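(* Let $\Omega\subseteq\mathbb{R}^n$ be an open set, $m\ge1$ a natural number, $p\in[1,\infty)$, $\mathcal{G}$ a subgroup of $\mathrm{SO}(n)$ and $D\subseteq\mathbb{R}^n$ a bounded open set. Let $\alpha_p$ be a $p$-core functional with domain $L^p_{\mathrm{loc}}(\mathbb{R}^n;\mathbb{R}^m)\times\mathcal{G}^D(\mathbb{R}^n)$. Assume also that for every $D'\in\mathcal{G}^D(\mathbb{R}^n)$ the restriction of $\alpha_p(\cdot,D')$ to $L^p(\mathbb{R}^n;\mathbb{R}^m)$ is a lower semicontinuous functional $L^p(\mathbb{R}^n;\mathbb{R}^m)\to[0,+\infty)$. Let $\mathcal{P}$ be a linear subspace of $\mathbb{R}^{m\times n}$ with $\mathbb{R}^{m\times n}=\mathcal{P}\oplus\mathcal{N}_{\psi_{\alpha_p}}$ and let $\pi_{\mathcal{P}}:\mathbb{R}^{m\times n}\to\mathcal{P}$ be the projection associated with this decomposition. Let $\{\rho_\sigma\}_{\sigma>0}\subset C^\infty_c(\mathbb{R}^n)$ be a family of standard mollifiers and let $\tilde\Omega\Subset\Omega$ be open. Then there is a constant $C>0$ depending on $\psi_{\alpha_p}$ such that, for every $u\in L^p_{\mathrm{loc}}(\mathbb{R}^n;\mathbb{R}^m)$ and every $0<\sigma<\operatorname{dist}(\tilde\Omega,\partial\Omega)$, setting $u_\sigma:=\rho_\sigma*u$, $$C\int_{\tilde\Omega}|\pi_{\mathcal{P}}(\nabla u_\sigma)|_2^p\,\mathrm{d}x\le\int_{\tilde\Omega}\psi_{\alpha_p}(\nabla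 u_\sigma)\,\mathrm{d}x=G^{\alpha_p}(u_\sigma,\tilde\Omega)\le G^{\alpha_p}_-(u,\Omega).$$
   Context: Notation. $|\cdot|_2$ is the Euclidean norm on $\mathbb{R}^d$; for a matrix $A$, $|A|_2=\sup\{|Ax|_2:|x|_2\le1\}$; $l^A(x)=Ax$; $Q=(-\frac12,\frac12)^n$. For a subgroup $\mathcal{G}$ of $\mathrm{SO}(n)$, $\Gamma^{\mathcal{G}}$ is the group of all maps $x\mapsto\varepsilon\mathcal{R}x+h$ with $\varepsilon>0$, $\mathcal{R}\in\mathcal{G}$, $h\in\mathbb{R}^n$. $\mathcal{G}^D_\varepsilon(\Omega)$ is the class of all sets $\varepsilon\mathcal{R}D+h$ ($\mathcal{R}\in\mathcal{G}$, $h\in\mathbb{R}^n$) contained in $\Omega$, and $\mathcal{G}^D(\Omega)=\bigcup_{\varepsilon>0}\mathcal{G}^D_\varepsilon(\Omega)$. Standard mollifiers: $\rho_\sigma(x)=\sigma^{-n}\rho(x/\sigma)$, where $\rho\in C_c^\infty(\mathbb{R}^n)$ is radial, nonnegative, has integral $1$ and $\operatorname{supp}\rho\subset B_1(0)$. $p$-core functional. A function $\alpha_p:L^p_{\mathrm{loc}}(\mathbb{R}^n;\mathbb{R}^m)\times\mathcal{G}^D(\mathbb{R}^n)\to[0,+\infty)$ is a $p$-core functional (with reference set $D$, subordinated to $\Gamma^{\mathcal{G}}$) if, for all $D'\in\mathcal{G}^D(\mathbb{R}^n)$ and $u,v\in L^p_{\mathrm{loc}}(\mathbb{R}^n;\mathbb{R}^m)$: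 (i) $\alpha_p(u,D')=\alpha_p(v,D')$ whenever $u|_{D'}=v|_{D'}$; (ii) $\alpha_p(\cdot,D')$ is convex; (iii) $\alpha_p(tu,D')=|t|^p\alpha_p(u,D')$ for all $t\in\mathbb{R}$; (iv) $\alpha_p(u+h,D')=\alpha_p(u,D')$ for all $h\in\mathbb{R}^m$; (v) $\alpha_p(u\circ F,D')=\alpha_p(u,F(D'))$ for all $F\in\Gamma^{\mathcal{G}}$; (vi) there is $c_1>0$ such that $\alpha_p(u,D)\le c_1\int_D|\nabla u|_2^p\,\mathrm{d}x$ for all $u\in L^p_{\mathrm{loc}}(\mathbb{R}^n;\mathbb{R}^m)$ with $u|_D\in W^{1,p}(D;\mathbb{R}^m)$. BMO-type seminorm. $G^{\alpha_p}_\varepsilon(u,\Omega)=\varepsilon^{n-p}\sup_{\mathcal{G}_\varepsilon}\sum_{D'\in\mathcal{G}_\varepsilon}\alpha_p(u,D')$, the supremum being over all families $\mathcal{G}_\varepsilon$ of pairwise disjoint elements of $\mathcal{G}^D_\varepsilon(\Omega)$ (an empty family contributes $0$). $G^{\alpha_p}_-(u,\Omega)=\liminf_{\varepsilon\to0^+}G^{\alpha_p}_\varepsilon(u,\Omega)$, and $G^{\alpha_p}(u,\Omega)=\lim_{\varepsilon\to0^+}G^{\alpha_p}_\varepsilon(u,\Omega)$ when this limit exists. $\psi_{\alpha_p}(A)=G^{\alpha_p}(l^A,Q)$ for $A\in\mathbb{R}^{m\times n}$ (the limit exists in $[0,\infty)$), and $\mathcal{N}_{\psi_{\alpha_p}}=\{A:\psi_{\alpha_p}(A)=0\}$,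 a linear subspace of $\mathbb{R}^{m\times n}$. *)

(* Defs.v *)
From HB Require Import structures.
From mathcomp Require Import all_boot all_order all_algebra.
From mathcomp Require Import all_classical all_reals all_analysis.

Set Implicit Arguments.
Unset Strict Implicit.
Unset Printing Implicit Defensive.

Import Order.TTheory GRing.Theory Num.Theory.
Import numFieldNormedType.Exports.

Local Open Scope classical_set_scope.
Local Open Scope ring_scope.

(* Points of R^n are column vectors 'cV[R]_n, so that l^A(x) is A *m x. *)

Definition measure_matrix_display : measure_display -> measure_display.
Proof. exact. Qed.

Section measurable_matrix.
Context {d} {T : sigmaRingType d} (m n : nat).

Definition mx_cylinder : set (set 'M[T]_(m, n)) :=
  [set A | exists i j, exists2 B : set T,
     measurable B & A = (fun M : 'M[T]_(m, n) => M i j) @^-1` B].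

(* The product sigma-algebra; over T = R it is the Borel sigma-algebra of
   R^(m x n), since R is second countable. *)
HB.instance Definition _ := @isMeasurable.Build (measure_matrix_display d)
  'M[T]_(m, n) <<s mx_cylinder >> (@sigma_algebra0 _ setT mx_cylinder)
  (@sigma_algebraC _ mx_cylinder) (@sigma_algebra_bigcup _ setT mx_cylinder).

Lemma measurable_entry i j :
  measurable_fun setT (fun M : 'M[T]_(m, n) => M i j).
Proof.
move=> _ B mB; rewrite setTI; apply: sub_sigma_algebra.
by exists i, j, B.
Qed.

Lemma measurable_mxP d' (T' : measurableType d') (f : T' -> 'M[T]_(m, n)) :
  (forall i j, measurable_fun setT (fun x => f x i j)) ->
  measurable_fun setT f.
Proof.
move=> mf; apply: (@measurability _ _ _ _ _ _ mx_cylinder) => //.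
move=> _ [_ [i [j [B mB ->]]] <-].
exact: mf.
Qed.

End measurable_matrix.

Section lebesgue_cons.
Context {R : realType} (n : nat).

Definition cv_cons (p : R * 'cV[R]_n) : 'cV[R]_n.+1 :=
  \col_i (if unlift ord0 i is Some j then p.2 j 0 else p.1).

Definition cv_uncons (x : 'cV[R]_n.+1) : R * 'cV[R]_n :=
  (x ord0 0, \col_i x (lift ord0 i) 0).

Lemma cv_consK : cancel cv_cons cv_uncons.
Proof.
move=> [a x]; congr pair; first by rewrite mxE unlift_none.
by apply/colP => i; rewrite !mxE liftK.
Qed.

Lemma measurable_cv_cons : measurable_fun setT cv_cons.
Proof.
apply: measurable_mxP => i j; under eq_fun do rewrite mxE.
case: unliftP => [k _|_]; last exact: measurable_fst.
exact: measurableT_comp (measurable_entry _ _) measurable_snd.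
Qed.

Lemma measurable_cv_uncons : measurable_fun setT cv_uncons.
Proof.
apply: measurable_fun_pair; first exact: measurable_entry.
apply: measurable_mxP => i j; under eq_fun do rewrite mxE.
exact: measurable_entry.
Qed.

Variable mu : {sigma_finite_measure set 'cV[R]_n -> \bar R}.

Definition leb_cons : set 'cV[R]_n.+1 -> \bar R :=
  pushforward (lebesgue_measure \x mu)%E cv_cons.

HB.instance Definition _ := Measure.copy leb_cons
  (measure_function_pushforward__canonical__measure_function_Measure
     (lebesgue_measure \x mu)%E measurable_cv_cons).

Lemma leb_cons_sigma_finite : sigma_finite setT leb_cons.
Proof.
have /sigma_finiteP[F [TF ndF Foo]] :=
  sigma_finiteT (@lebesgue_measure R).
have /sigma_finiteP[G [TG ndG Goo]] := sigma_finiteT mu.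
exists (fun k => cv_uncons @^-1` (F k `*` G k)).
  rewrite -preimage_bigcup -[LHS](preimage_setT cv_uncons); congr preimage.
  apply/seteqP; split=> // -[x y] _ /=.
  have [k _ Fkx] : (\bigcup_k F k) x by rewrite -TF.
  have [l _ Gly] : (\bigcup_l G l) y by rewrite -TG.
  exists (maxn k l) => //; split.
    by move: x Fkx; exact/subsetPset/ndF/leq_maxl.
  by move: y Gly; exact/subsetPset/ndG/leq_maxr.
move=> k; have [mF Fk] := Foo k; have [mG Gk] := Goo k; split.
  rewrite -[X in measurable X]setTI; apply: measurable_cv_uncons => //.
  exact: measurableX.
rewrite /leb_cons /pushforward -comp_preimage (_ : _ \o _ = id); last first.
  by apply/funext => p; exact: cv_consK.
by rewrite preimage_id product_measure1E// lte_mul_pinfty// ge0_fin_numE.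
Qed.

HB.instance Definition _ := Measure_isSigmaFinite.Build _ _ _ leb_cons
  leb_cons_sigma_finite.

End lebesgue_cons.

(* Lebesgue measure on R^n, by iterated products; leb 0 is the unit mass on the
   one-point space. *)
Fixpoint leb {R : realType} (n : nat) :
    {sigma_finite_measure set 'cV[R]_n -> \bar R} :=
  match n with
  | 0 => \d_(0 : 'cV[R]_0)
  | k.+1 => leb_cons (leb k)
  end.

Section euclidean.
Context {R : realType}.

Definition enorm n (x : 'cV[R]_n) : R := Num.sqrt (\sum_i x i 0 ^+ 2).

Definition opnorm m n (A : 'M[R]_(m, n)) : R :=
  sup [set enorm (A *m x) | x in [set x : 'cV[R]_n | enorm x <= 1]].

Definition partial n (j : 'I_n) (f : 'cV[R]_n -> R) : 'cV[R]_n -> R :=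
  fun x => 'D_(delta_mx j 0) f x.

Definition grad m n (u : 'cV[R]_n -> 'cV[R]_m) (x : 'cV[R]_n) : 'M[R]_(m, n) :=
  \matrix_(i, j) partial j (fun y => u y i 0) x.

Fixpoint Ck n (k : nat) (f : 'cV[R]_n -> R) : Prop :=
  match k with
  | 0 => continuous f
  | k'.+1 => continuous f /\ forall j : 'I_n,
      (forall x, derivable f x (delta_mx j 0)) /\ Ck k' (partial j f)
  end.

Definition smooth n (f : 'cV[R]_n -> R) : Prop := forall k, Ck k f.

Definition tsupport n (f : 'cV[R]_n -> R) : set 'cV[R]_n :=
  closure [set x | f x != 0].

Definition test_function n (A : set 'cV[R]_n) (f : 'cV[R]_n -> R) : Prop :=
  [/\ smooth f, compact (tsupport f) & tsupport f `<=` A].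

(* +oo when one of the two sets is empty, e.g. dist(A, boundary of R^n). *)
Definition euclid_dist n (A B : set 'cV[R]_n) : \bar R :=
  ereal_inf [set (enorm (x - y))%:E | x in A & y in B].

Definition boundary n (A : set 'cV[R]_n) : set 'cV[R]_n :=
  closure A `\` interior A.

Definition compactly_contained n (A B : set 'cV[R]_n) : Prop :=
  compact (closure A) /\ closure A `<=` B.

End euclidean.

(* Elements of L^p and L^p_loc are Borel functions defined everywhere; equality
   of classes is equality leb-almost everywhere. *)

Section function_spaces.
Context {R : realType} (m n : nat) (p : R).
Implicit Types (u v : 'cV[R]_n -> 'cV[R]_m) (g : 'cV[R]_n -> 'M[R]_(m, n)).
Implicit Types A : set 'cV[R]_n.

Definition Lp_on A u : Prop :=
  measurable_fun A u /\
  (\int[leb n]_(x in A) ((enorm (u x)) `^ p)%:E < +oo)%E.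

Definition Lp u : Prop := Lp_on setT u.

Definition Lploc u : Prop :=
  measurable_fun setT u /\ forall K, compact K -> Lp_on K u.

Definition Lp_dist u v : \bar R :=
  Lnorm (leb n) p%:E (fun x => (enorm (u x - v x))%:E).

Definition lsc_Lp (Phi : ('cV[R]_n -> 'cV[R]_m) -> R) : Prop :=
  forall u, Lp u -> forall a, a < Phi u ->
    exists2 e : R, 0 < e &
      forall v, Lp v -> (Lp_dist u v < e%:E)%E -> a < Phi v.

Definition weak_gradient A u g : Prop :=
  forall phi, test_function A phi -> forall i j,
    \int[leb n]_(x in A) (u x i 0 * partial j phi x) =
    - \int[leb n]_(x in A) (g x i j * phi x).

(* u restricted to A is in W^{1,p}(A; R^m), with weak gradient g. *)
Definition W1p_with_gradient A u g : Prop :=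
  [/\ Lp_on A u, measurable_fun A g,
      (\int[leb n]_(x in A) ((opnorm (g x)) `^ p)%:E < +oo)%E &
      weak_gradient A u g].

End function_spaces.

Section core_functional.
Context {R : realType} (m n : nat) (p : R).
Implicit Types (u v : 'cV[R]_n -> 'cV[R]_m).
Variables (G : set 'M[R]_n) (D : set 'cV[R]_n).
Variable alpha : ('cV[R]_n -> 'cV[R]_m) -> set 'cV[R]_n -> R.

Definition SO : set 'M[R]_n := [set A | A^T *m A = 1%:M /\ \det A = 1].

Definition SO_subgroup : Prop :=
  [/\ G `<=` SO, G 1%:M, (forall A B, G A -> G B -> G (A *m B)) &
      forall A, G A -> G (invmx A)].

Definition similarity (e : R) (A : 'M[R]_n) (h : 'cV[R]_n) :
    'cV[R]_n -> 'cV[R]_n :=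
  fun x => e *: (A *m x) + h.

Definition Gamma : set ('cV[R]_n -> 'cV[R]_n) :=
  [set F | exists e A h, [/\ 0 < e, G A & F = similarity e A h]].

Definition copies (e : R) (Omega : set 'cV[R]_n) : set (set 'cV[R]_n) :=
  [set D' | exists A h,
    [/\ G A, D' = similarity e A h @` D & D' `<=` Omega]].

Definition all_copies (Omega : set 'cV[R]_n) : set (set 'cV[R]_n) :=
  \bigcup_(e in [set e : R | 0 < e]) copies e Omega.

(* alpha is a total function; only its values on L^p_loc and on copies of D
   are meaningful. *)
Record p_core_functional : Prop := {
  core_ge0 : forall u D', Lploc p u -> all_copies setT D' -> 0 <= alpha u D' ;
  core_local : forall u v D', Lploc p u -> Lploc p v -> all_copies setT D' ->
    {ae leb n, forall x, D' x -> u x = v x} -> alpha u D' = alpha v D' ;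
  core_convex : forall u v D' (t : R), Lploc p u -> Lploc p v ->
    all_copies setT D' -> 0 <= t <= 1 ->
    alpha (fun x => t *: u x + (1 - t) *: v x) D' <=
      t * alpha u D' + (1 - t) * alpha v D' ;
  core_homogeneous : forall u D' (t : R), Lploc p u -> all_copies setT D' ->
    alpha (fun x => t *: u x) D' = `|t| `^ p * alpha u D' ;
  core_translation : forall u D' (h : 'cV[R]_m), Lploc p u ->
    all_copies setT D' -> alpha (fun x => u x + h) D' = alpha u D' ;
  core_similarity : forall u D' F, Lploc p u -> all_copies setT D' ->
    Gamma F -> alpha (u \o F) D' = alpha u (F @` D') ;
  core_bound : exists2 c : R, 0 < c & forall u g, Lploc p u ->
    W1p_with_gradient p D u g ->
    ((alpha u D)%:E <=
      c%:E * \int[leb n]_(x in D) ((opnorm (g x)) `^ p)%:E)%E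
}.

Definition bmo_eps (e : R) u (Omega : set 'cV[R]_n) : \bar R :=
  ((e `^ (n%:R - p))%:E *
   ereal_sup [set \esum_(D' in F) (alpha u D')%:E |
               F in [set F | F `<=` copies e Omega /\ trivIset F id]])%E.

Definition bmo_inf u (Omega : set 'cV[R]_n) : \bar R :=
  limf_einf (fun e => bmo_eps e u Omega) 0^'+.

Definition has_bmo u (Omega : set 'cV[R]_n) : Prop :=
  cvg (bmo_eps e u Omega @[e --> 0^'+]).

(* Meaningful only under has_bmo u Omega. *)
Definition bmo u (Omega : set 'cV[R]_n) : \bar R :=
  lim (bmo_eps e u Omega @[e --> 0^'+]).

Definition open_cube : set 'cV[R]_n :=
  [set x | forall i, - 2^-1 < x i 0 < 2^-1].

Definition core_psi (A : 'M[R]_(m, n)) : \bar R :=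
  bmo (fun x => A *m x) open_cube.

Definition core_null : set 'M[R]_(m, n) := [set A | core_psi A = 0%E].

End core_functional.

Section direct_sum.
Context {R : realType} (m n : nat).
Variables (P : {vspace 'M[R]_(m, n)}) (N : set 'M[R]_(m, n)).

Definition direct_sum_decomposition : Prop :=
  (forall A, exists B C, [/\ B \in P, N C & A = B + C]) /\
  [set` P] `&` N = [set 0].

Definition projection_along (pi : 'M[R]_(m, n) -> 'M[R]_(m, n)) : Prop :=
  forall A, pi A \in P /\ N (A - pi A).

End direct_sum.

Section mollifier.
Context {R : realType} (m n : nat).

Definition standard_kernel (rho : 'cV[R]_n -> R) : Prop :=
  [/\ test_function [set x | enorm x < 1] rho,
      forall x y, enorm x = enorm y -> rho x = rho y,
      forall x, 0 <= rho x &
      (\int[leb n]_x (rho x)%:E = 1)%E].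

Definition mollifier (rho : 'cV[R]_n -> R) (s : R) (x : 'cV[R]_n) : R :=
  s ^- n * rho (s^-1 *: x).

Definition convolution (f : 'cV[R]_n -> R) (u : 'cV[R]_n -> 'cV[R]_m)
    (x : 'cV[R]_n) : 'cV[R]_m :=
  \col_i \int[leb n]_y (f (x - y) * u y i 0).

End mollifier.

(* Main.v *)
(** Let psi(A) be the supremum, over all scales e and all packings of the unit
    cube by copies of size e of D, of the sums e^(n-p) sum alpha(l^A, D').
    Filling the cube with small copies of itself carries an almost optimal
    packing to every smaller scale, so psi = psi_alpha.

    Convexity and p-homogeneity give
      alpha(u + w) <= (1-l)^(1-p) alpha(u) + l^(1-p) alpha(w),
    and alpha(w, D') <= c e^p h^p when |grad w| <= h on a copy D' of size e.
    Hence, for v of class C^1, replacing v by an affine map on each cell of a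
    fine grid costs little, and the limit for v is the integral of psi(grad v).

    The mollification u_s is, in L^p on bounded sets, a limit of averages
    N^-1 sum_i u(x + z_i) with |z_i| < s.  For bounded u the z_i are found
    greedily in L^2: the cross term with the error accumulated so far has mean
    zero under the mollifier, so some z makes it nonpositive.  Lower
    semicontinuity, convexity and translation invariance then show that a
    packing of Omega' has, for u_s, at most the largest sum of its translates,
    which are packings of Omega, for u.

    Finally psi does not change under addition of a matrix in its null set and
    has a positive minimum on the unit sphere of P, whence the first
    inequality. *)

Require Import Defs.
From mathcomp Require Import all_boot all_order all_algebra.
From mathcomp Require Import all_classical all_reals all_analysis.
From mathcomp Require Import measurable_realfun.
From mathcomp Require Import ring lra.

Set Implicit Arguments.
Unset Strict Implicit.
Unset Printing Implicit Defensive.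

Import Order.TTheory GRing.Theory Num.Theory.
Import numFieldNormedType.Exports.

Local Open Scope classical_set_scope.
Local Open Scope ring_scope.

(** * Borel sets and Lebesgue measure on R^n *)

(** The factor e^(n-p) makes all sums scale like volume: at most a multiple of e^-n |U| disjoint
    copies of size e fit into U, each of energy at most a multiple of e^p h^p, so a packing of U
    contributes at most C h^p |U|, uniformly in e. This one estimate bounds psi, controls the
    replacement of v by an affine map, and disposes of the copies that lie in no grid cell: being
    small, they avoid slightly shrunken cells and so sit in a set of small measure.

    Jensen's inequality is applied to finite averages instead of the integral defining u_s: there it
    needs convexity alone, and semicontinuity enters once, at the limit. Expanding squares serves
    every p because the samples are drawn for a truncation of u, and for bounded functions smallness
    in L^2 gives smallness in L^p. The tail of u is estimated uniformly over the admissible samples,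
    so the truncation level can be fixed first.

    The norm of vectors and matrices is the sup norm, whose balls are cubes, of measure read off
    from the iterated product. Euclidean and operator norms are compared with it up to factors m and
    n. *)

Section matrix_norm.
Context {R : realType}.

Lemma ler_mx_norm_entry m n (A : 'M[R]_(m, n)) i j : `|A i j| <= `|A|.
Proof.
rewrite [leRHS]mx_normrE.
by rewrite (le_bigmax _ (fun ij => `|A ij.1 ij.2|) (i, j)).
Qed.

Lemma mx_norm_le m n (A : 'M[R]_(m, n)) (c : R) : 0 <= c ->
  (forall i j, `|A i j| <= c) -> `|A| <= c.
Proof. by move=> c0 Ac; rewrite [leLHS]mx_normrE bigmax_le. Qed.

Lemma mx_norm_lt m n (A : 'M[R]_(m, n)) (c : R) : 0 < c ->
  (forall i j, `|A i j| < c) -> `|A| < c.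
Proof. by move=> c0 Ac; rewrite [ltLHS]mx_normrE bigmax_lt. Qed.

Lemma continuous_mx_entries (T : topologicalType) m n (f : T -> 'M[R]_(m, n)) x :
  (forall i j, {for x, continuous (fun y => f y i j)}) -> {for x, continuous f}.
Proof.
move=> fc; apply/cvgrPdist_lt => e e0.
suff : \forall t \near x, forall i j, `|f x i j - f t i j| < e.
  by apply: filterS => t tx; apply: mx_norm_lt => // i j; rewrite !mxE.
apply: filter_forall => i; apply: filter_forall => j.
by have /cvgrPdist_lt/(_ _ e0) := fc i j.
Qed.

End matrix_norm.

Section matrix_borel.
Context {R : realType}.

Let rat_ball m n (p : 'M[rat]_(m, n) * nat) : set 'M[R]_(m, n) :=
  [set y | forall i j, `|ratr (p.1 i j) - y i j| < p.2.+1%:R^-1].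

Lemma measurable_forall_fin d (T : measurableType d) (I : finType)
    (A : I -> set T) :
  (forall i, measurable (A i)) -> measurable [set x | forall i, A i x].
Proof.
move=> mA.
rewrite [X in measurable X](_ : _ = \bigcap_(i in [set: I]) A i); last first.
  by apply/seteqP; split => x /= Ax i; [move=> _; exact: Ax|exact: (Ax i Logic.I)].
by apply: fin_bigcap_measurable => //; exact: finite_finset.
Qed.

(** The sigma-algebra is generated by the entries, so openness has to pass through countably many
    boxes: those with rational centre and radius [1/(k+1)] that lie in [U]. *)
Lemma open_measurable_mx m n (U : set 'M[R]_(m, n)) : open U -> measurable U.
Proof.
move=> oU.
have -> : U = \bigcup_(p : {p : 'M[rat]_(m, n) * nat | `[< rat_ball p `<=` U >]})
    rat_ball (sval p).
  apply/seteqP; split => [x Ux|x [[p pU] _]]; last exact: (asboolW pU).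
  have /nbhs_ballP[e /= e0 eU] : nbhs x U by exact: open_nbhs_nbhs.
  (* Half of [e]: a point of the rational box differs from [x] by less than twice the radius. *)
  have [k ke] : exists k, k.+1%:R^-1 < e / 2.
    have [k _ /= kP] := near_infty_natSinv_lt (PosNum (divr_gt0 e0 (ltr0n R 2))).
    by exists k; exact: kP (leqnn _).
  have k0 : 0 < k.+1%:R^-1 :> R by rewrite invr_gt0.
  have xq i j : exists q : rat, `|ratr q - x i j| < k.+1%:R^-1.
    have [|q] := @rat_in_itvoo R (x i j - k.+1%:R^-1) (x i j + k.+1%:R^-1).
      by rewrite ltrBlDr -addrA ltrDl addr_gt0.
    by rewrite in_itv /= -ltr_distl => ?; exists q.
  pose q := \matrix_(i, j) sval (cid (xq i j)).
  have qP i j : `|ratr (q i j) - x i j| < k.+1%:R^-1.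
    by rewrite mxE; case: cid.
  have qU : `[< rat_ball (q, k) `<=` U >].
    apply/asboolP => y qy; apply: eU; rewrite -ball_normE /ball_ /=.
    apply: mx_norm_lt => // i j; rewrite !mxE.
    have /= := qy i j; have := qP i j; move: ke.
    move: (_^-1) => d ?; rewrite !ltr_distl => /andP[? ?] /andP[? ?].
    by apply/andP; split; lra.
  by exists (exist _ (q, k) qU).
apply: countable_bigcupT_measurable.
  exact: countableP.
move=> [p _] /=; apply: measurable_forall_fin => i; apply: measurable_forall_fin => j.
rewrite [X in measurable X](_ : _ = (fun M : 'M[R]_(m, n) => M i j) @^-1` (ball (ratr (p.1 i j) : R) p.2.+1%:R^-1)); last first.
  by rewrite -ball_normE.
rewrite -[X in measurable X]setTI; apply: measurable_entry => //.
exact: measurable_ball.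
Qed.

Lemma closed_measurable_mx m n (U : set 'M[R]_(m, n)) : closed U -> measurable U.
Proof.
by move=> cU; rewrite -(setCK U); apply: measurableC; apply: open_measurable_mx; rewrite openC.
Qed.

Lemma continuous_measurable_mx m n (f : 'M[R]_(m, n) -> R) :
  continuous f -> measurable_fun setT f.
Proof.
move=> cf; apply: (measurability _ (RGenOpens.measurableE R)).
move=> _ [_ [a [b ->] <-]]; rewrite setTI; apply: open_measurable_mx.
by apply: open_comp => // x _; exact: cf.
Qed.

End matrix_borel.

(** * Translation invariance of Lebesgue measure *)

Section lebesgue_translation.
Context {R : realType}.

Lemma leb_cube n (S : 'I_n -> set R) (t : R) : 0 <= t ->
  (forall i, measurable (S i)) -> (forall i, lebesgue_measure (S i) = t%:E) ->
  leb n [set x : 'cV[R]_n | forall i, S i (x i 0)] = (t ^+ n)%:E.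
Proof.
move=> t0; elim: n S => [|n IH] S mS St.
  by rewrite /= diracE expr0 (mem_set _)// => -[].
rewrite /= /leb_cons /pushforward.
rewrite (_ : _ @^-1` _ = S ord0 `*` [set y : 'cV[R]_n | forall i, S (lift ord0 i) (y i 0)]).
  rewrite product_measure1E; [|exact: mS|]; last first.
    apply: (@measurable_forall_fin _ 'cV[R]_n) => i; rewrite -[X in measurable X]setTI.
    exact: measurable_entry.
  have E := IH (fun i => S (lift ord0 i)) (fun i => mS _) (fun i => St _).
  rewrite exprS EFinM; exact: (f_equal2 mule (St ord0) E).
apply/seteqP; split => -[a y] /= Sx.
  split; first by have := Sx ord0; rewrite mxE unlift_none.
  by move=> i; have := Sx (lift ord0 i); rewrite mxE liftK.
by move=> i; rewrite mxE; case: unliftP => [j ->|->]; [apply Sx.2|apply Sx.1].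
Qed.

(** The image of Lebesgue measure under a translation agrees with it on half-open intervals, and
    these determine it. *)
Lemma lebesgue_measure_shift (h : R) (A : set R) : measurable A ->
  lebesgue_measure [set x | A (x + h)] = lebesgue_measure A.
Proof.
move=> mA.
have mf : measurable_fun setT (fun x : R => x + h : measurableTypeR R) by exact: measurable_funD.
pose mu := measure_function_pushforward__canonical__measure_function_Measure
  (@lebesgue_measure R) mf.
rewrite (@lebesgue_measure_unique _ mu _ A mA)// => X [[a b] /= _ <-].
rewrite /mu /= /pushforward.
rewrite (_ : _ @^-1` _ = `]a - h, b - h]%classic); last first.
  by apply/seteqP; split => x /=; rewrite !in_itv /= => /andP[? ?]; apply/andP; split; lra.
rewrite !lebesgue_measure_itv/= !lte_fin ltrD2r.
by case: ifP => // _; rewrite -!EFinD; congr EFin; lra.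
Qed.

Lemma measurable_addr_mx m n (h : 'M[R]_(m, n)) : measurable_fun setT (fun x : 'M[R]_(m, n) => x + h).
Proof.
apply: measurable_mxP => i j; under eq_fun do rewrite mxE.
by apply: measurable_funD => //; exact: measurable_entry.
Qed.

Lemma ge0_integral_lebesgue_shift (h : R) (f : R -> \bar R) :
  measurable_fun [set: R] f -> (forall x, 0 <= f x)%E ->
  (\int[lebesgue_measure]_x f (x + h)%R = \int[lebesgue_measure]_x f x)%E.
Proof.
move=> mf f0.
have ma : measurable_fun setT (fun x : R => x + h : measurableTypeR R) by exact: measurable_funD.
pose mu := measure_function_pushforward__canonical__measure_function_Measure
  (@lebesgue_measure R) ma.
transitivity (\int[mu]_x f x)%E.
  by rewrite ge0_integral_pushforward//.
by apply: eq_measure_integral => A mA _; exact: lebesgue_measure_shift.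
Qed.

(** Induction on the dimension: sections of the translated set are translated sections over a
    translated base point, and the outer integral over the line is translation invariant. *)
Lemma leb_shift n (h : 'cV[R]_n) (A : set 'cV[R]_n) : measurable A ->
  leb n [set x | A (x + h)] = leb n A.
Proof.
elim: n h A => [|n IH] h A mA.
  congr (leb 0 _); apply/seteqP; split => x /=; rewrite (_ : x + h = x)//;
  by apply/colP => -[].
rewrite /= /leb_cons /pushforward /= /product_measure1 /=.
pose h' : 'cV[R]_n := \col_i h (lift ord0 i) 0.
set B := @cv_cons R n @^-1` A.
have mB : measurable B.
  by rewrite -[X in measurable X]setTI; exact: measurable_cv_cons.
transitivity (\int[lebesgue_measure]_x leb n (xsection B ((x : R) + h ord0 0)%R))%E.
  apply: eq_integral => x _ /=.
  rewrite -[RHS](IH h'); last by apply: measurable_xsection.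
  congr (leb n _); apply/seteqP; split => y /=; rewrite /xsection /= !inE /B /=;
    rewrite (_ : cv_cons (x, y) + h = cv_cons (x + h ord0 0, y + h'))//;
    apply/colP => i; rewrite !mxE; case: unliftP => [j ->|->]; by rewrite ?mxE.
rewrite (ge0_integral_lebesgue_shift (h ord0 0) (f := fun x => leb n (xsection B x)))//.
exact: measurable_fun_xsection.
Qed.

Lemma ge0_integral_shift n (h : 'cV[R]_n) (f : 'cV[R]_n -> \bar R) :
  measurable_fun [set: 'cV[R]_n] f -> (forall x, 0 <= f x)%E ->
  (\int[leb n]_x f (x + h)%R = \int[leb n]_x f x)%E.
Proof.
move=> mf f0.
pose mu := measure_function_pushforward__canonical__measure_function_Measure
  (leb n) (measurable_addr_mx h).
transitivity (\int[mu]_x f x)%E.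
  rewrite ge0_integral_pushforward//.
  exact: measurable_addr_mx.
by apply: eq_measure_integral => A mA _; exact: leb_shift.
Qed.

Lemma integral_shift n (h : 'cV[R]_n) (f : 'cV[R]_n -> \bar R) :
  measurable_fun [set: 'cV[R]_n] f ->
  (\int[leb n]_x f (x + h)%R = \int[leb n]_x f x)%E.
Proof.
move=> mf; rewrite integralE [RHS]integralE; congr (_ - _)%E.
  rewrite -(ge0_integral_shift h (measurable_funepos mf) (funepos_ge0 f)).
  by apply: eq_integral => x _; rewrite !funeposE.
rewrite -(ge0_integral_shift h (measurable_funeneg mf) (funeneg_ge0 f)).
by apply: eq_integral => x _; rewrite !funenegE.
Qed.

End lebesgue_translation.

Section cball.
Context {R : realType}.

(** A cube, since the norm of a column is the largest modulus of its entries. *)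
Definition cball n (r : R) : set 'cV[R]_n := [set x | `|x| <= r].

Lemma cballP n r (x : 'cV[R]_n) : 0 <= r ->
  cball r x <-> forall i, x i 0 \in `[- r, r].
Proof.
move=> r0; split=> [xr i|xr].
  by rewrite in_itv /= -ler_norml (le_trans _ xr)// ler_mx_norm_entry.
apply: mx_norm_le => // i j; rewrite ord1 ler_norml.
by have := xr i; rewrite in_itv.
Qed.

Lemma cball_lt0 n (r : R) : r < 0 -> @cball n r = set0.
Proof. by move=> r0; rewrite -subset0 => x /= /(le_trans (normr_ge0 _)); rewrite leNgt r0. Qed.

Lemma compact_cball n (r : R) : 0 <= r -> compact (@cball n r).
Proof.
move=> r0.
have cT : compact [set v : 'rV[R]_n | forall i, `[- r, r]%classic (v ord0 i)].
  by apply: (@rV_compact R n (fun=> `[- r, r]%classic)) => i; exact: segment_compact.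
rewrite (_ : cball r = [set v^T | v in [set v : 'rV[R]_n | forall i, `[- r, r]%classic (v ord0 i)]]).
  apply: continuous_compact => //; apply: continuous_subspaceT => v.
  apply: continuous_mx_entries => i j.
  rewrite (_ : (fun y => _) = (fun y : 'rV[R]_n => y j i)); first exact: coord_continuous.
  by apply/funext => y; rewrite mxE.
apply/seteqP; split => [x /(cballP _ r0) xr|_ [v vr <-]].
  by exists (x^T); rewrite ?trmxK// => i; rewrite /= mxE; exact: xr.
by apply/(cballP _ r0) => i; rewrite mxE; exact: vr.
Qed.

Lemma measurable_cball n r : measurable (@cball n r).
Proof.
apply: closed_measurable_mx.
rewrite (_ : cball r = Num.norm @^-1` [set y : R | y <= r])//.
apply: closed_comp; last exact: closed_le.
by move=> x _; apply: norm_continuous.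
Qed.

Lemma leb_cball n r : 0 <= r -> leb n (cball r) = ((2 * r) ^+ n)%:E.
Proof.
move=> r0.
rewrite (_ : cball r = [set x : 'cV[R]_n | forall i, [set` `[- r, r]] (x i 0)]); last first.
  by apply/seteqP; split => x; move/(cballP _ r0).
apply: (@leb_cube R n (fun=> `[- r, r]%classic)) => //; first by rewrite mulr_ge0.
move=> i; rewrite lebesgue_measure_itv /= lte_fin.
case: ifPn => [_|]; first by rewrite -EFinD; congr EFin; lra.
by rewrite -leNgt => ?; congr EFin; lra.
Qed.

Lemma leb_cball_lty n r : (leb n (cball r) < +oo)%E.
Proof.
have [r0|r0] := leP 0 r; first by rewrite leb_cball// ltry.
rewrite (_ : cball r = set0) ?measure0//; apply/seteqP; split => x //= xr.
by have := le_lt_trans (normr_ge0 _) (le_lt_trans xr r0); rewrite ltxx.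
Qed.

Lemma bounded_cball n (A : set 'cV[R]_n) : bounded_set A ->
  exists2 r : R, 0 < r & A `<=` cball r.
Proof.
move=> [M [_ MA]]; exists (`|M| + 1); first by rewrite ltr_wpDl.
by apply: MA; rewrite ltr_pwDr// ler_norm.
Qed.

Lemma continuous_dist n (V : normedModType R) (f : 'cV[R]_n -> V) x e : {for x, continuous f} -> 0 < e ->
  exists2 d : R, 0 < d & forall y, `|y - x| < d -> `|f y - f x| < e.
Proof.
move=> /cvgrPdist_lt/[apply] /nbhs_normP[d /= d0 dP]; exists d => // y yx.
by rewrite distrC; apply: dP; rewrite /= distrC.
Qed.

Lemma near_dist_continuous (T : topologicalType) (f : T -> R) (x : T) :
  (forall e : R, 0 < e -> \forall y \near x, `|f x - f y| <= e) ->
  {for x, continuous f}.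
Proof. by move=> H; apply/cvgrPdist_le. Qed.

Lemma dist_continuous n (f : 'cV[R]_n -> R) (x : 'cV[R]_n) :
  (forall e : R, 0 < e -> exists2 d : R, 0 < d &
    forall y, `|y - x| < d -> `|f y - f x| <= e) -> {for x, continuous f}.
Proof.
move=> H; apply: near_dist_continuous => e e0; have [d d0 dP] := H e e0.
by apply/nbhs_normP; exists d => //= y; rewrite /= distrC => /dP; rewrite distrC.
Qed.

Lemma dist_cvg_dnbhs0 (g : R -> R) l :
  (forall e, 0 < e -> exists2 d : R, 0 < d &
    forall h, h != 0 -> `|h| < d -> `|g h - l| <= e) -> g h @[h --> 0^'] --> l.
Proof.
move=> H; apply/cvgrPdist_le => e /H[d d0 dP].
near=> h; rewrite distrC; apply: dP; near: h.
  exact: nbhs_dnbhs_neq.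
exact: dnbhs0_lt.
Unshelve. all: by end_near. Qed.

(** Only [x] is confined to the ball. The point [y] may leave it, as comparisons of [f x] with
    [f (x + v)] near the boundary require. *)
Lemma unif_continuous_cball n (V : normedModType R) (f : 'cV[R]_n -> V) (r e : R) : 0 <= r ->
  continuous f -> 0 < e ->
  exists2 d : R, 0 < d & forall x y, `|x| <= r -> `|x - y| < d -> `|f x - f y| < e.
Proof.
move=> r0 cf e0.
have /compact_near_coveringP cov := @compact_cball n r r0.
pose P (d : R) (x : 'cV[R]_n) := forall y, `|x - y| < d -> `|f x - f y| < e.
have {}cov : \forall d \near 0^'+, cball r `<=` P d.
  apply: cov => x _; have e2 : 0 < e / 2 by rewrite divr_gt0.
  have [d d0 dP] := continuous_dist (cf x) e2.
  have d2 : 0 < d / 2 by rewrite divr_gt0.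
  exists (ball x (d / 2), [set t | t < d / 2]) => /=.
    by split; [exact: nbhsx_ballx|exact: nbhs_right_lt].
  move=> [x' t] /= [xx' td] y x'y.
  have {}xx' : `|x' - x| < d / 2 by move: xx'; rewrite -ball_normE /= distrC.
  have fx' : `|f x' - f x| < e / 2 by apply: dP; lra.
  have fy : `|f y - f x| < e / 2.
    apply: dP; rewrite (_ : y - x = (x' - x) - (x' - y)); last first.
      by apply/matrixP => i j; rewrite !mxE; ring.
    by rewrite (le_lt_trans (ler_normB _ _))//; lra.
  rewrite (_ : f x' - f y = (f x' - f x) - (f y - f x)); last by rewrite opprB addrA subrK.
  by rewrite (le_lt_trans (ler_normB _ _))//; lra.
near (0 : R)^'+ => d; exists d; first by near: d; exact: nbhs_right_gt.
by move=> x y xr; move: x xr y; near: d.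
Unshelve. all: by end_near. 
Qed.

Lemma continuous_bounded_cball n (f : 'cV[R]_n -> R) (r : R) :
  continuous f -> exists2 M : R, 0 < M & forall x, `|x| <= r -> `|f x| <= M.
Proof.
move=> cf; have [r0|r0] := leP 0 r; last first.
  exists 1 => // x xr; have := le_lt_trans (normr_ge0 x) (le_lt_trans xr r0).
  by rewrite ltxx.
have [||c _ cM] := compact_EVT_max (f := fun x => `|f x|) _ (@compact_cball n r r0).
- by exists 0; rewrite /cball /= normr0.
- apply: continuous_subspaceT => x; apply: continuous_comp; first exact: cf.
  exact: norm_continuous.
exists (`|f c| + 1); first by rewrite ltr_wpDl.
by move=> x xr; rewrite (le_trans (cM x _)) ?inE ?lerDl.
Qed.

End cball.

(** * Euclidean and operator norms against the sup norm *)

Section euclidean_norms.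
Context {R : realType}.

Lemma enorm_ge0 n (x : 'cV[R]_n) : 0 <= enorm x.
Proof. exact: sqrtr_ge0. Qed.

Lemma ler_entry_enorm n (x : 'cV[R]_n) i : `|x i 0| <= enorm x.
Proof.
rewrite -sqrtr_sqr ler_wsqrtr// (bigD1 i)//= lerDl sumr_ge0// => k _.
exact: sqr_ge0.
Qed.

Lemma ler_norm_enorm n (x : 'cV[R]_n) : `|x| <= enorm x.
Proof.
by apply: mx_norm_le => [|i j]; rewrite ?enorm_ge0// ord1 ler_entry_enorm.
Qed.

Lemma enorm_le_sum n (x : 'cV[R]_n) : enorm x <= \sum_i `|x i 0|.
Proof.
rewrite -[leRHS]ger0_norm ?sumr_ge0// -sqrtr_sqr ler_wsqrtr//.
rewrite expr2 mulr_suml ler_sum// => i _.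
rewrite -[leLHS]real_normK ?num_real// expr2 ler_wpM2l//.
by rewrite (bigD1 i)//= lerDl sumr_ge0.
Qed.

Lemma enorm_le_norm n (x : 'cV[R]_n) : enorm x <= n%:R * `|x|.
Proof.
rewrite (le_trans (enorm_le_sum x))//.
apply: le_trans (_ : \sum_(i < n) `|x| <= _); last first.
  by rewrite sumr_const card_ord mulr_natl.
by apply: ler_sum => i _; exact: ler_mx_norm_entry.
Qed.

Lemma enormZ n (t : R) (x : 'cV[R]_n) : enorm (t *: x) = `|t| * enorm x.
Proof.
rewrite /enorm -sqrtr_sqr -sqrtrM ?sqr_ge0// mulr_sumr.
by congr Num.sqrt; apply: eq_bigr => i _; rewrite mxE exprMn.
Qed.

Lemma mulmx_norm_le m n k (A : 'M[R]_(m, n)) (B : 'M[R]_(n, k)) :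
  `|A *m B| <= n%:R * `|A| * `|B|.
Proof.
apply: mx_norm_le => [|i j]; first by rewrite !mulr_ge0.
rewrite mxE (le_trans (ler_norm_sum _ _ _))//.
apply: le_trans (_ : \sum_(i < n) `|A| * `|B| <= _); last first.
  by rewrite sumr_const card_ord -[X in X <= _]mulr_natl mulrA.
apply: ler_sum => l _; rewrite normrM ler_pM//; exact: ler_mx_norm_entry.
Qed.

(** Both bounds on this supremum rest on the set being bounded, and nonempty through [x = 0]; the
    factors [m] and [n] come from the detour through the sup norm. *)
Lemma opnorm_bounds m n (A : 'M[R]_(m, n)) :
  0 <= opnorm A /\ opnorm A <= m%:R * n%:R * `|A|.
Proof.
have ub : ubound [set enorm (A *m x) | x in [set x : 'cV[R]_n | enorm x <= 1]]
    (m%:R * n%:R * `|A|).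
  move=> _ [x /= x1 <-]; rewrite (le_trans (enorm_le_norm _))//.
  rewrite -!mulrA ler_wpM2l// (le_trans (mulmx_norm_le _ _))//.
  by rewrite ler_piMr ?mulr_ge0// (le_trans (ler_norm_enorm _)).
have n0 : [set enorm (A *m x) | x in [set x : 'cV[R]_n | enorm x <= 1]] 0.
  exists 0 => /=; rewrite ?mulmx0 /enorm big1 ?sqrtr0// => i _;
  by rewrite mxE expr0n.
split; first by apply: ub_le_sup => //; eexists; exact: ub.
by apply: ge_sup => //; exists 0.
Qed.

Lemma opnorm0 m n : opnorm (0 : 'M[R]_(m, n)) = 0.
Proof.
have [oge0 o1] := opnorm_bounds (0 : 'M[R]_(m, n)).
by apply/eqP; rewrite eq_le oge0 (le_trans o1)// normr0 mulr0.
Qed.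

End euclidean_norms.

(** * Directional derivatives from continuous partial derivatives *)

Section C1.
Context {R : realType} (n : nat).
Implicit Types (f g : 'cV[R]_n -> R) (x d : 'cV[R]_n).

Lemma derivable_line f x d (s : R) :
  derivable f (x + s *: d) d ->
  is_derive s 1 (fun t : R => f (x + t *: d)) ('D_d f (x + s *: d)).
Proof.
move=> fd.
have E : (fun h : R => h^-1 *: (((fun t : R => f (x + t *: d)) \o shift s) (h *: (1 : R)) - f (x + s *: d)))
   = (fun h : R => h^-1 *: ((f \o shift (x + s *: d)) (h *: d) - f (x + s *: d))).
  apply/funext => h /=; congr (_ *: (f _ - _)).
  by rewrite /shift /= [h *: 1]mulr1 scalerDl addrCA.
split; first by rewrite /derivable E.
by rewrite /derive E.
Qed.

Lemma derivable_line_mean f x d (t : R) :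
  (forall y, derivable f y d) ->
  exists2 s : R, `|s| <= `|t| & f (x + t *: d) - f x = t * 'D_d f (x + s *: d).
Proof.
move=> fd.
have dl (s : R) : is_derive s 1 (fun t : R => f (x + t *: d)) ('D_d f (x + s *: d)).
  exact: derivable_line.
have cl a b : {within `[a, b], continuous (fun t : R => f (x + t *: d))}.
  apply: continuous_subspaceT => s; apply: differentiable_continuous.
  by apply/derivable1_diffP; case: (dl s).
have [t0|t0] := leP 0 t.
  have [c c01 E] := MVT_segment t0 (fun s _ => dl s) (@cl _ _).
  exists c.
    by move: c01; rewrite in_itv /= => /andP[? ?]; rewrite !ger0_norm.
  by move: E; rewrite scale0r addr0 subr0 mulrC.
have [c c01 E] := MVT_segment (ltW t0) (fun s _ => dl s) (@cl _ _).
exists c.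
  by move: c01; rewrite in_itv /= => /andP[? ?]; rewrite !ler0_norm ?lerN2// ltW.
by move: E; rewrite scale0r addr0 sub0r => E; rewrite -opprB E mulrN opprK mulrC.
Qed.

(** [Ck 1] speaks of derivatives along the axes only. The path from [x] to [x + h d] changes one
    coordinate at a time; each leg is treated by the mean value theorem and continuity of the
    partial derivatives at [x]. *)
Lemma C1_derive f x d : Ck 1 f ->
  derivable f x d /\ 'D_d f x = \sum_j d j 0 * partial j f x.
Proof.
move=> [cf pf].
suff H : h^-1 *: ((f \o shift x) (h *: d) - f x) @[h --> 0^'] -->
    (\sum_j d j 0 * partial j f x : R).
  split; first by apply/cvg_ex; eexists; exact: H.
  exact/cvg_lim.
(* The corner reached after the first [k] coordinates have been moved. *)
pose y k h := x + h *: \col_(j < n) (if (j < k)%N then d j 0 else 0).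
have y0 h : y 0%N h = x.
  by rewrite /y (_ : \col__ _ = 0) ?scaler0 ?addr0//; apply/colP => j; rewrite !mxE.
have yn h : y n h = h *: d + x.
  rewrite /y addrC; congr (_ *: _ + _); apply/colP => j; rewrite mxE.
  by rewrite ltn_ord.
have yS (j : 'I_n) h : y j.+1 h = y j h + (h * d j 0) *: delta_mx j 0.
  apply/colP => i; rewrite !mxE -addrA; congr (_ + _).
  rewrite ltnS leq_eqVlt eqxx andbT; have [->|ij] := eqVneq i j.
    by rewrite eqxx ltnn mulr0 add0r mulr1.
  by rewrite (negbTE (_ : (i != j :> nat))) //= mulr0 addr0.
apply: dist_cvg_dnbhs0 => e e0.
have n1 : 0 < n%:R + 1 :> R by rewrite ltr_wpDl.
pose D := `|d| + 1.
have D0 : 0 < D by rewrite ltr_wpDl.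
(* There are [n] legs, each with error at most [D * e']; [n + 1] avoids a division by zero. *)
pose e' := e / (n%:R + 1) / D.
have e'0 : 0 < e' by rewrite !divr_gt0.
have dD j : `|d j 0| <= D by rewrite (le_trans (ler_mx_norm_entry _ _ _))// lerDl.
have [r r0 rP] : exists2 r : R, 0 < r & forall j z, `|z - x| < r ->
    `|partial j f z - partial j f x| < e'.
  have H j := continuous_dist ((pf j).2 x) e'0.
  pose rr j := s2val (cid2 (H j)).
  exists (\big[Num.min/1]_j rr j).
    by apply/bigmin_gtP; split => // j _; rewrite /rr; case: cid2.
  move=> j z zr; have := s2valP' (cid2 (H j)); apply.
  by rewrite (lt_le_trans zr)//; exact: bigmin_le.
(* The corner and the intermediate point of its leg each contribute at most [|h| D] to the distance
   from [x], hence the factor 2. *)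
exists (r / D / 2); first by rewrite !divr_gt0.
move=> h h0 hr; rewrite distrC.
have yx k : `|y k h - x| <= `|h| * D.
  rewrite /y addrC addKr normrZ ler_wpM2l//; apply: mx_norm_le => [|i j]; first exact: ltW.
  by rewrite mxE; case: ifP => _; rewrite ?normr0// ltW.
have step (j : 'I_n) : `|d j 0 * partial j f x - h^-1 * (f (y j.+1 h) - f (y j h))| <= D * e'.
  rewrite yS; have [s sh ->] := derivable_line_mean (y j h) (h * d j 0) (pf j).1.
  set X := 'D_(delta_mx j 0) f _.
  have -> : h^-1 * (h * d j 0 * X) = d j 0 * X by rewrite !mulrA mulVf// mul1r.
  rewrite -mulrBr normrM ler_pM//.
  rewrite distrC ltW//; apply: rP; rewrite addrAC.
  rewrite (le_lt_trans (ler_normD _ _))//.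
  have : `|s *: delta_mx j (0 : 'I_1)| <= `|h| * D :> R.
    apply: mx_norm_le => [|i k]; first by rewrite mulr_ge0// ltW.
    rewrite !mxE normrM (le_trans (_ : _ <= `|s| * 1))//.
      by rewrite ler_wpM2l//; case: (_ && _); rewrite ?normr1 ?normr0.
    by rewrite mulr1 (le_trans sh)// normrM ler_wpM2l.
  have := yx j; move: hr; rewrite -mulrA -invfM ltr_pdivlMr; last by rewrite mulr_gt0.
  lra.
have -> : h^-1 *: ((f \o shift x) (h *: d) - f x) = h^-1 * (f (y n h) - f (y 0%N h)).
  by rewrite y0 yn.
have -> : f (y n h) - f (y 0%N h) = \sum_(j < n) (f (y j.+1 h) - f (y j h)).
  by rewrite -(telescope_sumr (fun k => f (y k h)))// big_mkord.
rewrite mulr_sumr -sumrB (le_trans (ler_norm_sum _ _ _))//.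
apply: le_trans (_ : \sum_(j < n) D * e' <= _); first exact: ler_sum.
rewrite sumr_const card_ord -[X in X <= _]mulr_natl /e'.
rewrite [D * _]mulrC divfK ?gt_eqF// mulrCA ler_piMr ?ltW// ltr_pdivrMr// mul1r.
by rewrite ltrDl.
Qed.

End C1.

(** * Functions of class C^1 *)

Section real_continuity.
Context {R : realType} (T : topologicalType).
Implicit Types f g : T -> R.

Lemma continuous_addf f g : continuous f -> continuous g ->
  continuous (fun x => f x + g x).
Proof. by move=> cf cg x; exact: (continuousD (cf x) (cg x)). Qed.

Lemma continuous_subf f g : continuous f -> continuous g ->
  continuous (fun x => f x - g x).
Proof. by move=> cf cg x; exact: (continuousB (cf x) (cg x)). Qed.

Lemma continuous_mulf f g : continuous f -> continuous g ->
  continuous (fun x => f x * g x).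
Proof. by move=> cf cg x; exact: (continuousM (cf x) (cg x)). Qed.

Lemma continuous_cstf (c : R) : continuous (fun _ : T => c).
Proof. by move=> x; exact: cst_continuous. Qed.

End real_continuity.

Section C1_calculus.
Context {R : realType} (n : nat).
Implicit Types (f g : 'cV[R]_n -> R) (x d : 'cV[R]_n).

Lemma continuous_at_sum (T : topologicalType) (I : Type) (r : seq I)
    (F : I -> T -> R) (x : T) :
  (forall i, {for x, continuous (F i)}) ->
  {for x, continuous (fun y => \sum_(i <- r) F i y)}.
Proof.
move=> cF; elim: r => [|i r IH].
  rewrite (_ : (fun _ => _) = cst 0); first exact: cst_continuous.
  by apply/funext => y; rewrite big_nil.
rewrite (_ : (fun _ => _) = F i \+ (fun y => \sum_(i <- r) F i y)).
  exact: continuousD.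
by apply/funext => y; rewrite big_cons.
Qed.

Lemma C1_lincomb f g (a b : R) : Ck 1 f -> Ck 1 g ->
  Ck 1 (fun x => a * f x + b * g x) /\
  forall j x, partial j (fun x => a * f x + b * g x) x =
              a * partial j f x + b * partial j g x.
Proof.
move=> [cf pf] [cg pg].
have E : (fun x => a * f x + b * g x) = (a \*: f) + (b \*: g) by [].
have P j x : partial j (fun x => a * f x + b * g x) x =
    a * partial j f x + b * partial j g x.
  rewrite /partial E deriveD; last 2 first.
  - by apply: derivableZ; exact: (pf j).1.
  - by apply: derivableZ; exact: (pg j).1.
  by rewrite !deriveZ; [|exact: (pg j).1|exact: (pf j).1].
split=> //; split.
  by apply: continuous_addf; apply: continuous_mulf => //; exact: continuous_cstf.
move=> j; split.
  move=> x; rewrite E; apply: derivableD; apply: derivableZ; [exact: (pf j).1|exact: (pg j).1].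
rewrite (_ : partial j _ = (fun y => a * partial j f y + b * partial j g y)); last first.
  by apply/funext => y; exact: P.
by apply: continuous_addf; apply: continuous_mulf; [exact: continuous_cstf|exact: (pf j).2|exact: continuous_cstf|exact: (pg j).2].
Qed.

Lemma C1_mul f g : Ck 1 f -> Ck 1 g ->
  Ck 1 (fun x => f x * g x) /\
  forall j x, partial j (fun x => f x * g x) x =
              f x * partial j g x + g x * partial j f x.
Proof.
move=> [cf pf] [cg pg].
have P j x : partial j (fun x => f x * g x) x =
    f x * partial j g x + g x * partial j f x.
  exact: (deriveM ((pf j).1 x) ((pg j).1 x)).
split=> //; split; first exact: continuous_mulf.
move=> j; split; first by move=> x; apply: derivableM; [exact: (pf j).1|exact: (pg j).1].
rewrite (_ : partial j _ = (fun y => f y * partial j g y + g y * partial j f y)); last first.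
  by apply/funext => y; exact: P.
by apply: continuous_addf; apply: continuous_mulf => //; [exact: (pg j).2|exact: (pf j).2].
Qed.

Lemma affine_lipschitz (B : 'M[R]_n) (h x y : 'cV[R]_n) :
  `|(B *m y + h) - (B *m x + h)| <= n%:R * `|B| * `|y - x|.
Proof. by rewrite opprD addrACA subrr addr0 -mulmxBr mulmx_norm_le. Qed.

Lemma continuous_comp_affine f (B : 'M[R]_n) (h : 'cV[R]_n) :
  continuous f -> continuous (fun x => f (B *m x + h)).
Proof.
move=> cf x; apply: dist_continuous => e e0.
have [r r0 rP] := continuous_dist (cf (B *m x + h)) e0.
have L0 : 0 < n%:R * `|B| + 1 by rewrite ltr_wpDl// mulr_ge0.
exists (r / (n%:R * `|B| + 1)); first by rewrite divr_gt0.
move=> y yx; rewrite ltW//; apply: rP; rewrite (le_lt_trans (affine_lipschitz _ _ _ _))//.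
move: yx; rewrite ltr_pdivlMr// => /(le_lt_trans _); apply.
by rewrite mulrC ler_wpM2l// lerDl.
Qed.

Lemma C1_affine f (B : 'M[R]_n) (h : 'cV[R]_n) : Ck 1 f ->
  Ck 1 (fun x => f (B *m x + h)) /\
  forall j x, partial j (fun x => f (B *m x + h)) x =
              \sum_k partial k f (B *m x + h) * B k j.
Proof.
move=> C1f; have [cf pf] := C1f.
have E j x : (fun t : R => t^-1 *: (((fun x => f (B *m x + h)) \o shift x) (t *: delta_mx j 0) - f (B *m x + h)))
   = (fun t : R => t^-1 *: ((f \o shift (B *m x + h)) (t *: (B *m delta_mx j 0)) - f (B *m x + h))).
  apply/funext => t /=; congr (_ *: (f _ - _)).
  by rewrite /shift /= mulmxDr -scalemxAr addrA.
have D j x : derivable (fun x => f (B *m x + h)) x (delta_mx j 0).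
  by rewrite /derivable E; apply: (C1_derive _ _ C1f).1.
have P j x : partial j (fun x => f (B *m x + h)) x = \sum_k partial k f (B *m x + h) * B k j.
  rewrite /partial /derive E -/(derive _ _ _) (C1_derive _ _ C1f).2.
  by apply: eq_bigr => k _; rewrite mulrC -colE mxE.
split=> //; split; first exact: continuous_comp_affine.
move=> j; split; first exact: D.
move=> x; rewrite (_ : partial j _ = (fun y => \sum_k partial k f (B *m y + h) * B k j)); last first.
  by apply/funext => y; exact: P.
apply: continuous_at_sum => k; apply: continuousM; last exact: cst_continuous.
by apply: (continuous_comp_affine (pf k).2).
Qed.

Lemma partial_near0 f j x (r : R) : 0 < r ->
  (forall y, `|y - x| < r -> f y = 0) -> partial j f x = 0.
Proof.
move=> r0 fx; apply/cvg_lim => //; apply: dist_cvg_dnbhs0 => e e0.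
exists r => // h h0 hr; rewrite /= subr0 !fx ?subr0 ?scaler0 ?normr0 ?ltW//.
  by rewrite subrr normr0.
rewrite /shift /= addrK normrZ (le_lt_trans _ hr)// ler_piMr//.
by apply: mx_norm_le => // i k; rewrite mxE; case: (_ && _); rewrite ?normr1 ?normr0.
Qed.

(** Compact support with an explicit radius, a form that products and [partial] inherit at once. *)
Definition null_outside (r : R) f := forall x, r < `|x| -> f x = 0.

Lemma partial_null_outside r f j : null_outside r f -> null_outside r (partial j f).
Proof.
move=> fr x xr; apply: (@partial_near0 _ _ _ (`|x| - r)); first by rewrite subr_gt0.
move=> y yx; apply: fr; have := ler_distD 0 x y; rewrite !subr0 !sub0r normrN.
by have := ler_normB y (y - x); rewrite opprB addrCA subrr addr0; lra.
Qed.

End C1_calculus.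

Section real_integrable.
Context d (T : measurableType d) (R : realType) (mu : measure T R) (D : set T).
Context (mD : measurable D).
Implicit Types f g : T -> R.

Lemma integrable_addf f g : mu.-integrable D (EFin \o f) ->
  mu.-integrable D (EFin \o g) -> mu.-integrable D (EFin \o (fun x => f x + g x)).
Proof. by move=> If Ig; exact: (integrableD mD If Ig). Qed.

Lemma integrable_subf f g : mu.-integrable D (EFin \o f) ->
  mu.-integrable D (EFin \o g) -> mu.-integrable D (EFin \o (fun x => f x - g x)).
Proof. by move=> If Ig; exact: (integrableB mD If Ig). Qed.

Lemma integrable_scalef (c : R) f : mu.-integrable D (EFin \o f) ->
  mu.-integrable D (EFin \o (fun x => c * f x)).
Proof. by move=> If; exact: (integrableZl mD c If). Qed.

End real_integrable.

(** * Integrals of compactly supported functions and integration by parts *)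

Section integrals.
Context {R : realType} (n : nat).
Implicit Types (f g u : 'cV[R]_n -> R) (x d : 'cV[R]_n).

Lemma integrable_cball f (r M : R) : measurable_fun setT f ->
  (forall x, `|x| <= r -> `|f x| <= M) -> (leb n).-integrable (cball r) (EFin \o f).
Proof.
move=> mf fM; apply: measurable_bounded_integrable.
- exact: measurable_cball.
- exact: leb_cball_lty.
- exact: measurable_funTS.
- exists M; split; first exact: num_real.
  by move=> M' MM' x xr /=; rewrite (le_trans (fM x xr))// ltW.
Qed.

Lemma null_outside_restrict r f : null_outside r f -> f \_ (cball r) = f.
Proof.
move=> fr; apply/funext => x; rewrite patchE; case: ifPn => //.
by rewrite notin_setE /cball /= => /negP; rewrite -ltNge => /fr.
Qed.

Lemma integrable_null_outside f (r : R) : null_outside r f ->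
  (leb n).-integrable (cball r) (EFin \o f) -> (leb n).-integrable setT (EFin \o f).
Proof.
move=> fr /(integrable_mkcond _ (measurable_cball r)).
by rewrite restrict_EFin null_outside_restrict.
Qed.

Lemma continuous_integrable f (r : R) : continuous f -> null_outside r f ->
  (leb n).-integrable setT (EFin \o f).
Proof.
move=> cf fr; apply: (integrable_null_outside fr).
have [M _ fM] := continuous_bounded_cball r cf.
by apply: (integrable_cball (M := M)) => //; exact: continuous_measurable_mx.
Qed.

Lemma Rintegral_null_outside_le f (r e : R) : 0 <= r -> 0 <= e -> continuous f ->
  null_outside r f -> (forall x, `|f x| <= e) ->
  `|\int[leb n]_x f x| <= e * (2 * r) ^+ n.
Proof.
move=> r0 e0 cf fr fe.
rewrite -(null_outside_restrict fr) -Rintegral_mkcond.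
have If : (leb n).-integrable (cball r) (EFin \o f).
  by apply: (integrable_cball (M := e)) => //; exact: continuous_measurable_mx.
rewrite (le_trans (le_normr_Rintegral _ If))//; first exact: measurable_cball.
rewrite (_ : e * _ = \int[leb n]_(x in cball r) e); last first.
  rewrite Rintegral_cst; last exact: measurable_cball.
  by congr (_ * _); have /= -> := leb_cball n r0.
apply: le_Rintegral => //; first exact: measurable_cball.
- exact: integrable_norm.
- apply: (integrable_cball (M := e)) => // x _; by rewrite ger0_norm.
Qed.

Lemma Rintegral_shift (h : 'cV[R]_n) f : measurable_fun setT f ->
  \int[leb n]_x f (x + h) = \int[leb n]_x f x.
Proof.
move=> mf; congr fine; apply: (integral_shift h (f := EFin \o f)).
exact/measurable_EFinP.
Qed.

Lemma le_eps (a b V : R) : 0 <= V -> (forall e : R, 0 < e -> a <= b + e * V) -> a <= b.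
Proof.
move=> V0 H; apply/ler_addgt0Pr => e e0.
have V1 : 0 < V + 1 by rewrite ltr_wpDl.
apply: le_trans (H (e / (V + 1)) _) _; first by rewrite divr_gt0.
by rewrite lerD2l mulrAC ler_pdivrMr// ler_pM2l// lerDl.
Qed.

(* Translation invariance makes the integral of any difference quotient vanish. *)
Lemma Rintegral_partial f (r : R) j : 0 <= r -> Ck 1 f -> null_outside r f ->
  \int[leb n]_x partial j f x = 0.
Proof.
move=> r0 [cf pf] fr; apply/eqP; rewrite -normr_le0.
have r1 : 0 <= r + 1 by rewrite addr_ge0.
have pr := partial_null_outside j fr.
apply: (@le_eps _ _ ((2 * (r + 1)) ^+ n)); first by rewrite exprn_ge0// mulr_ge0.
move=> e e0; rewrite add0r.
have [d d0 dP] := unif_continuous_cball r1 (pf j).2 e0.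
(* [t < d] brings the mean value point within [d] of [x]; [t < 1] keeps the translate supported in
   radius [r + 1]. *)
pose t := Num.min d 1 / 2.
have m0 : 0 < Num.min d 1 by rewrite lt_min d0 ltr01.
have t0 : 0 < t by rewrite divr_gt0.
have td : t < d by rewrite (@lt_le_trans _ _ (Num.min d 1))// ?ge_min ?lexx// ltr_pdivrMr// ltr_pMr// ltr1n.
have t1 : t < 1 by rewrite (@lt_le_trans _ _ (Num.min d 1))// ?ge_min ?lexx ?orbT// ltr_pdivrMr// ltr_pMr// ltr1n.
pose v : 'cV[R]_n := t *: delta_mx j 0.
have vN s : `|s *: delta_mx j 0 : 'cV[R]_n| <= `|s|.
  by apply: mx_norm_le => // i k; rewrite !mxE; case: (_ && _); rewrite ?mulr1 ?mulr0 ?normr0.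
have v1 : `|v| <= 1 by rewrite (le_trans (vN _))// gtr0_norm// ltW.
pose k x := t^-1 * (f (x + v) - f x) - partial j f x.
have cfv : continuous (fun x => f (x + v)).
  move=> x; have := @continuous_comp_affine _ _ f 1%:M v cf x.
  by under eq_fun do rewrite mul1mx.
have fvr : null_outside (r + 1) (fun x => f (x + v)).
  move=> x xr; apply: fr; have := ler_normB (x + v) v; rewrite addrK; lra.
have fr1 : null_outside (r + 1) f by move=> x xr; apply: fr; lra.
have pr1 : null_outside (r + 1) (partial j f) by move=> x xr; apply: pr; lra.
have cD : continuous (fun x => t^-1 * (f (x + v) - f x)).
  by apply: continuous_mulf; [exact: continuous_cstf|exact: continuous_subf].
have ck : continuous k.
  by apply: continuous_subf => //; exact: (pf j).2.
have Ip : (leb n).-integrable setT (EFin \o partial j f) by apply: (continuous_integrable (pf j).2 pr).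
have If : (leb n).-integrable setT (EFin \o f) by apply: (continuous_integrable cf fr).
have Ifv : (leb n).-integrable setT (EFin \o (fun x => f (x + v))) by apply: (continuous_integrable cfv fvr).
have ID : (leb n).-integrable setT (EFin \o (fun x => t^-1 * (f (x + v) - f x))).
  by apply: (continuous_integrable (r := r + 1)) => // x xr; rewrite fvr// fr1// subrr mulr0.
(* [f] and its translate have the same integral, so only the error [k] of the difference quotient is
   left, and it is at most [e] everywhere. *)
have -> : \int[leb n]_x partial j f x = - \int[leb n]_x k x.
  rewrite RintegralB// RintegralZl//; last first.
    by apply: (continuous_integrable (r := r + 1)) => [|x xr]; [exact: continuous_subf|rewrite fvr// fr1// subrr].
  rewrite RintegralB// Rintegral_shift; last exact: continuous_measurable_mx.
  by rewrite subrr mulr0 sub0r opprK.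
rewrite normrN; apply: Rintegral_null_outside_le => //; first exact: ltW.
  by move=> x xr; rewrite /k fvr// fr1// pr1// subrr mulr0 subr0.
move=> x; rewrite /k /v.
have [s st ->] := derivable_line_mean x t (pf j).1.
rewrite mulrA mulVf ?gt_eqF// mul1r distrC.
have st' : `|s *: delta_mx j 0 : 'cV[R]_n| <= t by rewrite (le_trans (vN _))// (le_trans st)// gtr0_norm.
have [xr|xr] := leP `|x| (r + 1).
  by rewrite ltW//; apply: dP => //; rewrite opprD addrA subrr sub0r normrN; lra.
rewrite pr1// -/(partial _ _ _) pr ?subrr ?normr0 ?ltW//.
by have := ler_normB (x + s *: delta_mx j 0) (s *: delta_mx j 0); rewrite addrK; lra.
Qed.

Lemma test_function_null_outside (A : set 'cV[R]_n) phi : test_function A phi ->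
  exists2 r : R, 0 < r & null_outside r phi.
Proof.
move=> [_ /compact_bounded/bounded_cball[r r0 rP] _]; exists r => // x xr.
apply/eqP/negPn/negP => px; have : tsupport phi x by apply: subset_closure.
by move=> /rP; rewrite /cball /= leNgt xr.
Qed.

Lemma partial_tsupport phi j x : partial j phi x != 0 -> tsupport phi x.
Proof.
apply: contra_neqP => /= nx.
have : nbhs x (~` tsupport phi).
  by apply: open_nbhs_nbhs; split => //; apply: closed_openC; exact: closed_closure.
move=> /nbhs_normP[r /= r0 rP].
apply: (@partial_near0 _ _ _ j x r) => // y yx; apply/eqP/negPn/negP => py.
by apply: (rP y); rewrite /= 1?distrC//; exact: subset_closure.
Qed.

(** The product [w * phi] has compact support, so its derivative has integral zero. As [phi] and its
    derivative vanish off [A], the integrals over [A] are integrals over the whole space. *)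
Lemma C1_weak_derivative (A : set 'cV[R]_n) w phi j : Ck 1 w ->
  test_function A phi ->
  \int[leb n]_(x in A) (w x * partial j phi x) =
  - \int[leb n]_(x in A) (partial j w x * phi x).
Proof.
move=> Cw tphi; have [r r0 phir] := test_function_null_outside tphi.
have [sphi _ phiA] := tphi.
have Cphi : Ck 1 phi by exact: sphi.
rewrite Rintegral_mkcond [in RHS]Rintegral_mkcond.
rewrite (_ : _ \_ A = (fun x => w x * partial j phi x)); last first.
  apply/funext => x; rewrite patchE; case: ifPn => // xA.
  have [->|/partial_tsupport/phiA] := eqVneq (partial j phi x) 0; first by rewrite mulr0.
  by move=> Ax; move: xA; rewrite notin_setE.
rewrite (_ : _ \_ A = (fun x => partial j w x * phi x)); last first.
  apply/funext => x; rewrite patchE; case: ifPn => // xA.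
  have [->|px] := eqVneq (phi x) 0; first by rewrite mulr0.
  by move: xA; rewrite notin_setE => -[]; apply: phiA; exact: subset_closure.
have [CM PM] := C1_mul Cw Cphi.
have Mr : null_outside r (fun x => w x * phi x) by move=> x xr; rewrite phir// mulr0.
have I0 := Rintegral_partial j (ltW r0) CM Mr.
apply/eqP; rewrite -addr_eq0 -RintegralD//.
- rewrite -[X in _ == X]I0; apply/eqP; apply: eq_Rintegral => x _.
  by rewrite PM [phi x * _]mulrC.
- apply: (continuous_integrable (r := r)).
    by apply: continuous_mulf; [exact: Cw.1|exact: (Cphi.2 j).2].
  by move=> x xr; rewrite (partial_null_outside j phir)// mulr0.
- apply: (continuous_integrable (r := r)).
    by apply: continuous_mulf; [exact: (Cw.2 j).2|exact: Cphi.1].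
  by move=> x xr; rewrite phir// mulr0.
Qed.

End integrals.

(** * Convolution *)

Section convolution_C1.
Context {R : realType} (n : nat).
Implicit Types (f g k u : 'cV[R]_n -> R) (x : 'cV[R]_n).

Definition locally_integrable_cV u :=
  measurable_fun setT u /\ forall r, (leb n).-integrable (cball r) (EFin \o u).

Definition conv g u x := \int[leb n]_y (g (x - y) * u y).

Lemma kernel_integrable k u s : continuous k -> null_outside s k ->
  locally_integrable_cV u -> (leb n).-integrable setT (EFin \o (fun y => k y * u y)).
Proof.
move=> ck ks [mu Iu]; apply: (integrable_null_outside (r := s)).
  by move=> x xs; rewrite ks// mul0r.
have [M M0 kM] := continuous_bounded_cball s ck.
apply: (@integrableMr _ _ _ _ _ (measurable_cball s) k (EFin \o u)) => //.
  by apply: measurable_funTS; exact: continuous_measurable_mx.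
exists M; split; first exact: num_real.
by move=> M' MM' x xr /=; rewrite (le_trans (kM x xr))// ltW.
Qed.

(** Continuity and differentiability of [conv] both reduce to this bound, applied to a uniformly
    small difference of kernels. *)
Lemma kernel_le k u s e : continuous k -> null_outside s k ->
  locally_integrable_cV u -> (forall y, `|k y| <= e) ->
  `|\int[leb n]_y (k y * u y)| <= e * \int[leb n]_(y in cball s) `|u y|.
Proof.
move=> ck ks lu ke; have [mu Iu] := lu.
have Iku := kernel_integrable ck ks lu.
have kus : null_outside s (fun y => k y * u y) by move=> x xs; rewrite ks// mul0r.
rewrite -(null_outside_restrict kus) -Rintegral_mkcond.
have Is : (leb n).-integrable (cball s) (EFin \o (fun y => k y * u y)).
  by apply: integrableS Iku => //; exact: measurable_cball.
rewrite (le_trans (le_normr_Rintegral _ Is))//; first exact: measurable_cball.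
rewrite -RintegralZl; [|exact: measurable_cball|exact: integrable_norm].
apply: le_Rintegral; first exact: measurable_cball.
- exact: integrable_norm.
- have := integrableZl (measurable_cball s) e (integrable_norm (Iu s)).
  by [].
by move=> y _; rewrite normrM ler_wpM2r.
Qed.

Lemma continuous_reflect g x : continuous g ->
  continuous (fun y : 'cV[R]_n => g (x - y)).
Proof.
move=> cg; rewrite (_ : (fun y => _) = (fun y => g ((- 1%:M) *m y + x))).
  exact: continuous_comp_affine.
by apply/funext => y; rewrite mulNmx mul1mx addrC.
Qed.

Lemma null_outside_reflect g r x s : null_outside r g -> `|x| + r <= s ->
  null_outside s (fun y => g (x - y)).
Proof.
move=> gr xs y ys; apply: gr.
by have := ler_normB x (x - y); rewrite opprB addrC subrK; lra.
Qed.

Lemma conv_integrable g u r x : continuous g -> null_outside r g ->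
  locally_integrable_cV u ->
  (leb n).-integrable setT (EFin \o (fun y => g (x - y) * u y)).
Proof.
move=> cg gr lu.
apply: (@kernel_integrable (fun y => g (x - y)) u (`|x| + r)) => //.
  exact: continuous_reflect.
exact: null_outside_reflect gr _.
Qed.

Lemma unif_continuous_null_outside g r e : 0 <= r -> continuous g ->
  null_outside r g -> 0 < e ->
  exists2 d : R, 0 < d <= 1 & forall x y, `|x - y| < d -> `|g x - g y| < e.
Proof.
move=> r0 cg gr e0; have r1 : 0 <= r + 1 by rewrite addr_ge0.
have [d d0 dP] := unif_continuous_cball r1 cg e0.
exists (Num.min d 1); first by rewrite lt_min d0 ltr01 ge_min lexx orbT.
move=> x y; rewrite lt_min => /andP[xyd xy1].
have [xr|xr] := leP `|x| (r + 1); first exact: dP.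
rewrite !gr ?subrr ?normr0//; last lra.
by have := ler_normD (x - y) y; rewrite subrK; lra.
Qed.

Lemma conv_continuous g u r : 0 <= r -> continuous g -> null_outside r g ->
  locally_integrable_cV u -> continuous (conv g u).
Proof.
move=> r0 cg gr lu x; apply: dist_continuous => e e0.
(* The radius is that of a cube containing the supports of [g (x' - y)] in [y] for all [x'] within 1
   of [x]; this is why [d] is at most 1. *)
set I := \int[leb n]_(y in cball (`|x| + 1 + r)) `|u y|.
have I0 : 0 <= I by apply: Rintegral_ge0.
have I1 : 0 < I + 1 by rewrite ltr_wpDl.
have e'0 : 0 < e / (I + 1) by rewrite divr_gt0.
have [d /andP[d0 d1] dP] := unif_continuous_null_outside r0 cg gr e'0.
exists d => // x' x'x.
have x'1 : `|x'| <= `|x| + 1.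
  by have := ler_normD (x' - x) x; rewrite subrK; lra.
rewrite /conv -RintegralB//; [|exact: (conv_integrable _ cg gr)..].
under eq_Rintegral do rewrite -mulrBl.
apply: le_trans (_ : e / (I + 1) * I <= _); last first.
  by rewrite mulrAC ler_pdivrMr// ler_pM2l// lerDl.
apply: (@kernel_le (fun y => g (x' - y) - g (x - y))) => //.
- by apply: continuous_subf; exact: continuous_reflect.
- move=> y ys; rewrite !gr ?subrr//.
    by have := ler_normB x (x - y); rewrite opprB addrC subrK; lra.
  by have := ler_normB x' (x' - y); rewrite opprB addrC subrK; lra.
by move=> y; rewrite ltW//; apply: dP; rewrite opprB addrA subrK.
Qed.

(** Differentiation under the integral sign: the difference quotient of [g] is a value of
    [partial j g] at a nearby point, so it differs little from [partial j g], uniformly. *)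
Lemma conv_partial g u r j x : 0 <= r -> Ck 1 g -> null_outside r g ->
  locally_integrable_cV u ->
  h^-1 *: ((conv g u \o shift x) (h *: delta_mx j 0) - conv g u x) @[h --> 0^'] -->
    conv (partial j g) u x.
Proof.
move=> r0 [cg pg] gr lu; apply: dist_cvg_dnbhs0 => e e0.
have pgr := partial_null_outside j gr.
set I := \int[leb n]_(y in cball (`|x| + 1 + r)) `|u y|.
have I0 : 0 <= I by apply: Rintegral_ge0.
have I1 : 0 < I + 1 by rewrite ltr_wpDl.
have e'0 : 0 < e / (I + 1) by rewrite divr_gt0.
have [d /andP[d0 d1] dP] := unif_continuous_null_outside r0 (pg j).2 pgr e'0.
exists d => // h h0 hd; set v : 'cV[R]_n := h *: delta_mx j 0.
have vN s : `|s *: delta_mx j 0 : 'cV[R]_n| <= `|s|.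
  by apply: mx_norm_le => // i k; rewrite !mxE; case: (_ && _); rewrite ?mulr1 ?mulr0 ?normr0.
have x'1 : `|v + x| <= `|x| + 1.
  by have := ler_normD v x; have := vN h; rewrite -/v; lra.
rewrite /shift /= -[_ *: _]/(_ * _) /conv.
rewrite -RintegralB//; [|exact: (conv_integrable _ cg gr)..].
rewrite -RintegralZl//; last first.
  by apply: integrable_subf => //; exact: (conv_integrable _ cg gr).
rewrite -RintegralB//; last 2 first.
- by apply: integrable_scalef => //; apply: integrable_subf => //; exact: (conv_integrable _ cg gr).
- exact: (conv_integrable _ (pg j).2 pgr).
under eq_Rintegral do rewrite -mulrBl mulrA -mulrBl.
apply: le_trans (_ : e / (I + 1) * I <= _); last first.
  by rewrite mulrAC ler_pdivrMr// ler_pM2l// lerDl.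
apply: (@kernel_le (fun y => h^-1 * (g (v + x - y) - g (x - y)) - partial j g (x - y))) => //.
- apply: continuous_subf; last by apply: continuous_reflect; exact: (pg j).2.
  apply: continuous_mulf; first exact: continuous_cstf.
  by apply: continuous_subf; exact: continuous_reflect.
- move=> y ys.
  have a1 : r < `|x - y|.
    by have := ler_normB x (x - y); rewrite opprB addrC subrK; lra.
  have a2 : r < `|v + x - y|.
    by have := ler_normB (v + x) (v + x - y); rewrite opprB addrC subrK; lra.
  by rewrite !gr// pgr// subrr mulr0 subr0.
move=> y; have [s sh] := derivable_line_mean (x - y) h (pg j).1.
rewrite (_ : v + x - y = x - y + h *: delta_mx j 0); last by rewrite -addrA addrC.
move=> ->; rewrite mulrA mulVf// mul1r ltW//; apply: dP.
by rewrite addrC addKr (le_lt_trans (vN s))// (le_lt_trans sh).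
Qed.

Lemma conv_C1 g u r : 0 <= r -> Ck 1 g -> null_outside r g ->
  locally_integrable_cV u -> Ck 1 (conv g u).
Proof.
move=> r0 Cg gr lu; split; first exact: (conv_continuous r0 Cg.1 gr lu).
move=> j; split=> [x|].
  by apply/cvg_ex; exists (conv (partial j g) u x); exact: (@conv_partial g u r j x r0 Cg gr lu).
rewrite (_ : partial j _ = conv (partial j g) u); last first.
  apply/funext => x; apply/cvg_lim => //; exact: (@conv_partial g u r j x r0 Cg gr lu).
exact: (conv_continuous r0 (Cg.2 j).2 (partial_null_outside j gr) lu).
Qed.

End convolution_C1.

Section enorm_measurable.
Context {R : realType}.

Lemma enorm_continuous n : continuous (fun x : 'cV[R]_n => enorm x).
Proof.
move=> x; apply: (@continuous_comp _ _ _ (fun x : 'cV[R]_n => \sum_i x i 0 ^+ 2) (@Num.sqrt R)).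
  apply: continuous_at_sum => i.
  have cc : continuous (fun x : 'cV[R]_n => x i 0) by exact: coord_continuous.
  have c2 : continuous (fun x : 'cV[R]_n => x i 0 ^+ 2) := continuous_mulf cc cc.
  exact: c2.
exact: sqrt_continuous.
Qed.

Lemma measurable_enorm d (T : measurableType d) m (f : T -> 'cV[R]_m) :
  measurable_fun setT f -> measurable_fun setT (fun x => enorm (f x)).
Proof.
move=> mf; have me : measurable_fun [set: 'cV[R]_m] (fun x : 'cV[R]_m => enorm x).
  by apply: continuous_measurable_mx; exact: enorm_continuous.
exact: measurableT_comp me mf.
Qed.

Lemma measurable_enorm_powR d (T : measurableType d) m (f : T -> 'cV[R]_m) p :
  measurable_fun setT f -> measurable_fun setT (fun x => enorm (f x) `^ p).
Proof.
move=> mf; rewrite (_ : (fun x => _) = (@powR R ^~ p) \o (fun x => enorm (f x)))//.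
apply: measurableT_comp; first exact: measurable_powR.
exact: measurable_enorm.
Qed.

End enorm_measurable.

Section mollification_C1.
Context {R : realType} (m n : nat) (p : R).

(** Since [p >= 1], the modulus of an entry is at most 1 plus the p-th power of the norm. *)
Lemma Lploc_entry (u : 'cV[R]_n -> 'cV[R]_m) i : 1 <= p -> Lploc p u ->
  locally_integrable_cV (fun x => u x i 0).
Proof.
move=> p1 [mu Lu].
have mui : measurable_fun setT (fun x => u x i 0).
  exact: (measurableT_comp (measurable_entry i 0) mu).
split => // r; have [r0|r0] := leP 0 r; last first.
  by rewrite cball_lt0//; exact: integrable_set0.
have [_ uK] := Lu _ (compact_cball r0).
apply: (@le_integrable _ _ _ _ _ (measurable_cball r) _ (fun x => (1 + (enorm (u x)) `^ p)%:E)).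
- by apply/measurable_EFinP; exact: measurable_funTS.
- move=> x _ /=; rewrite lee_fin [leRHS]ger0_norm ?addr_ge0 ?powR_ge0//.
  rewrite (le_trans (ler_entry_enorm _ _))//.
  have [u1|u1] := leP (enorm (u x)) 1; first by rewrite (le_trans u1)// lerDl powR_ge0.
  rewrite (le_trans (_ : _ <= enorm (u x) `^ p))// ?lerDr//.
  by rewrite -[leLHS]powRr1 ?enorm_ge0// ler_powR// ltW.
apply: integrable_addf; first exact: measurable_cball.
  by apply: (integrable_cball (M := 1)) => // x _; rewrite normr1.
apply/integrableP; split.
  apply/measurable_EFinP/measurable_funTS; exact: measurable_enorm_powR.
rewrite (le_lt_trans _ uK)//; rewrite le_eqVlt; apply/orP; left; apply/eqP.
by apply: eq_integral => x _ /=; rewrite ger0_norm ?powR_ge0.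
Qed.

Lemma mollifier_C1 (rho : 'cV[R]_n -> R) s : standard_kernel rho -> 0 < s ->
  Ck 1 (mollifier rho s) /\ null_outside s (mollifier rho s).
Proof.
move=> [[srho _ rho1] _ _ _] s0; split.
  have Cr : Ck 1 rho by exact: srho.
  have [C _] := C1_affine (s^-1)%:M 0 Cr.
  have [C' _] := C1_lincomb (s ^- n) 0 C C.
  rewrite (_ : mollifier rho s = (fun x => s ^- n * rho ((s^-1)%:M *m x + 0) + 0 * rho ((s^-1)%:M *m x + 0)))//.
  by apply/funext => x; rewrite mul0r !addr0 mul_scalar_mx.
move=> x xs; rewrite /mollifier.
have -> : rho (s^-1 *: x) = 0; last by rewrite mulr0.
apply/eqP/negPn/negP => rx; have /rho1 /= : tsupport rho (s^-1 *: x) by exact: subset_closure.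
rewrite enormZ gtr0_norm ?invr_gt0// mulrC ltr_pdivrMr// mul1r ltNge.
by rewrite (le_trans (ltW xs))// ler_norm_enorm.
Qed.

Lemma convolution_C1 (rho : 'cV[R]_n -> R) (u : 'cV[R]_n -> 'cV[R]_m) s i :
  1 <= p -> standard_kernel rho -> 0 < s -> Lploc p u ->
  Ck 1 (fun x => convolution (mollifier rho s) u x i 0).
Proof.
move=> p1 krho s0 Lu.
have [C N] := mollifier_C1 krho s0.
have := conv_C1 (ltW s0) C N (Lploc_entry i p1 Lu).
rewrite (_ : conv _ _ = (fun x => convolution (mollifier rho s) u x i 0))//.
by apply/funext => x; rewrite mxE.
Qed.

End mollification_C1.

(** * Local L^p spaces *)

Section nonmeasurable_integral.
Context d (T : measurableType d) (R : realType) (mu : measure T R).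

(* The integral of a nonnegative function is a supremum over simple functions,
   so no measurability is needed; piP o grad us is not assumed measurable. *)
Lemma ge0_le_lower_integral (D : set T) (f g : T -> \bar R) :
  (forall x, D x -> (0 <= f x)%E) -> (forall x, D x -> (f x <= g x)%E) ->
  (\int[mu]_(x in D) f x <= \int[mu]_(x in D) g x)%E.
Proof.
move=> f0 fg; have g0 x : D x -> (0 <= g x)%E by move=> Dx; rewrite (le_trans (f0 x Dx)) ?fg.
rewrite !ge0_integralE//; apply: le_ereal_sup => _ [h /= hf <-]; exists h => //= x.
rewrite (le_trans (hf x))// !patchE; case: ifPn => // /set_mem Dx; exact: fg.
Qed.

(** The constant is moved to the side of the measurable [g], where linearity of the integral is
    available. *)
Lemma ge0_integral_le_scale (D : set T) (c : R) (f g : T -> \bar R) : 0 < c ->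
  measurable D -> measurable_fun D g ->
  (forall x, D x -> (0 <= f x)%E) -> (forall x, D x -> (c%:E * f x <= g x)%E) ->
  (c%:E * \int[mu]_(x in D) f x <= \int[mu]_(x in D) g x)%E.
Proof.
move=> c0 mD mg f0 fg; rewrite -lee_pdivlMl//.
have g0 x : D x -> (0 <= g x)%E.
  by move=> Dx; rewrite (le_trans _ (fg x Dx))// mule_ge0 ?lee_fin ?(ltW c0)// f0.
rewrite -ge0_integralZl//; last by rewrite lee_fin invr_ge0 ltW.
by apply: ge0_le_lower_integral => // x Dx; rewrite lee_pdivlMl// fg.
Qed.

End nonmeasurable_integral.

Section Lploc_closure.
Context {R : realType} (m n : nat) (p : R) (p1 : 1 <= p).
Implicit Types u v : 'cV[R]_n -> 'cV[R]_m.

Let p0 : 0 < p. Proof. exact: lt_le_trans p1. Qed.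

Lemma ler_powR_nneg (a b : R) : 0 <= a -> a <= b -> a `^ p <= b `^ p.
Proof.
by move=> a0 ab; apply: ge0_ler_powR; rewrite ?nnegrE ?(ltW p0)// (le_trans a0).
Qed.

Lemma powR_add_le (a b : R) : 0 <= a -> 0 <= b ->
  (a + b) `^ p <= 2 `^ p * (a `^ p + b `^ p).
Proof.
move=> a0 b0; wlog ab : a b a0 b0 / a <= b.
  move=> H; have [ab|/ltW ba] := leP a b; first exact: H.
  by rewrite addrC [X in _ * X]addrC H.
rewrite (le_trans (ler_powR_nneg (b := 2 * b) _ _))//.
- by rewrite addr_ge0.
- by rewrite mulr2n mulrDl mul1r lerD2r.
by rewrite powRM// ler_wpM2l ?powR_ge0// lerDr powR_ge0.
Qed.

(** A triangle inequality up to the factor [m], obtained through the sup norm; its uses are all up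
    to constants. *)
Lemma enormD_le (x y : 'cV[R]_m) : enorm (x + y) <= m%:R * (enorm x + enorm y).
Proof.
rewrite (le_trans (enorm_le_norm _))// ler_wpM2l// (le_trans (ler_normD _ _))//.
by rewrite lerD// ler_norm_enorm.
Qed.

Lemma LplocP u : Lploc p u <-> measurable_fun setT u /\
  forall r, 0 <= r -> (leb n).-integrable (cball r) (EFin \o (fun x => enorm (u x) `^ p)).
Proof.
split=> -[mu Lu]; split => //.
  move=> r r0; have [_ Lr] := Lu _ (compact_cball r0).
  apply/integrableP; split.
    by apply/measurable_EFinP/measurable_funTS; exact: measurable_enorm_powR.
  rewrite (le_lt_trans _ Lr)// ge0_le_lower_integral// => x _.
  by rewrite /= ger0_norm ?powR_ge0.
move=> K cK; split; first exact: measurable_funTS.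
have [r r0 Kr] := bounded_cball (compact_bounded cK).
have /integrableP[_ Ir] := Lu r (ltW r0).
apply: le_lt_trans Ir.
apply: (@le_trans _ _ (\int[leb n]_(x in cball r) (enorm (u x) `^ p)%:E)%E); last first.
  by apply: ge0_le_lower_integral => x _; rewrite ?lee_fin ?powR_ge0//= ler_norm.
apply: ge0_subset_integral => //.
- by apply: closed_measurable_mx; apply: compact_closed => //; exact: norm_hausdorff.
- exact: measurable_cball.
- by apply/measurable_EFinP/measurable_funTS; exact: measurable_enorm_powR.
by move=> x _; rewrite lee_fin powR_ge0.
Qed.

Lemma measurable_mxD d (T : measurableType d) (f g : T -> 'cV[R]_m) a b :
  measurable_fun setT f -> measurable_fun setT g ->
  measurable_fun setT (fun x => a *: f x + b *: g x).
Proof.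
move=> mf mg; apply: measurable_mxP => i j.
rewrite (_ : (fun x => _) = (fun x => a * f x i j) \+ (fun x => b * g x i j)); last first.
  by apply/funext => x; rewrite !mxE.
apply: measurable_funD; apply: measurable_funM => //.
  exact: measurableT_comp (measurable_entry i j) mf.
exact: measurableT_comp (measurable_entry i j) mg.
Qed.

Lemma Lploc_lincomb u v (a b : R) : Lploc p u -> Lploc p v ->
  Lploc p (fun x => a *: u x + b *: v x).
Proof.
move=> /LplocP[mu Iu] /LplocP[mv Iv]; apply/LplocP.
have mw : measurable_fun setT (fun x => a *: u x + b *: v x) by exact: measurable_mxD.
split; first exact: mw.
move=> r r0; pose c := m%:R `^ p * 2 `^ p.
have mc := @measurable_cball R n r.
apply: (le_integrable mc (g := EFin \o (fun x => c * `|a| `^ p * enorm (u x) `^ p + c * `|b| `^ p * enorm (v x) `^ p))).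
- by apply/measurable_EFinP/measurable_funTS; exact: measurable_enorm_powR.
- move=> x _ /=; rewrite lee_fin [leLHS]ger0_norm ?powR_ge0// [leRHS]ger0_norm; last first.
    by rewrite addr_ge0// !mulr_ge0// powR_ge0.
  apply: (@le_trans _ _ ((m%:R * (`|a| * enorm (u x) + `|b| * enorm (v x))) `^ p)).
    apply: ler_powR_nneg; first exact: enorm_ge0.
    by rewrite -!enormZ enormD_le.
  rewrite powRM ?addr_ge0 ?mulr_ge0 ?enorm_ge0// /c -!mulrA -mulrDr ler_wpM2l ?powR_ge0//.
  rewrite -mulrDr -!powRM ?enorm_ge0//.
  by apply: powR_add_le; rewrite mulr_ge0 ?enorm_ge0.
by apply: integrable_addf => //; apply: integrable_scalef => //; [exact: Iu|exact: Iv].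
Qed.

Lemma Lploc_continuous u : continuous u -> Lploc p u.
Proof.
move=> cu; apply/LplocP; split.
  apply: measurable_mxP => i j; apply: continuous_measurable_mx => x.
  apply: (@continuous_comp _ _ _ u (fun M : 'cV[R]_m => M i j)); first exact: cu.
  exact: coord_continuous.
move=> r r0; have cn : continuous (fun x => `|u x|).
  by move=> x; apply: continuous_comp; [exact: cu|exact: norm_continuous].
have [M M0 uM] := continuous_bounded_cball r cn.
apply: (integrable_cball (M := (m%:R * M) `^ p)).
  apply: measurable_enorm_powR; apply: measurable_mxP => i j; apply: continuous_measurable_mx => x.
  apply: (@continuous_comp _ _ _ u (fun M : 'cV[R]_m => M i j)); first exact: cu.
  exact: coord_continuous.
move=> x xr; rewrite ger0_norm ?powR_ge0// ler_powR_nneg ?enorm_ge0//.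
by rewrite (le_trans (enorm_le_norm _))// ler_wpM2l// (le_trans _ (uM x xr))// ler_norm.
Qed.

Lemma integral_cball_shift_le (g : 'cV[R]_n -> R) r t z : `|z| <= t ->
  (forall x, 0 <= g x) -> measurable_fun setT g ->
  (\int[leb n]_(x in cball r) (g (x + z))%:E <= \int[leb n]_(x in cball (r + t)) (g x)%:E)%E.
Proof.
move=> zt g0 mg; rewrite integral_mkcond [leRHS]integral_mkcond.
rewrite -[leRHS](integral_shift z); last first.
  apply/(measurable_restrictT _ (measurable_cball _)); apply: measurable_funTS.
  exact/measurable_EFinP.
apply: ge0_le_lower_integral => x _; first by apply: erestrict_ge0 => y; rewrite lee_fin.
rewrite /= !patchE; case: ifPn => [/set_mem xr|_]; last first.
  by case: ifPn => _; rewrite ?lee_fin//; exact: lexx.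
by rewrite mem_set// /cball /= (le_trans (ler_normD _ _))// lerD.
Qed.

Lemma Lploc_shift u h : Lploc p u -> Lploc p (fun x => u (x + h)).
Proof.
move=> /LplocP[mu Iu]; have muh := measurableT_comp mu (measurable_addr_mx h).
apply/LplocP; split; first exact: muh.
move=> r r0; have rh : 0 <= r + `|h| by rewrite addr_ge0.
have /integrableP[_ Irh] := Iu _ rh.
apply/integrableP; split.
  by apply/measurable_EFinP/measurable_funTS; exact: measurable_enorm_powR.
apply: le_lt_trans Irh; under eq_integral do rewrite /= ger0_norm ?powR_ge0//.
under [leRHS]eq_integral do rewrite /= ger0_norm ?powR_ge0//.
apply: (integral_cball_shift_le (g := fun x => enorm (u x) `^ p)) => //.
  by move=> x; exact: powR_ge0.
exact: measurable_enorm_powR.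
Qed.

End Lploc_closure.

Section C1_vector.
Context {R : realType} (m n : nat) (p : R) (p1 : 1 <= p).
Implicit Types w : 'cV[R]_n -> 'cV[R]_m.

Definition C1v w := forall i, Ck 1 (fun x => w x i 0).

Lemma C1v_continuous w : C1v w -> continuous w.
Proof.
by move=> Cw x; apply: continuous_mx_entries => i j; rewrite ord1; exact: (Cw i).1.
Qed.

Lemma C1v_grad_continuous w : C1v w -> continuous (grad w).
Proof.
move=> Cw x; apply: continuous_mx_entries => i j.
rewrite (_ : (fun y => _) = partial j (fun x => w x i 0)); first exact: ((Cw i).2 j).2.
by apply/funext => y; rewrite mxE.
Qed.

Lemma C1v_linear (A : 'M[R]_(m, n)) : C1v (fun x => A *m x) /\
  forall x, grad (fun x => A *m x) x = A.
Proof.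
have dA i j x : h^-1 *: (((fun x : 'cV[R]_n => (A *m x) i 0) \o shift x) (h *: delta_mx j 0) - (A *m x) i 0) @[h --> 0^'] --> A i j.
  apply: dist_cvg_dnbhs0 => e e0; exists 1 => // h h0 _ /=.
  rewrite /shift /= mulmxDr -scalemxAr mxE addrK mxE -colE mxE.
  by rewrite [_ *: _]mulrA mulVf// mul1r subrr normr0 ltW.
have P i j : partial j (fun x => (A *m x) i 0) = fun=> A i j.
  by apply/funext => x; apply/cvg_lim => //; exact: dA.
split; last by move=> x; apply/matrixP => i j; rewrite mxE P.
move=> i; split.
  move=> x; under eq_fun do rewrite mxE.
  apply: continuous_at_sum => k.
  have ck : continuous (fun x : 'cV[R]_n => A i k * x k 0).
    by apply: continuous_mulf; [exact: continuous_cstf|exact: coord_continuous].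
  exact: ck.
move=> j; split; first by move=> x; apply/cvg_ex; exists (A i j); exact: dA.
by rewrite P; exact: continuous_cstf.
Qed.

Lemma C1v_lincomb w1 w2 (a b : R) : C1v w1 -> C1v w2 ->
  C1v (fun x => a *: w1 x + b *: w2 x) /\
  forall x, grad (fun x => a *: w1 x + b *: w2 x) x = a *: grad w1 x + b *: grad w2 x.
Proof.
move=> C1 C2.
have E i : (fun x => (a *: w1 x + b *: w2 x) i 0) = (fun x => a * w1 x i 0 + b * w2 x i 0).
  by apply/funext => x; rewrite !mxE.
split; first by move=> i; rewrite E; exact: (C1_lincomb a b (C1 i) (C2 i)).1.
move=> x; apply/matrixP => i j; rewrite !mxE E.
exact: (C1_lincomb a b (C1 i) (C2 i)).2.
Qed.

Lemma C1v_affine w (B : 'M[R]_n) h : C1v w ->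
  C1v (fun x => w (B *m x + h)) /\
  forall x, grad (fun x => w (B *m x + h)) x = grad w (B *m x + h) *m B.
Proof.
move=> C; split; first by move=> i; exact: (C1_affine B h (C i)).1.
move=> x; apply/matrixP => i j; rewrite !mxE (C1_affine B h (C i)).2.
by apply: eq_bigr => k _; rewrite mxE.
Qed.

Lemma C1v_Lploc w : C1v w -> Lploc p w.
Proof. by move=> /C1v_continuous/(Lploc_continuous p1). Qed.

Lemma opnorm_powR_integral_le (D : set 'cV[R]_n) (g : 'cV[R]_n -> 'M[R]_(m, n)) M :
  measurable D -> (forall x, D x -> `|g x| <= M) -> 0 <= M ->
  (\int[leb n]_(x in D) (opnorm (g x) `^ p)%:E <= ((m%:R * n%:R * M) `^ p)%:E * leb n D)%E.
Proof.
move=> mD gM M0; rewrite -integral_cst//.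
apply: ge0_le_lower_integral => x Dx; rewrite lee_fin ?powR_ge0//.
have [oge0 ole] := opnorm_bounds (g x).
by rewrite (ler_powR_nneg p1)// (le_trans ole)// ler_wpM2l ?mulr_ge0// gM.
Qed.

Lemma bounded_leb_lty (D : set 'cV[R]_n) : measurable D -> bounded_set D ->
  (leb n D < +oo)%E.
Proof.
move=> mD /bounded_cball[r r0 Dr]; apply: (le_lt_trans _ (leb_cball_lty n r)).
by apply: le_measure => //; rewrite inE//; exact: measurable_cball.
Qed.

(** [core_bound] is stated for Sobolev gradients; this makes it applicable to the classical
    gradient. *)
Lemma C1v_W1p (D : set 'cV[R]_n) w : open D -> bounded_set D -> C1v w ->
  W1p_with_gradient p D w (grad w).
Proof.
move=> oD bD Cw; have mD := open_measurable_mx oD.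
have [r r0 Dr] := bounded_cball bD.
have cg := C1v_grad_continuous Cw.
have mg : measurable_fun setT (grad w).
  apply: measurable_mxP => i j; apply: continuous_measurable_mx => x.
  apply: (@continuous_comp _ _ _ (grad w) (fun M : 'M[R]_(m, n) => M i j)); first exact: cg.
  exact: coord_continuous.
have /LplocP[] := C1v_Lploc Cw.
move=> mw /(_ r (ltW r0)) /integrableP[_ Iw]; split.
- split; first exact: measurable_funTS.
  apply: le_lt_trans Iw.
  apply: (@le_trans _ _ (\int[leb n]_(x in cball r) (enorm (w x) `^ p)%:E)%E); last first.
    by apply: ge0_le_lower_integral => x _; rewrite ?lee_fin ?powR_ge0//= ler_norm.
  apply: ge0_subset_integral => //.
  + exact: measurable_cball.
  + by apply/measurable_EFinP/measurable_funTS; exact: measurable_enorm_powR.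
  by move=> x _; rewrite lee_fin powR_ge0.
- exact: measurable_funTS.
- have cn : continuous (fun x => `|grad w x|).
    by move=> x; apply: continuous_comp; [exact: cg|exact: norm_continuous].
  have [M M0 gM] := continuous_bounded_cball r cn.
  apply: (@le_lt_trans _ _ (((m%:R * n%:R * M) `^ p)%:E * leb n D)%E).
    apply: opnorm_powR_integral_le => //; last exact: ltW.
    by move=> x Dx; rewrite -[leLHS]normr_id; apply: gM; exact: Dr.
  by rewrite lte_mul_pinfty ?lee_fin ?powR_ge0// bounded_leb_lty.
- move=> phi tphi i j; rewrite (C1_weak_derivative j (Cw i) tphi).
  by congr (- _); apply: eq_Rintegral => x _; rewrite mxE.
Qed.

End C1_vector.

(** * Packings by copies of D *)

Section packing.
Context {R : realType} (m n : nat) (n_gt0 : (0 < n)%N) (p : R) (p1 : 1 <= p).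
Context (G : set 'M[R]_n) (subG : SO_subgroup G).
Context (D : set 'cV[R]_n) (openD : open D) (bndD : bounded_set D).
Context (alpha : ('cV[R]_n -> 'cV[R]_m) -> set 'cV[R]_n -> R).
Context (alpha_core : p_core_functional p G D alpha).
Implicit Types (u v w : 'cV[R]_n -> 'cV[R]_m) (U V : set 'cV[R]_n).
Implicit Types (s : seq (set 'cV[R]_n)) (e t : R).

Let p0 : 0 < p. Proof. exact: lt_le_trans p1. Qed.

Lemma SO_norm_le1 (A : 'M[R]_n) : SO A -> `|A| <= 1.
Proof.
move=> [AA _]; apply: mx_norm_le => // i j.
have : (A^T *m A) j j = 1 by rewrite AA mxE eqxx.
rewrite mxE => H; rewrite -(@ler_pXn2r _ 2) ?nnegrE// expr1n real_normK ?num_real// -H.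
rewrite (bigD1 i)//= mxE -expr2 lerDl sumr_ge0// => k _.
by rewrite mxE -expr2 sqr_ge0.
Qed.

Lemma similarity1E t (c x : 'cV[R]_n) : similarity t 1%:M c x = t *: x + c.
Proof. by rewrite /similarity mul1mx. Qed.

Lemma Gamma_homothety t (c : 'cV[R]_n) : 0 < t -> Gamma G (similarity t 1%:M c).
Proof. by move=> t0; exists t, 1%:M, c; split => //; case: subG. Qed.

Lemma all_copies_ref : all_copies G D setT D.
Proof.
exists 1 => //=; exists 1%:M, 0; split => //; first by case: subG.
apply/seteqP; split=> [x Dx|_ [x Dx <-]]; last by rewrite similarity1E scale1r addr0.
by exists x => //; rewrite similarity1E scale1r addr0.
Qed.

Lemma copies_all e U D' : 0 < e -> copies G D e U D' -> all_copies G D setT D'.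
Proof. by move=> e0 [A [h [GA -> _]]]; exists e => //; exists A, h. Qed.

Lemma copies_subset e U V D' : U `<=` V -> copies G D e U D' -> copies G D e V D'.
Proof. by move=> UV [A [h [GA -> sU]]]; exists A, h; split => //; exact: subset_trans UV. Qed.

Lemma copies_homothety t c e U D' : copies G D e U D' ->
  copies G D (t * e) (similarity t 1%:M c @` U) (similarity t 1%:M c @` D').
Proof.
move=> [A [h [GA -> sU]]]; exists A, (t *: h + c); split => //.
  rewrite image_comp; congr (_ @` _); apply/funext => x /=.
  by rewrite similarity1E /similarity scalerDr scalerA addrA.
by apply: image_subset.
Qed.

Lemma alpha_homothety u t c D' : 0 < t -> Lploc p u -> all_copies G D setT D' ->
  alpha u (similarity t 1%:M c @` D') = alpha (u \o similarity t 1%:M c) D'.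
Proof.
by move=> t0 Lu aD'; rewrite (core_similarity alpha_core)//; exact: Gamma_homothety.
Qed.

(** Families in [bmo_eps] may contain the empty set, which the packings below exclude. An empty copy
    forces [D] to be empty, and then [core_bound] reads [alpha u D <= 0]. *)
Lemma alpha_copies_set0 u e U : 0 < e -> Lploc p u -> copies G D e U set0 ->
  alpha u set0 = 0.
Proof.
move=> e0 Lu cU; have [A [h [_ D0 _]]] := cU.
have {}D0 : D = set0.
  by apply/seteqP; split => x // Dx; suff : set0 (similarity e A h x) by []; rewrite D0; exists x.
apply/eqP; rewrite eq_le; apply/andP; split; last first.
  exact: (core_ge0 alpha_core Lu (copies_all e0 cU)).
have [c c0 bd] := core_bound alpha_core.
have := bd u (fun=> 0) Lu; rewrite D0 -lee_fin => /(_ _)/le_trans; apply.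
  split; rewrite ?integral_set0 ?ltry//.
  - split; first exact: measurable_fun_set0.
    by rewrite integral_set0 ltry.
  by move=> phi _ i j; rewrite !Rintegral_set0 oppr0.
by rewrite integral_set0 mule0.
Qed.

(** [core_bound] concerns [D] alone, so [w] is pulled back by the similarity. The chain rule
    multiplies [grad w] by [e *: A], and the entries of a rotation are at most 1; the p-th power
    then yields the powers of [e] and [h]. *)
Lemma energy_bound : exists2 C : R, 0 < C & forall w e U D' (h : R), C1v w ->
  0 < e -> copies G D e U D' -> 0 <= h -> (forall x, D' x -> `|grad w x| <= h) ->
  alpha w D' <= C * e `^ p * h `^ p.
Proof.
have mD := open_measurable_mx openD.
have Dfin := bounded_leb_lty mD bndD.
have [c c0 bd] := core_bound alpha_core.
pose L := fine (leb n D).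
have L0 : 0 <= L by rewrite fine_ge0.
have Lfin : leb n D = L%:E by rewrite fineK// ge0_fin_numE.
(* Two factors come from [opnorm_bounds], the last [n] from the matrix product in the chain rule. *)
pose K := (m%:R * n%:R * n%:R : R) `^ p.
have K0 : 0 <= K by rewrite powR_ge0.
exists (c * K * L + 1); first by rewrite ltr_wpDl// !mulr_ge0// ltW.
move=> w e U D' h Cw e0 [A [k [GA D'E _]]] h0 wh.
have Lw := C1v_Lploc p1 Cw.
have aDE : alpha w D' = alpha (w \o similarity e A k) D.
  rewrite D'E (core_similarity alpha_core)//; first exact: all_copies_ref.
  by exists e, A, k.
have wE : w \o similarity e A k = (fun x => w ((e *: A) *m x + k)).
  by apply/funext => x; rewrite /= /similarity scalemxAl.
have [Cw' gw'] := C1v_affine (e *: A) k Cw.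
have A1 : `|A| <= 1 by apply: SO_norm_le1; case: subG => GS _ _ _; exact: GS.
have := bd _ _ (C1v_Lploc p1 Cw') (C1v_W1p p1 openD bndD Cw').
rewrite aDE wE => /le_trans => /(_ (c * (K * (e `^ p * h `^ p)) * L)%:E).
rewrite lee_fin => H; apply: (le_trans (H _)); last first.
  rewrite -[leRHS]mulrA mulrDl mul1r -[leLHS]addr0 lerD ?mulr_ge0 ?powR_ge0//.
  by rewrite le_eqVlt; apply/orP; left; apply/eqP; ring.
have -> : c * (K * (e `^ p * h `^ p)) * L = c * (K * (e `^ p * h `^ p) * L) by rewrite !mulrA.
rewrite [X in (_ <= X)%E]EFinM lee_pmul2l ?lte_fin//.
apply: le_trans (opnorm_powR_integral_le p1 (M := n%:R * h * e) mD _ _) _.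
- move=> x Dx; rewrite gw' (le_trans (mulmx_norm_le _ _))//.
  rewrite normrZ gtr0_norm// -!mulrA ler_wpM2l// ler_pM//.
  + by rewrite mulr_ge0// ltW.
  + by apply: wh; rewrite D'E; exists x => //; rewrite /similarity scalemxAl.
  by rewrite ler_piMr// ltW.
- by rewrite !mulr_ge0// ltW.
rewrite Lfin -EFinM lee_fin /K ler_wpM2r// -!powRM ?mulr_ge0 ?(ltW e0)//.
by rewrite le_eqVlt; apply/orP; left; apply/eqP; congr (_ `^ _); ring.
Qed.

(** Nonempty disjoint sets cannot repeat in a list, so sums over the list are sums over the set of
    its members. *)
Definition packs e U s := (forall D', D' \in s -> copies G D e U D' /\ D' !=set0) /\
  pairwise (fun A B : set 'cV[R]_n => `[< A `&` B = set0 >]) s.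

Definition psum e u s := e `^ (n%:R - p) * \sum_(D' <- s) alpha u D'.

Lemma packs_cons e U D' s : packs e U (D' :: s) ->
  [/\ copies G D e U D', D' !=set0, packs e U s & forall D'', D'' \in s -> D' `&` D'' = set0].
Proof.
move=> [cs /= /andP[/allP D's ps]]; have [c1 c2] := cs D' (mem_head _ _).
split=> //; last by move=> D'' /D's/asboolP.
by split=> // D'' D''s; apply: cs; rewrite inE D''s orbT.
Qed.

Lemma packs_uniq e U s : packs e U s -> uniq s.
Proof.
elim: s => // D' s IH /packs_cons[_ D'0 /IH us dis] /=; rewrite us andbT.
apply/negP => /dis; rewrite setIid => D'E; by move: D'0; rewrite D'E => -[].
Qed.

Lemma packs_disjoint e U s A B : packs e U s -> A \in s -> B \in s ->
  A != B -> A `&` B = set0.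
Proof.
elim: s => // D' s IH /packs_cons[_ _ /IH{}IH dis]; rewrite !inE.
move=> /predU1P[->|As] /predU1P[->|Bs] AB; [by rewrite eqxx in AB|exact: dis| |exact: IH].
by rewrite setIC; exact: dis.
Qed.

Lemma packs_subset e U V s : U `<=` V -> packs e U s -> packs e V s.
Proof.
move=> UV [cs ps]; split=> // D' /cs[c1 c2]; split=> //; exact: copies_subset c1.
Qed.

Lemma packs_filter e U V s (a : pred (set 'cV[R]_n)) :
  (forall D', D' \in s -> a D' -> D' `<=` V) -> packs e U s -> packs e V [seq D' <- s | a D'].
Proof.
move=> aV [cs ps]; split; last exact: pairwise_filter.
move=> D'; rewrite mem_filter => /andP[aD' D's]; have [[A [h [GA E _]]] c2] := cs _ D's.
by split=> //; exists A, h; split=> //; exact: aV.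
Qed.

(* Every copy contains a cube of comparable size, so that no rotation
   invariance of the Lebesgue measure is needed to count disjoint copies. *)
Lemma copies_cube : D !=set0 -> exists2 k : R, 0 < k &
  forall e U D', 0 < e -> copies G D e U D' ->
  exists c : 'cV[R]_n, [set y : 'cV[R]_n | forall i, c i 0 - k * e < y i 0 < c i 0 + k * e] `<=` D'.
Proof.
move=> [x0 Dx0].
have /nbhs_normP[d /= d0 dD] : nbhs x0 D by exact: open_nbhs_nbhs.
have nR : 0 < n%:R :> R by rewrite ltr0n.
exists (d / n%:R); first by rewrite divr_gt0.
move=> e U D' e0 [A [h [GA -> _]]].
have [AA _] : SO A by case: subG => GS _ _ _; exact: GS.
have AA' : A *m A^T = 1%:M by exact: mulmx1C.
exists (similarity e A h x0) => y yP.
(* The preimage under the similarity, with the transpose as inverse rotation; the divisor in [d / n]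
   absorbs the factor [n] of the matrix product. *)
exists (x0 + e^-1 *: (A^T *m (y - similarity e A h x0))).
  apply: dD; rewrite /= opprD addrA subrr sub0r normrN normrZ gtr0_norm ?invr_gt0//.
  rewrite mulrC ltr_pdivrMr//.
  have yx : `|y - similarity e A h x0| < d / n%:R * e.
    apply: mx_norm_lt => [|i j]; first by rewrite mulr_gt0// divr_gt0.
    by have := yP i; rewrite ord1 !mxE ltr_norml => /andP[? ?]; apply/andP; split; lra.
  apply: le_lt_trans (mulmx_norm_le _ _) _.
  apply: le_lt_trans (_ : n%:R * `|y - similarity e A h x0| < _); last first.
    by move: yx; rewrite mulrAC ltr_pdivlMr// mulrC.
  rewrite ler_wpM2r// ler_piMr//; apply: mx_norm_le => // i j; rewrite mxE.
  rewrite (le_trans (ler_mx_norm_entry _ _ _))//; apply: SO_norm_le1.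
  by case: subG => GS _ _ _; exact: GS.
rewrite {1}/similarity mulmxDr scalerDr -scalemxAr scalerA mulfV ?gt_eqF// scale1r.
by rewrite mulmxA AA' mul1mx addrAC -/(similarity e A h x0) addrC subrK.
Qed.

(** The copies contain disjoint cubes of side [2 k e]. In the induction the cube of the head is
    removed from [U]: the other copies miss it and lie in what remains. *)
Lemma packs_count : D !=set0 -> exists2 k : R, 0 < k &
  forall e U s, 0 < e -> measurable U -> packs e U s ->
  ((size s)%:R%:E * (k * e ^+ n)%:E <= leb n U)%E.
Proof.
move=> /copies_cube[k k0 kP]; exists ((2 * k) ^+ n); first by rewrite exprn_gt0// mulr_gt0.
move=> e U s e0; elim: s U => [|D' s IH] U mU; first by rewrite mul0e.
move=> /packs_cons[cD' _ ps dis].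
have [c cP] := kP _ _ _ e0 cD'.
set Q := [set y | _] in cP.
have ke : 0 < k * e by rewrite mulr_gt0.
pose S (i : 'I_n) := `]c i 0 - k * e, c i 0 + k * e[%classic : set R.
have QE : Q = [set y : 'cV[R]_n | forall i, S i (y i 0)].
  by apply/seteqP; split=> y yQ i; have := yQ i; rewrite /S /= in_itv.
have mS i : measurable (S i) by exact: measurable_itv.
have mQ : measurable Q.
  rewrite QE; apply: (@measurable_forall_fin _ 'cV[R]_n) => i.
  by rewrite -[X in measurable X]setTI; exact: measurable_entry.
have lQ : leb n Q = ((2 * k) ^+ n * e ^+ n)%:E.
  rewrite QE (@leb_cube _ _ S (2 * k * e)) ?exprMn ?mulr_ge0 ?(ltW k0) ?(ltW e0)//.
  move=> i; rewrite lebesgue_measure_itv /= lte_fin ifT; last by lra.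
  by rewrite -EFinD; congr EFin; lra.
have QU : Q `<=` U by apply: subset_trans cP _; case: cD' => A [h [_ -> ]].
have psQ : packs e (U `\` Q) s.
  case: ps => cs pw; split=> // D'' D''s; have [[A [h [GA E sU]]] ne] := cs _ D''s.
  split=> //; exists A, h; split=> // x D''x; split; first exact: sU.
  by move=> /cP D'x; have : (D' `&` D'') x by []; rewrite dis.
have -> : leb n U = (leb n (U `\` Q) + leb n Q)%E.
  by rewrite (measureDI (leb n) mU mQ) (setIidr QU).
rewrite lQ /= -natr1 EFinD muleDl//.
rewrite mul1e leeD2r//; apply: IH => //; exact: measurableD.
Qed.

(** At most [|U| / (k e^n)] copies, each of energy at most [C e^p h^p]: with the factor [e^(n-p)]
    the powers of [e] cancel, so the bound is the same at every scale. *)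
Lemma psum_energy : exists2 C : R, 0 < C & forall w e U s (h : R), C1v w ->
  0 < e -> measurable U -> (leb n U < +oo)%E -> packs e U s -> 0 <= h ->
  (forall x, U x -> `|grad w x| <= h) ->
  psum e w s <= C * h `^ p * fine (leb n U).
Proof.
have [C C0 CP] := energy_bound.
have [D0|/set0P D0] := eqVneq D set0.
  exists 1 => // w e U s h Cw e0 mU fU [cs _] h0 wh.
  have -> : s = [::].
    case: s cs => // D' s cs; have [[A [k [_ E _]]] [y]] := cs D' (mem_head _ _).
    by rewrite E D0 image_set0.
  by rewrite /psum big_nil mulr0 mul1r mulr_ge0 ?powR_ge0// fine_ge0.
have [k k0 kP] := packs_count D0.
exists (C / k); first by rewrite divr_gt0.
move=> w e U s h Cw e0 mU fU ps h0 wh.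
have sC : \sum_(D' <- s) alpha w D' <= (size s)%:R * (C * e `^ p * h `^ p).
  apply: le_trans (_ : \sum_(D' <- s) C * e `^ p * h `^ p <= _); last first.
    by rewrite big_const_seq count_predT iter_addr_0 mulr_natl.
  rewrite big_seq [leRHS]big_seq; apply: ler_sum => D' D's.
  have [c _] := ps.1 _ D's; apply: (CP _ _ _ _ _ Cw e0 c h0).
  by move=> x D'x; apply: wh; case: c D'x => A [k' [_ -> ]]; apply.
have := kP _ _ _ e0 mU ps.
rewrite -[leb n U]fineK ?ge0_fin_numE// -EFinM lee_fin => cnt.
rewrite /psum (le_trans (ler_wpM2l (powR_ge0 _ _) sC))//.
have -> : e `^ (n%:R - p) * ((size s)%:R * (C * e `^ p * h `^ p)) =
    C / k * h `^ p * ((size s)%:R * (k * e ^+ n)).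
  have -> : e ^+ n = e `^ (n%:R - p) * e `^ p.
    have en0 : e != 0 by rewrite gt_eqF.
    by rewrite -powRD ?en0 ?implybT// subrK powR_mulrn// ltW.
  by field; rewrite gt_eqF.
by rewrite ler_wpM2l// !mulr_ge0 ?powR_ge0 ?invr_ge0 ?(ltW C0) ?(ltW k0).
Qed.

Lemma psum_ge0 e u U s : 0 < e -> Lploc p u -> packs e U s -> 0 <= psum e u s.
Proof.
move=> e0 Lu [cs _]; rewrite mulr_ge0 ?powR_ge0// big_seq sumr_ge0// => D' /cs[c _].
by apply: (core_ge0 alpha_core) => //; exact: copies_all c.
Qed.

Lemma psum_le_bmo_eps e u U s : 0 < e -> Lploc p u -> packs e U s ->
  ((psum e u s)%:E <= bmo_eps p G D alpha e u U)%E.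
Proof.
move=> e0 Lu ps; have [cs pw] := ps.
rewrite /psum /bmo_eps EFinM lee_wpmul2l ?lee_fin ?powR_ge0//.
apply: ereal_sup_ubound; exists [set` s] => /=.
  split; first by move=> D' /= /cs[].
  move=> A B /= As Bs [x ABx]; apply/eqP/negPn/negP => /(packs_disjoint ps As Bs).
  by move=> AB0; rewrite AB0 in ABx.
rewrite esum_fset; [|exact: finite_seq|]; last first.
  move=> D' /set_mem /= /cs[c _]; rewrite lee_fin; apply: (core_ge0 alpha_core) => //; exact: copies_all c.
by rewrite -fsbig_seq ?(packs_uniq ps)// sumEFin.
Qed.

(** [esum] is a supremum over finite subfamilies, so finite lists decide the bound once empty
    members, where [alpha] is 0, are dropped. *)
Lemma bmo_eps_le e u U (b : \bar R) : 0 < e -> Lploc p u ->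
  (forall s, packs e U s -> ((psum e u s)%:E <= b)%E) ->
  (bmo_eps p G D alpha e u U <= b)%E.
Proof.
move=> e0 Lu H; have c0 : 0 < e `^ (n%:R - p) by rewrite powR_gt0.
rewrite /bmo_eps -lee_pdivlMl//; apply: ge_ereal_sup => _ [F [FU tF] <-].
apply: ge_ereal_sup => _ [A [fA AF] <-].
rewrite lee_pdivlMl// fsbig_finite//= sumEFin -EFinM.
pose s : seq (set 'cV[R]_n) := [seq B <- finmap.enum_fset (fset_set A) | B != set0].
have E : \sum_(B <- finmap.enum_fset (fset_set A)) alpha u B = \sum_(B <- s) alpha u B.
  rewrite big_filter [RHS]big_mkcond /= big_seq [RHS]big_seq; apply: eq_bigr => B.
  rewrite in_fset_set// => /set_mem/AF/FU cB; case: ifPn => // /negPn/eqP B0.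
  by rewrite B0 in cB *; exact: (alpha_copies_set0 e0 Lu cB).
rewrite E; apply: H; split.
  move=> B; rewrite mem_filter in_fset_set// => /andP[/set0P B0 /set_mem/AF/FU cB].
  by split.
apply/(pairwiseP set0) => i j; rewrite !inE => si sj ij.
have mem k : (k < size s)%N -> F (nth set0 s k).
  move=> sk; have := mem_nth set0 sk; rewrite mem_filter in_fset_set// => /andP[_ /set_mem]; exact: AF.
apply/seteqP; split => // x [xi xj].
have := tF _ _ (mem _ si) (mem _ sj) (ex_intro _ x (conj xi xj)).
move=> /eqP; rewrite nth_uniq//; first by rewrite (ltn_eqF ij).
by apply: filter_uniq; exact: finmap.fset_uniq.
Qed.

End packing.

(** * The density psi *)

Section real_estimates.
Context {R : realType} (p : R) (p1 : 1 <= p).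

Let p0 : 0 < p. Proof. exact: lt_le_trans p1. Qed.

Lemma bernoulli_le (x : R) k : 0 <= x <= 1 -> 1 - k%:R * x <= (1 - x) ^+ k.
Proof.
move=> /andP[x0 x1]; elim: k => [|k IH]; first by rewrite mul0r subr0 expr0.
rewrite exprS; apply: le_trans (_ : (1 - x) * (1 - k%:R * x) <= _); last first.
  by rewrite ler_wpM2l// subr_ge0.
have : 0 <= k%:R * x * x by rewrite !mulr_ge0.
by rewrite -natr1; nra.
Qed.

Lemma powR_le_id (x : R) : 0 <= x <= 1 -> x `^ p <= x.
Proof.
move=> /andP[x0 x1]; move: x0; rewrite le_eqVlt => /predU1P[<-|x0].
  by rewrite powR0// gt_eqF.
have xn0 : x != 0 by rewrite gt_eqF.
have -> : x `^ p = x * x `^ (p - 1).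
  rewrite -[X in _ = X * _](powRr1 (ltW x0)) -powRD ?xn0 ?implybT//.
  by congr (_ `^ _); ring.
have H1 : (1 : R) `^ (p - 1) = 1 by rewrite powR1.
rewrite ler_piMr ?(ltW x0)// -[leRHS]H1.
by apply: ge0_ler_powR; rewrite ?subr_ge0// nnegrE ltW.
Qed.

(* The weight of a convex combination after p-homogeneity:
   alpha (l *: (l^-1 *: u)) is estimated by l * l^-p * alpha u. *)
Definition cvx_weight (l : R) := l * l^-1 `^ p.

Lemma cvx_weight_ge0 l : 0 <= l -> 0 <= cvx_weight l.
Proof. by move=> l0; rewrite mulr_ge0 ?powR_ge0. Qed.

(** For an integer [N + 1 >= p] the weight of [1 - l] is at most [(1 - l)^-(N+1)], which Bernoulli's
    inequality bounds by [1 / (1 - (N+1) l)]. The choice of [l] makes [(N+1) l] half of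
    [tau / (S + tau)]. *)
Lemma cvx_weight_near1 S tau : 0 <= S -> 0 < tau ->
  exists2 l, 0 < l < 1 & cvx_weight (1 - l) * S <= S + tau.
Proof.
move=> S0 t0; have [N pN] : exists N : nat, p <= N.+1%:R.
  exists (Num.truncn p); have /andP[_ /ltW//] := truncn_itv (ltW p0).
have N0 : 0 < N.+1%:R :> R by [].
have S1 : 0 < S + 1 by rewrite ltr_wpDl.
have St : 0 < S + tau by rewrite ltr_wpDl.
pose l := tau / (S + tau) / N.+1%:R / 2.
have tS : 0 < tau / (S + tau) by rewrite divr_gt0.
have tS1 : tau / (S + tau) <= 1 by rewrite ler_pdivrMr// mul1r lerDr.
have l0 : 0 < l by rewrite !divr_gt0.
have Nl : N.+1%:R * l = tau / (S + tau) / 2.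
  by rewrite /l; field; rewrite !gt_eqF.
have l1 : l < 1.
  have : l <= N.+1%:R * l by rewrite ler_pMl// ler1n.
  by rewrite Nl; lra.
exists l; first by rewrite l0.
have ml0 : 0 < 1 - l by rewrite subr_gt0.
have H1 : cvx_weight (1 - l) <= ((1 - l) ^+ N.+1)^-1.
  rewrite /cvx_weight (le_trans (_ : _ <= 1 * (1 - l)^-1 `^ p))//.
    by rewrite ler_wpM2r ?powR_ge0//; lra.
  rewrite mul1r -exprVn -powR_mulrn ?invr_ge0 ?(ltW ml0)//.
  by apply: ler_powR => //; rewrite invf_ge1//; lra.
have H2 : 1 - tau / (S + tau) / 2 <= (1 - l) ^+ N.+1.
  by rewrite -Nl; apply: bernoulli_le; rewrite (ltW l0) ltW.
apply: (@le_trans _ _ ((1 - tau / (S + tau) / 2)^-1 * S)).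
  rewrite ler_wpM2r// (le_trans H1)// lef_pV2// posrE; last by lra.
  by rewrite exprn_gt0.
rewrite mulrC ler_pdivrMr; last by lra.
have -> : (S + tau) * (1 - tau / (S + tau) / 2) = S + tau / 2.
  by field; rewrite gt_eqF.
by lra.
Qed.

(** First [l] brings the weight of [1 - l] near 1, then [d] makes the perturbation small in spite of
    the possibly large weight of [l]. The bound [S] enters because the first error is proportional
    to [x]. *)
Lemma cvx_perturbation C S tau : 0 <= C -> 0 <= S -> 0 < tau ->
  exists l d, [/\ 0 < l < 1, 0 < d & forall x y b, 0 <= x <= S -> 0 <= b <= d ->
    y <= cvx_weight (1 - l) * x + cvx_weight l * (C * b `^ p) -> y <= x + tau].
Proof.
move=> C0 S0 t0; have t2 : 0 < tau / 2 by rewrite divr_gt0.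
have [l /andP[l0 l1] lS] := cvx_weight_near1 S0 t2.
pose X := cvx_weight l * C.
have X0 : 0 <= X by rewrite mulr_ge0 ?cvx_weight_ge0// ltW.
have X1 : 0 < X + 1 by rewrite ltr_wpDl.
(* The entry 1 allows the p-th power of [b] to be replaced by [b]. *)
exists l, (Num.min 1 (tau / 2 / (X + 1))); split; first by rewrite l0.
  by rewrite lt_min ltr01 divr_gt0.
move=> x y b /andP[x0 xS] /andP[b0]; rewrite le_min => /andP[b1 bd] /le_trans; apply.
have H : cvx_weight (1 - l) * x <= x + tau / 2.
  have [w1|w1] := leP 1 (cvx_weight (1 - l)).
    have : (cvx_weight (1 - l) - 1) * x <= (cvx_weight (1 - l) - 1) * S.
      by rewrite ler_wpM2l// subr_ge0.
    by lra.
  have : cvx_weight (1 - l) * x <= 1 * x by rewrite ler_wpM2r// ltW.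
  by lra.
suff : cvx_weight l * (C * b `^ p) <= tau / 2 by lra.
rewrite mulrA -/X (le_trans (_ : _ <= (X + 1) * b))//.
  rewrite ler_pM ?powR_ge0// ?lerDl// powR_le_id// b0.
  by [].
by move: bd; rewrite ler_pdivlMr// mulrC.
Qed.

End real_estimates.

Lemma ereal_cvg_right0 (R : realType) (f : R -> \bar R) (L : R) :
  (forall tau, 0 < tau -> exists2 e0 : R, 0 < e0 & forall e, 0 < e < e0 ->
    ((L - tau)%:E <= f e <= (L + tau)%:E)%E) ->
  f e @[e --> 0^'+] --> L%:E.
Proof.
move=> H; apply/fine_cvgP; split.
  have [e0 e00 fe] := H 1 ltr01; near=> e.
  have /fe/andP[f1 f2] : 0 < e < e0.
    by apply/andP; split; near: e; [exact: nbhs_right_gt|exact: nbhs_right_lt].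
  rewrite fin_numElt (lt_le_trans _ f1) ?ltNyr//.
  by rewrite (le_lt_trans f2) ?ltry.
apply/cvgrPdist_le => tau t0; have [e0 e00 fe] := H tau t0; near=> e.
have /fe/andP[] : 0 < e < e0.
  by apply/andP; split; near: e; [exact: nbhs_right_gt|exact: nbhs_right_lt].
rewrite /=; move: (f e) => [r| |] //=; rewrite !lee_fin => f1 f2.
by rewrite ler_norml; apply/andP; split; lra.
Unshelve. all: by end_near. Qed.

Local Notation grid n M := {ffun 'I_n -> 'I_M}.

Section grid.
Context {R : realType} (n : nat).

Definition gcell (a t : R) M (k : grid n M) : set 'cV[R]_n :=
  [set x | forall i, a + (k i)%:R * t < x i 0 < a + (k i).+1%:R * t].

Definition gcenter (a t : R) M (k : grid n M) : 'cV[R]_n :=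
  \col_i (a + ((k i)%:R + 2^-1) * t).

Lemma gcellE a t M (k : grid n M) : 0 < t ->
  similarity t 1%:M (gcenter a t k) @` @open_cube R n = gcell a t k.
Proof.
move=> t0; apply/seteqP; split => [_ [x xQ <-] i|x xk].
  rewrite similarity1E !mxE -[(k i).+1%:R]natr1; have /andP[x1 x2] := xQ i.
  have : t * x i 0 < t * 2^-1 by rewrite ltr_pM2l.
  have : t * - 2^-1 < t * x i 0 by rewrite ltr_pM2l.
  by move=> ? ?; apply/andP; split; lra.
exists (t^-1 *: (x - gcenter a t k)).
  move=> i; rewrite !mxE [t^-1 * _]mulrC ltr_pdivlMr// ltr_pdivrMr//.
  by have := xk i; rewrite -[(k i).+1%:R]natr1 => /andP[? ?]; apply/andP; split; lra.
by rewrite similarity1E scalerA mulfV ?gt_eqF// scale1r subrK.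
Qed.

Lemma gcell_disjoint a t M (k k' : grid n M) : 0 < t -> k != k' ->
  gcell a t k `&` gcell a t k' = set0.
Proof.
move=> t0 kk'; apply/seteqP; split => // x [xk xk'].
suff E : k = k' by rewrite E eqxx in kk'.
have H (u v : grid n M) i : gcell a t u x -> gcell a t v x -> (u i <= v i)%N.
  move=> /(_ i)/andP[x1 _] /(_ i)/andP[_ x2].
  have : (u i)%:R * t < (v i).+1%:R * t by lra.
  by rewrite ltr_pM2r// ltr_nat ltnS.
by apply/ffunP => i; apply/val_inj/eqP; rewrite eqn_leq !H.
Qed.

End grid.

Section psi.
Context {R : realType} (m n : nat) (n_gt0 : (0 < n)%N) (p : R) (p1 : 1 <= p).
Context (G : set 'M[R]_n) (subG : SO_subgroup G).
Context (D : set 'cV[R]_n) (openD : open D) (bndD : bounded_set D).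
Context (alpha : ('cV[R]_n -> 'cV[R]_m) -> set 'cV[R]_n -> R).
Context (alpha_core : p_core_functional p G D alpha).
Implicit Types (u v w : 'cV[R]_n -> 'cV[R]_m) (U V : set 'cV[R]_n).
Implicit Types (s : seq (set 'cV[R]_n)) (e t : R) (A B : 'M[R]_(m, n)).

Local Notation packs := (packs G D).
Local Notation psum := (psum p alpha).
Local Notation cube := (@open_cube R n).
Local Notation lin A := (fun x : 'cV[R]_n => A *m x).
Let p0 : 0 < p. Proof. exact: lt_le_trans p1. Qed.

Lemma Lploc_linear A : Lploc p (lin A).
Proof. by apply: (C1v_Lploc p1); exact: (C1v_linear A).1. Qed.

Lemma open_cubeE : cube = [set x | forall i, `]- 2^-1, 2^-1[%classic (x i 0)].
Proof. by apply/seteqP; split => x xQ i; have := xQ i; rewrite /= in_itv. Qed.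

Lemma measurable_open_cube : measurable cube.
Proof.
rewrite open_cubeE; apply: (@measurable_forall_fin _ 'cV[R]_n) => i.
by rewrite -[X in measurable X]setTI; exact: measurable_entry.
Qed.

Lemma leb_open_cube : leb n cube = 1%E.
Proof.
rewrite open_cubeE (@leb_cube _ _ (fun=> `]- 2^-1, 2^-1[%classic) 1) ?expr1n//.
move=> i; rewrite lebesgue_measure_itv /= lte_fin ifT; last by lra.
by rewrite -EFinD; congr EFin; lra.
Qed.

Lemma alpha_split u w D' l : Lploc p u -> Lploc p w -> all_copies G D setT D' ->
  0 < l < 1 -> alpha (fun x => u x + w x) D' <=
    cvx_weight p (1 - l) * alpha u D' + cvx_weight p l * alpha w D'.
Proof.
move=> Lu Lw aD /andP[l0 l1]; have ml0 : 0 < 1 - l by rewrite subr_gt0.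
have Z (v : 'cV[R]_n -> 'cV[R]_m) c : Lploc p v -> Lploc p (fun x => c *: v x).
  move=> Lv; have := Lploc_lincomb p1 c 0 Lv Lv.
  by under [in X in X -> _]eq_fun do rewrite scale0r addr0.
have := core_convex alpha_core (Z _ (1 - l)^-1 Lu) (Z _ l^-1 Lw) aD (t := 1 - l).
rewrite subr_ge0 (ltW l1) lerBlDr lerDl (ltW l0) => /(_ isT).
rewrite opprB addrCA subrr addr0 !(core_homogeneous alpha_core)//.
rewrite !gtr0_norm ?invr_gt0// !mulrA; apply: le_trans.
rewrite le_eqVlt; apply/orP; left; apply/eqP; congr alpha; apply/funext => x.
by rewrite !scalerA !mulfV ?gt_eqF// !scale1r.
Qed.

Lemma psum_split e u w U s l : 0 < e -> Lploc p u -> Lploc p w -> packs e U s ->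
  0 < l < 1 -> psum e (fun x => u x + w x) s <=
    cvx_weight p (1 - l) * psum e u s + cvx_weight p l * psum e w s.
Proof.
move=> e0 Lu Lw [cs _] l01.
rewrite /psum mulrCA [X in _ <= _ + X]mulrCA -mulrDr ler_wpM2l ?powR_ge0//.
rewrite !mulr_sumr -big_split /= big_seq [leRHS]big_seq; apply: ler_sum => D' /cs[c _].
by apply: alpha_split => //; exact: copies_all c.
Qed.

Lemma packs_homothety t c e U s : 0 < t -> packs e U s ->
  packs (t * e) (similarity t 1%:M c @` U) [seq similarity t 1%:M c @` D' | D' <- s].
Proof.
move=> t0 [cs pw]; split.
  move=> _ /mapP[D' /cs[cD' [x D'x]] ->]; split; first exact: copies_homothety.
  by exists (similarity t 1%:M c x); exists x.
rewrite pairwise_map; apply: sub_pairwise pw => A B /= /asboolP AB; apply/asboolP.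
apply/seteqP; split => // _ [[x Ax <-] [y By]].
rewrite !similarity1E => /addIr/(scalerI (negbT (gt_eqF t0))) xy.
have : (A `&` B) x by split=> //; rewrite -xy.
by rewrite AB.
Qed.

(** A homothety turns the linear map into [t] times itself plus a constant: homogeneity gives [t^p]
    and the normalisation [t^(n-p)], together the factor [t^n] by which volumes scale. *)
Lemma psum_homothety A t c e U s : 0 < t -> 0 < e -> packs e U s ->
  psum (t * e) (lin A) [seq similarity t 1%:M c @` D' | D' <- s] =
  t ^+ n * psum e (lin A) s.
Proof.
move=> t0 e0 [cs _]; rewrite /psum big_map.
have -> : \sum_(D' <- s) alpha (lin A) (similarity t 1%:M c @` D') =
    t `^ p * \sum_(D' <- s) alpha (lin A) D'.
  rewrite mulr_sumr big_seq [RHS]big_seq; apply: eq_bigr => D' /cs[cD' _].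
  have aD := copies_all e0 cD'; have LA := Lploc_linear A.
  rewrite (alpha_homothety subG alpha_core)//.
  have -> : lin A \o similarity t 1%:M c = (fun x => t *: (A *m x) + A *m c).
    by apply/funext => x /=; rewrite similarity1E mulmxDr scalemxAr.
  have LtA : Lploc p (fun x : 'cV[R]_n => t *: (A *m x)).
    by have := Lploc_linear (t *: A); under [in X in X -> _]eq_fun do rewrite -scalemxAl.
  transitivity (alpha (fun x : 'cV[R]_n => t *: (A *m x)) D').
    exact: (core_translation alpha_core (A *m c) LtA aD).
  by have := core_homogeneous alpha_core t LA aD; rewrite gtr0_norm.
have tn0 : t != 0 by rewrite gt_eqF.
have -> : t ^+ n = t `^ (n%:R - p) * t `^ p.
  by rewrite -powRD ?tn0 ?implybT// subrK powR_mulrn// ltW.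
by rewrite powRM ?(ltW t0) ?(ltW e0)//; ring.
Qed.

Lemma packs_flatten (I : eqType) (r : seq I) (U_ : I -> set 'cV[R]_n)
    (s_ : I -> seq (set 'cV[R]_n)) e V : uniq r ->
  (forall i j, i \in r -> j \in r -> i != j -> U_ i `&` U_ j = set0) ->
  (forall i, i \in r -> U_ i `<=` V) -> (forall i, i \in r -> packs e (U_ i) (s_ i)) ->
  packs e V (flatten [seq s_ i | i <- r]).
Proof.
elim: r => [//|i r IH] /= /andP[ir ur] dis UV ps.
have [] := IH ur _ _ _.
- by move=> j k jr kr; apply: dis; rewrite inE ?jr ?kr orbT.
- by move=> j jr; apply: UV; rewrite inE jr orbT.
- by move=> j jr; apply: ps; rewrite inE jr orbT.
move=> cs pw; have [ci pi] := packs_subset (UV i (mem_head _ _)) (ps i (mem_head _ _)).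
split; first by move=> D'; rewrite mem_cat => /orP[/ci|/cs].
rewrite pairwise_cat pw pi !andbT; apply/allrelP => A B As /flatten_mapP[j jr Bs].
apply/asboolP/seteqP; split => // x [Ax Bx].
have [[_ [_ [_ _ AU]]] _] := (ps i (mem_head _ _)).1 A As.
have jr' : j \in i :: r by rewrite inE jr orbT.
have [[_ [_ [_ _ BU]]] _] := (ps j jr').1 B Bs.
have <- := dis i j (mem_head _ _) jr' _; first by split; [exact: AU|exact: BU].
by apply: contraNneq ir => ->.
Qed.

Lemma psum_flatten (I : eqType) (r : seq I) (s_ : I -> seq (set 'cV[R]_n)) e u :
  psum e u (flatten [seq s_ i | i <- r]) = \sum_(i <- r) psum e u (s_ i).
Proof.
rewrite /psum -mulr_sumr; congr (_ * _).
by elim: r => [|i r IH] /=; rewrite ?big_nil// big_cat big_cons IH.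
Qed.

(** With the supremum over all scales, the upper bound for packings of the cube holds at each scale
    by definition, and the limit requires a lower bound only. *)
Definition psi A : R := sup [set psum es.1 (lin A) es.2 |
  es in [set es : R * seq (set 'cV[R]_n) | 0 < es.1 /\ packs es.1 cube es.2]].

Lemma packs_nil e U : packs e U [::].
Proof. by []. Qed.

Lemma psi_bound : exists2 C : R, 0 < C & forall A e s, 0 < e -> packs e cube s ->
  psum e (lin A) s <= C * `|A| `^ p.
Proof.
have [C C0 H] := psum_energy n_gt0 p1 subG openD bndD alpha_core.
exists C => // A e s e0 ps; have [CA gA] := C1v_linear A.
have := H _ _ _ _ `|A| CA e0 measurable_open_cube _ ps.
rewrite leb_open_cube ltry /= mulr1; apply => // x _.
by rewrite gA.
Qed.

Lemma psi_has_sup A : has_sup [set psum es.1 (lin A) es.2 |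
  es in [set es : R * seq (set 'cV[R]_n) | 0 < es.1 /\ packs es.1 cube es.2]].
Proof.
have [C C0 H] := psi_bound; split.
  by exists (psum 1 (lin A) [::]); exists (1, [::]).
by exists (C * `|A| `^ p) => _ [[e s] /= [e0 ps] <-]; exact: H.
Qed.

Lemma psum_le_psi A e s : 0 < e -> packs e cube s -> psum e (lin A) s <= psi A.
Proof.
by move=> e0 ps; apply: ub_le_sup; [exact: (psi_has_sup A).2|exists (e, s)].
Qed.

Lemma psi_le A (b : R) : (forall e s, 0 < e -> packs e cube s -> psum e (lin A) s <= b) ->
  psi A <= b.
Proof.
move=> H; apply: ge_sup; first exact: (psi_has_sup A).1.
by move=> _ [[e s] /= [e0 ps] <-]; exact: H.
Qed.

Lemma psi_ge0 A : 0 <= psi A.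
Proof.
by have := @psum_le_psi A 1 [::] ltr01 (packs_nil _ _); rewrite /psum big_nil mulr0.
Qed.

Lemma psi_growth : exists2 C : R, 0 < C & forall A, psi A <= C * `|A| `^ p.
Proof.
by have [C C0 H] := psi_bound; exists C => // A; apply: psi_le => e s; exact: H.
Qed.

(* Tiling the unit cube by scaled copies of itself transports an almost optimal
   family to every smaller scale. *)
Lemma psi_lower A tau : 0 < tau -> exists2 e0 : R, 0 < e0 & forall e, 0 < e < e0 ->
  exists2 s, packs e cube s & psi A - tau < psum e (lin A) s.
Proof.
move=> t0; have t2 : 0 < tau / 2 by rewrite divr_gt0.
have [_ [[e1 s1] /= [e10 ps1] <-]] := sup_adherent t2 (psi_has_sup A).
rewrite -/(psi A); set P := psum _ _ _ => HP.
have P0 : 0 <= P by apply: (psum_ge0 alpha_core e10 (Lploc_linear A) ps1).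
have nP : 0 < n%:R * P + 1 :> R by rewrite ltr_wpDl// mulr_ge0.
(* The first entry keeps [t = e / e1] below 1; the second limits the loss [n t P] to [tau / 2]. *)
pose c := Num.min 1 (tau / 2 / (n%:R * P + 1)).
have c0 : 0 < c by rewrite lt_min ltr01 divr_gt0.
exists (c * e1); first by rewrite mulr_gt0.
move=> e /andP[e0 ec]; pose t := e / e1.
have tt0 : 0 < t by rewrite divr_gt0.
have tc : t < c by rewrite ltr_pdivrMr.
have t1 : t < 1 by rewrite (lt_le_trans tc)// /c ge_min lexx.
have tP : n%:R * t * P <= tau / 2.
  have : t <= tau / 2 / (n%:R * P + 1) by rewrite ltW// (lt_le_trans tc)// /c ge_min lexx orbT.
  rewrite ler_pdivlMr// => H; apply: le_trans H.
  by rewrite mulrAC mulrDr mulr1 mulrC lerDl ltW.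
have eE : e = t * e1 by rewrite /t divfK// gt_eqF.
(* In each direction [M] intervals of length [t] fit into the unit side and leave less than [t]
   uncovered. *)
pose M := Num.truncn t^-1.
have /andP[M1 M2] : M%:R <= t^-1 < M.+1%:R by apply: truncn_itv; rewrite invr_ge0 ltW.
have Mt1 : M%:R * t <= 1 by rewrite -ler_pdivlMr// mul1r.
have Mt2 : 1 - t <= M%:R * t.
  by move: M2; rewrite -[t^-1]mul1r ltr_pdivrMr// -natr1 mulrDl mul1r => ?; lra.
pose F (k : grid n M) := similarity t 1%:M (gcenter (- 2^-1) t k).
pose s := flatten [seq [seq F k @` D' | D' <- s1] | k <- enum (grid n M)].
have pk k : packs e (gcell (- 2^-1) t k) [seq F k @` D' | D' <- s1].
  by rewrite -gcellE// eE; exact: packs_homothety.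
exists s.
  apply: (@packs_flatten _ _ (fun k => gcell (- 2^-1) t k)) => //.
  - exact: enum_uniq.
  - by move=> i j _ _; exact: gcell_disjoint.
  move=> k _ x xk i; have /andP[x1 x2] := xk i.
  have k0 : 0 <= (k i)%:R * t by rewrite mulr_ge0// ltW.
  have kM : (k i).+1%:R * t <= M%:R * t by rewrite ler_wpM2r ?(ltW tt0)// ler_nat.
  by apply/andP; split; lra.
rewrite /s psum_flatten.
rewrite (eq_bigr (fun=> t ^+ n * P)); last first.
  by move=> k _; rewrite {1}eE (psum_homothety _ _ tt0 e10 ps1).
rewrite big_enum /= sumr_const card_ffun !card_ord -[X in _ < X]mulr_natl.
have -> : (M ^ n)%:R * (t ^+ n * P) = (M%:R * t) ^+ n * P.
  by rewrite natrX mulrA -exprMn.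
(* [(M t)^n >= (1 - t)^n >= 1 - n t], the last by Bernoulli's inequality. *)
have : (1 - n%:R * t) * P <= (M%:R * t) ^+ n * P.
  rewrite ler_wpM2r// (le_trans (bernoulli_le _ _))//; first by rewrite (ltW tt0) ltW.
  have Mt0 : 0 <= M%:R * t by rewrite mulr_ge0// ltW.
  have t10 : 0 <= 1 - t by rewrite subr_ge0 ltW.
  exact: lerXn2r.
by lra.
Qed.

Lemma bmo_linear A : bmo_eps p G D alpha e (lin A) cube @[e --> 0^'+] --> (psi A)%:E.
Proof.
apply: ereal_cvg_right0 => tau t0; have [e0 e00 He] := psi_lower A t0.
exists e0 => // e /[dup]/andP[ep _] /He[s ps sA]; apply/andP; split.
  apply: (le_trans _ (psum_le_bmo_eps alpha_core ep (Lploc_linear A) ps)).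
  by rewrite lee_fin ltW.
apply: (bmo_eps_le alpha_core ep (Lploc_linear A)) => s' ps'.
by rewrite lee_fin (le_trans (psum_le_psi A ep ps'))// lerDl ltW.
Qed.

Lemma core_psiE A : core_psi p G D alpha A = (psi A)%:E.
Proof. by apply/cvg_lim => //; exact: bmo_linear. Qed.

Lemma psi_split A B l : 0 < l < 1 ->
  psi (A + B) <= cvx_weight p (1 - l) * psi A + cvx_weight p l * psi B.
Proof.
move=> /[dup] l01 /andP[l0 l1]; apply: psi_le => e s e0 ps.
have := psum_split e0 (Lploc_linear A) (Lploc_linear B) ps l01.
under [in X in X <= _ -> _]eq_fun do rewrite -mulmxDl.
move=> /le_trans; apply; apply: lerD; apply: ler_wpM2l; rewrite ?psum_le_psi//.
  by rewrite cvx_weight_ge0// subr_ge0 ltW.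
by rewrite cvx_weight_ge0// ltW.
Qed.

Lemma psi_scale A t : t != 0 -> `|t| `^ p * psi A <= psi (t *: A).
Proof.
rewrite -normr_gt0 => t0; rewrite mulrC -ler_pdivlMr ?powR_gt0//; apply: psi_le => e s e0 ps.
rewrite ler_pdivlMr ?powR_gt0//; apply: le_trans (psum_le_psi _ e0 ps).
rewrite /psum -mulrA ler_wpM2l ?powR_ge0// mulr_suml big_seq [leRHS]big_seq.
apply: ler_sum => D' /(ps.1)[cD' _].
under [in leRHS]eq_fun do rewrite -scalemxAl.
have := core_homogeneous alpha_core t (Lploc_linear A) (copies_all e0 cD').
by move=> ->; rewrite mulrC.
Qed.

(** The perturbation estimate is applied from [A] to [B] and back. The first application bounds
    [psi B] by [psi A + tau], so a single [S], and hence a single radius, serves both. *)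
Lemma psi_continuous : continuous psi.
Proof.
have [C C0 HC] := psi_growth.
move=> A; apply: near_dist_continuous => tau t0.
have S0 : 0 <= psi A + tau by rewrite addr_ge0 ?psi_ge0// ltW.
have [l [d [l01 d0 H]]] := cvx_perturbation p1 (ltW C0) S0 t0.
have step X Y : psi X <= psi A + tau -> `|Y - X| <= d -> psi Y <= psi X + tau.
  move=> XA YX; apply: (H _ _ `|Y - X|); rewrite ?psi_ge0 ?normr_ge0//.
  have -> : Y = X + (Y - X) by rewrite addrC subrK.
  apply: (le_trans (psi_split _ _ l01)).
  rewrite addrAC subrr add0r lerD2l ler_wpM2l ?HC// cvx_weight_ge0//.
  by case/andP: l01 => /ltW.
apply/nbhs_normP; exists d => //= B /ltW AB.
have h1 : psi B <= psi A + tau by apply: step; rewrite ?lerDl ?(ltW t0)// distrC.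
have h2 : psi A <= psi B + tau by apply: step.
by rewrite ler_norml; apply/andP; split; lra.
Qed.

End psi.

(** * The limit for maps of class C^1 *)

Section disjoint_sum.
Context d (T : measurableType d) (R : realType) (mu : measure T R).
Context (I : eqType) (E : I -> set T).

Definition seq_union (r : seq I) : set T := [set x | exists2 i, i \in r & E i x].

Lemma seq_union_cons i r : seq_union (i :: r) = E i `|` seq_union r.
Proof.
apply/seteqP; split => [x [j]|x [Eix|[j jr Ejx]]].
- by rewrite inE => /predU1P[->|jr] Ejx; [left|right; exists j].
- by exists i; rewrite ?mem_head.
- by exists j => //; rewrite inE jr orbT.
Qed.

Lemma measurable_seq_union r : (forall i, measurable (E i)) -> measurable (seq_union r).
Proof.
move=> mE; elim: r => [|i r IH]; last by rewrite seq_union_cons; exact: measurableU.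
by rewrite (_ : seq_union _ = set0)//; apply/seteqP; split => // x [].
Qed.

(** The remainder is kept because grid cells fill [V] only in part; with [f = 1] the same identity
    measures it. *)
Lemma sum_Rintegral_disjoint r (V : set T) (f : T -> R) : uniq r ->
  (forall i, measurable (E i)) -> measurable V ->
  (forall i j, i \in r -> j \in r -> i != j -> E i `&` E j = set0) ->
  (forall i, i \in r -> E i `<=` V) -> mu.-integrable V (EFin \o f) ->
  \sum_(i <- r) \int[mu]_(x in E i) f x + \int[mu]_(x in V `\` seq_union r) f x =
  \int[mu]_(x in V) f x.
Proof.
move=> + mE; elim: r V => [|i r IH] V ur mV dis EV If.
  rewrite big_nil add0r (_ : seq_union _ = set0) ?setD0//.
  by apply/seteqP; split => // x [].
move: ur => /= /andP[ir ur].
have EiV : E i `<=` V by apply: EV; rewrite mem_head.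
have VE : V = E i `|` (V `\` E i) by rewrite setDUK.
rewrite big_cons -addrA seq_union_cons -setDDl IH//.
- rewrite [in RHS]VE Rintegral_setU//.
  + exact: measurableD.
  + by rewrite -VE.
  + by rewrite disj_set2E setDIK.
- exact: measurableD.
- by move=> j k jr kr; apply: dis; rewrite inE ?jr ?kr orbT.
- move=> j jr x Ejx; split; first by apply: EV Ejx; rewrite inE jr orbT.
  move=> Eix; have ij : i != j by apply: contraNneq ir => ->.
  have : (E i `&` E j) x by [].
  by rewrite dis ?mem_head// inE jr orbT.
- by apply: integrableS If => //; exact: measurableD.
Qed.

End disjoint_sum.

(** * Open, half-open and shrunken cells of a grid *)

Section cells.
Context {R : realType} (n : nat).

(** The flags choose open or closed ends, so that all three kinds of cells are measured at once. *)
Lemma leb_box (l h : 'I_n -> R) (t : R) (b0 b1 : bool) : 0 < t ->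
  (forall i, h i - l i = t) ->
  leb n [set x | forall i, x i 0 \in Interval (BSide b0 (l i)) (BSide b1 (h i))] = (t ^+ n)%:E
  /\ measurable [set x : 'cV[R]_n | forall i, x i 0 \in Interval (BSide b0 (l i)) (BSide b1 (h i))].
Proof.
move=> t0 ht; pose S i := [set` Interval (BSide b0 (l i)) (BSide b1 (h i))].
split.
  apply: (@leb_cube _ _ S); [exact: ltW|by move=> i; exact: measurable_itv|].
  move=> i; rewrite lebesgue_measure_itv /= lte_fin ifT ?ht//.
    by rewrite -EFinD ht.
  by rewrite -subr_gt0 ht.
apply: (@measurable_forall_fin _ 'cV[R]_n) => i.
have := measurable_entry i 0 measurableT (measurable_itv (Interval (BSide b0 (l i)) (BSide b1 (h i)))).
by move=> /(_ 0%N); rewrite setTI.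
Qed.

Lemma gcell_measure (a t : R) M (k : grid n M) : 0 < t ->
  leb n (gcell a t k) = (t ^+ n)%:E /\ measurable (gcell a t k).
Proof.
move=> t0; have := @leb_box (fun i => a + (k i)%:R * t) (fun i => a + (k i).+1%:R * t) t false true t0.
rewrite (_ : [set x | _] = gcell a t k); last first.
  by apply/seteqP; split => x xk i; have := xk i; rewrite in_itv.
by apply=> i; rewrite -[(k i).+1%:R]natr1; ring.
Qed.

(** Half-open cells cover the box without remainder, while packings live in the open cells, of equal
    measure. *)
Definition hcell (a t : R) M (k : grid n M) : set 'cV[R]_n :=
  [set x | forall i, x i 0 \in `[a + (k i)%:R * t, a + (k i).+1%:R * t[].

Lemma hcell_measure (a t : R) M (k : grid n M) : 0 < t ->
  leb n (hcell a t k) = (t ^+ n)%:E /\ measurable (hcell a t k).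
Proof.
move=> t0; apply: (@leb_box (fun i => a + (k i)%:R * t) (fun i => a + (k i).+1%:R * t) t true true t0).
by move=> i; rewrite -[(k i).+1%:R]natr1; ring.
Qed.

Lemma hcell_disjoint a t M (k k' : grid n M) : 0 < t -> k != k' ->
  hcell a t k `&` hcell a t k' = set0.
Proof.
move=> t0 kk'; apply/seteqP; split => // x [xk xk'].
suff E : k = k' by rewrite E eqxx in kk'.
have H (u v : grid n M) i : hcell a t u x -> hcell a t v x -> (u i <= v i)%N.
  move=> /(_ i); rewrite in_itv /= => /andP[x1 _] /(_ i).
  rewrite in_itv /= => /andP[_ x2].
  have : (u i)%:R * t < (v i).+1%:R * t by lra.
  by rewrite ltr_pM2r// ltr_nat ltnS.
by apply/ffunP => i; apply/val_inj/eqP; rewrite eqn_leq !H.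
Qed.

(** A set of diameter less than [h] that meets the shrunken cell lies inside the open cell; this
    detects the copies contained in no cell. *)
Definition scell (a t h : R) M (k : grid n M) : set 'cV[R]_n :=
  [set x | forall i, x i 0 \in `[a + (k i)%:R * t + h, a + (k i).+1%:R * t - h]].

Lemma scell_measure (a t h : R) M (k : grid n M) : 0 < t - 2 * h ->
  leb n (scell a t h k) = ((t - 2 * h) ^+ n)%:E /\ measurable (scell a t h k).
Proof.
move=> t0; apply: (@leb_box (fun i => a + (k i)%:R * t + h) (fun i => a + (k i).+1%:R * t - h) _ true false t0).
by move=> i; rewrite -[(k i).+1%:R]natr1; ring.
Qed.

Lemma scell_gcell (a t h : R) M (k : grid n M) : 0 < h ->
  scell a t h k `<=` gcell a t k.
Proof.
by move=> h0 x xk i; have := xk i; rewrite in_itv /= => /andP[? ?]; apply/andP; split; lra.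
Qed.

Lemma scell_near (a t h : R) M (k : grid n M) x y : 0 < h ->
  scell a t h k x -> `|x - y| < h -> gcell a t k y.
Proof.
move=> h0 xk xy i; have := xk i; rewrite in_itv /= => /andP[? ?].
have := le_lt_trans (ler_mx_norm_entry (x - y) i 0) xy.
by rewrite !mxE ltr_norml => /andP[? ?]; apply/andP; split; lra.
Qed.

Lemma gcenter_gcell (a t : R) M (k : grid n M) : 0 < t ->
  gcell a t k (gcenter a t k).
Proof.
move=> t0 i; rewrite mxE -[(k i).+1%:R]natr1.
by apply/andP; split; lra.
Qed.

Lemma gcell_diam (a t : R) M (k : grid n M) x y : 0 < t ->
  gcell a t k x -> gcell a t k y -> `|x - y| < t.
Proof.
move=> t0 xk yk; apply: mx_norm_lt => // i j; rewrite ord1 !mxE ltr_norml.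
have /andP[? ?] := xk i; have := yk i; rewrite -[(k i).+1%:R]natr1 => /andP[? ?].
have := xk i; rewrite -[(k i).+1%:R]natr1 => /andP[? ?].
by apply/andP; split; lra.
Qed.

Lemma hcell_cover (L t : R) M (x : 'cV[R]_n) : 0 < t -> M%:R * t = 2 * L ->
  (forall i, - L <= x i 0 < L) -> exists k : (grid n M), hcell (- L) t k x.
Proof.
move=> t0 Mt xL.
have xi0 i : 0 <= (x i 0 + L) / t.
  by have /andP[? ?] := xL i; rewrite divr_ge0 ?(ltW t0)//; lra.
have kM i : (Num.truncn ((x i 0 + L) / t)%R < M)%N.
  have /andP[H _] := truncn_itv (xi0 i); rewrite -(ltr_nat R) (le_lt_trans H)//.
  by rewrite ltr_pdivrMr// Mt; have /andP[? ?] := xL i; lra.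
exists [ffun i => Ordinal (kM i)] => i; rewrite ffunE /= in_itv /=.
have /andP[] := truncn_itv (xi0 i); rewrite ler_pdivlMr// ltr_pdivrMr// => ? ?.
by apply/andP; split; lra.
Qed.

Definition cells_in (L t : R) M (V : set 'cV[R]_n) : seq (grid n M) :=
  [seq k <- enum (grid n M) | `[< gcell (- L) t k `<=` V >]].

Lemma cells_inP L t M V k : k \in @cells_in L t M V -> gcell (- L) t k `<=` V.
Proof. by rewrite mem_filter => /andP[/asboolP]. Qed.

Lemma cells_in_uniq L t M V : uniq (@cells_in L t M V).
Proof. by rewrite filter_uniq// enum_uniq. Qed.

Lemma gcell_closure (L t : R) M (k : grid n M) x y : 0 < t ->
  hcell (- L) t k x -> gcell (- L) t k y -> `|x - y| <= t.
Proof.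
move=> t0 xk yk; apply: mx_norm_le => [|i j]; first exact: ltW.
rewrite ord1 !mxE ler_norml.
have := xk i; have := yk i; rewrite in_itv /= -[(k i).+1%:R]natr1 => /andP[? ?] /andP[? ?].
by apply/andP; split; lra.
Qed.

(** The points whose [1/(j+1)]-ball stays in [V] increase to [V], so for some [j] they fill it up to
    [eta]. Once [t < 1/(j+1)], the open cell belonging to the half-open cell of such a point is
    contained in [V]. *)
Lemma cells_exhaust (L r : R) (V : set 'cV[R]_n) eta : open V -> 0 < r -> r < L ->
  V `<=` cball r -> 0 < eta ->
  exists N0, forall M, (N0 < M)%N -> forall t, M%:R * t = 2 * L ->
    fine (leb n V) - eta <= (size (@cells_in L t M V))%:R * t ^+ n.
Proof.
move=> oV r0 rL Vr eta0.
have L0 : 0 < L by lra.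
have mV := open_measurable_mx oV.
have Vfin : (leb n V < +oo)%E.
  by apply: (le_lt_trans _ (leb_cball_lty n r)); apply: le_measure => //; rewrite inE//; exact: measurable_cball.
pose F j : set 'cV[R]_n := [set x | forall y, `|x - y| < j.+1%:R^-1 -> V y].
have FV j : F j `<=` V.
  by move=> x; apply; rewrite subrr normr0 invr_gt0.
have mF j : measurable (F j).
  apply: closed_measurable_mx.
  rewrite (_ : F j = ~` \bigcup_(y in ~` V) ball y j.+1%:R^-1).
    by apply: open_closedC; apply: bigcup_open => y _; exact: ball_open.
  apply/seteqP; split => [x Fx [y nVy]|x nx y xy].
    by rewrite -ball_normE /= distrC => /Fx.
  apply: contrapT => nVy; apply: nx; exists y => //.
  by rewrite -ball_normE /= distrC.
have UF : \bigcup_j F j = V.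
  apply/seteqP; split => [x [j _]|x Vx]; first exact: FV.
  have /nbhs_normP[d /= d0 dV] : nbhs x V by exact: open_nbhs_nbhs.
  have [j _ jd] := near_infty_natSinv_lt (PosNum d0).
  exists j => // y xy; apply: dV; rewrite /= (lt_le_trans xy)// ltW//.
  exact: jd (leqnn _).
have cF : (leb n \o F) x @[x --> \oo] --> leb n V.
  rewrite -UF; apply: nondecreasing_cvg_mu => //; first by rewrite UF.
  move=> i j ij; apply/subsetPset => x Fx y xy; apply: Fx.
  by rewrite (lt_le_trans xy)// lef_pV2 ?posrE// ler_nat.
have [j Fj] : exists j, fine (leb n V) - eta < fine (leb n (F j)).
  have /fine_cvgP[_] : (leb n \o F) x @[x --> \oo] --> (fine (leb n V))%:E.
    by rewrite fineK// ge0_fin_numE.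
  move=> /cvgrPdist_lt/(_ _ eta0)[j _ /(_ j (leqnn _)) /=].
  by rewrite ltr_norml => /andP[_ H]; exists j; lra.
have L2 : 0 <= 2 * L * j.+1%:R by rewrite !mulr_ge0// ltW.
(* [M > 2 L (j + 1)] amounts to [t < 1/(j+1)]. *)
exists (Num.truncn (2 * L * j.+1%:R)) => M NM t Mt.
have M0 : 0 < M%:R :> R by rewrite ltr0n (leq_ltn_trans _ NM).
have t0 : 0 < t by rewrite -(pmulr_rgt0 _ M0) Mt mulr_gt0.
have tj : t < j.+1%:R^-1.
  rewrite -(ltr_pM2l M0) Mt ltr_pdivlMr//.
  have /andP[_ H] := truncn_itv L2; rewrite (lt_le_trans H)// ler_nat.
  exact: NM.
set K := cells_in L t M V.
have sub : F j `<=` seq_union (fun k => hcell (- L) t k) K.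
  move=> x Fx; have xL i : - L <= x i 0 < L.
    have := le_trans (ler_mx_norm_entry x i 0) (Vr _ (FV _ _ Fx)).
    by rewrite ler_norml => /andP[? ?]; apply/andP; split; lra.
  have [k xk] := hcell_cover t0 Mt xL; exists k => //.
  rewrite mem_filter mem_enum andbT; apply/asboolP => y yk.
  by apply: Fx; rewrite (le_lt_trans (gcell_closure t0 xk yk)).
have mU : measurable (seq_union (fun k => hcell (- L) t k) K).
  by apply: measurable_seq_union => k; have [] := hcell_measure (- L) k t0.
have Ufin : (leb n (seq_union (fun k => hcell (- L) t k) K) < +oo)%E.
  apply: (le_lt_trans _ (leb_cball_lty n L)); apply: le_measure; rewrite ?inE//.
    exact: measurable_cball.
  move=> x [k _ xk]; apply/cballP; first exact: ltW.
  move=> i; have := xk i; rewrite !in_itv /= => /andP[x1 x2].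
  have k0 : 0 <= (k i)%:R * t by rewrite mulr_ge0// ltW.
  have : (k i).+1%:R * t <= M%:R * t by rewrite ler_wpM2r ?(ltW t0)// ler_nat.
  by rewrite Mt => ?; apply/andP; split; lra.
have I1 : (leb n).-integrable (seq_union (fun k => hcell (- L) t k) K) (EFin \o cst 1).
  apply: measurable_bounded_integrable => //.
  exists 1; split; first exact: num_real.
  by move=> M' M'1 x _ /=; rewrite normr1 ltW.
have := @sum_Rintegral_disjoint _ _ _ (leb n) _ (fun k => hcell (- L) t k) K _ (cst 1)
   (cells_in_uniq _ _ _ _) (fun k => (hcell_measure (- L) k t0).2) mU.
move=> /(_ _ _ I1); rewrite setDv Rintegral_set0 addr0 Rintegral_cst// mul1r.
rewrite (eq_bigr (fun=> t ^+ n)); last first.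
  by move=> k _; have [lk mk] := hcell_measure (- L) k t0; rewrite Rintegral_cst// mul1r /= lk.
rewrite big_const_seq count_predT iter_addr_0 => H; rewrite mulr_natl H.
- rewrite (le_trans (ltW Fj))// fine_le ?ge0_fin_numE//.
    by rewrite (le_lt_trans _ Vfin)// le_measure ?inE.
  by rewrite le_measure ?inE.
- by move=> k k' _ _; exact: hcell_disjoint.
- by move=> k kK x xk; exists k.
Qed.

End cells.

Section C1_limit.
Context {R : realType} (m n : nat) (n_gt0 : (0 < n)%N) (p : R) (p1 : 1 <= p).
Context (G : set 'M[R]_n) (subG : SO_subgroup G).
Context (D : set 'cV[R]_n) (openD : open D) (bndD : bounded_set D).
Context (alpha : ('cV[R]_n -> 'cV[R]_m) -> set 'cV[R]_n -> R).
Context (alpha_core : p_core_functional p G D alpha).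
Implicit Types (u v w : 'cV[R]_n -> 'cV[R]_m) (U V : set 'cV[R]_n).
Implicit Types (s : seq (set 'cV[R]_n)) (e t : R) (A B : 'M[R]_(m, n)).

Local Notation packs := (packs G D).
Local Notation psum := (psum p alpha).
Local Notation cube := (@open_cube R n).
Local Notation psi := (psi p G D alpha).
Local Notation lin A := (fun x : 'cV[R]_n => A *m x).

Lemma psum_lin_cell A t c e s : 0 < t -> 0 < e ->
  packs e (similarity t 1%:M c @` cube) s -> psum e (lin A) s <= t ^+ n * psi A.
Proof.
move=> t0 e0 ps; have tV : 0 < t^-1 by rewrite invr_gt0.
have := packs_homothety (- (t^-1 *: c)) tV ps.
have -> : similarity t^-1 1%:M (- (t^-1 *: c)) @` (similarity t 1%:M c @` cube) = cube.
  rewrite image_comp [X in X @` _](_ : _ = id) ?image_id//.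
  apply/funext => x /=; rewrite !similarity1E scalerDr scalerA mulVf ?gt_eqF//.
  by rewrite scale1r addrK.
have te0 : 0 < t^-1 * e by rewrite mulr_gt0.
move=> /(psum_le_psi n_gt0 p1 subG openD bndD alpha_core A te0).
rewrite (psum_homothety p1 subG alpha_core A _ tV e0 ps) exprVn.
by rewrite mulrC ler_pdivrMr ?exprn_gt0// mulrC.
Qed.

Lemma lin_cell_lower A tau : 0 < tau -> exists2 e0 : R, 0 < e0 & forall t c e,
  0 < t -> 0 < e < t * e0 -> exists2 s, packs e (similarity t 1%:M c @` cube) s &
    t ^+ n * (psi A - tau) <= psum e (lin A) s.
Proof.
move=> /(psi_lower n_gt0 p1 subG openD bndD alpha_core A)[e0 e00 H].
exists e0 => // t c e t0 /andP[ep ete].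
have [|s ps sA] := H (t^-1 * e).
  by rewrite mulr_gt0 ?invr_gt0//= mulrC ltr_pdivrMr// mulrC.
have te0 : 0 < t^-1 * e by rewrite mulr_gt0 ?invr_gt0.
have eE : e = t * (t^-1 * e) by rewrite mulrA mulfV ?gt_eqF// mul1r.
exists [seq similarity t 1%:M c @` D' | D' <- s].
  by rewrite eE; exact: packs_homothety.
rewrite {1}eE (psum_homothety p1 subG alpha_core A c t0 te0 ps).
by rewrite ler_wpM2l ?exprn_ge0 ?(ltW t0)// ltW.
Qed.

(** Each copy is sorted into the cells containing it. Terms are nonnegative, so counting one in
    several cells only enlarges the right side. *)
Lemma psum_cover (I : eqType) (K : seq I) (E : I -> set 'cV[R]_n) e u U s :
  0 < e -> Lploc p u -> packs e U s ->
  psum e u s <= \sum_(k <- K) psum e u [seq D' <- s | `[< D' `<=` E k >]] +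
    psum e u [seq D' <- s | ~~ has (fun k => `[< D' `<=` E k >]) K].
Proof.
move=> e0 Lu [cs _]; rewrite /psum -mulr_sumr -mulrDr ler_wpM2l ?powR_ge0//.
have a0 D' : D' \in s -> 0 <= alpha u D'.
  by move=> /cs[c _]; apply: (core_ge0 alpha_core) => //; exact: copies_all c.
rewrite big_filter (bigID (fun D' => has (fun k => `[< D' `<=` E k >]) K))/= lerD2r.
rewrite [leRHS](eq_bigr (fun k => \sum_(D' <- s) if `[< D' `<=` E k >] then alpha u D' else 0)); last first.
  by move=> k _; rewrite big_filter big_mkcond.
rewrite exchange_big /= big_mkcond /= big_seq [leRHS]big_seq; apply: ler_sum => D' D's.
case: ifPn => [/hasP[k kK kD]|_]; last first.
  by apply: sumr_ge0 => k _; case: ifP => // _; exact: a0.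
rewrite (perm_big _ (perm_to_rem kK)) big_cons kD lerDl.
by apply: sumr_ge0 => j _; case: ifP => // _; exact: a0.
Qed.

Lemma copies_small : exists2 c : R, 0 < c & forall e U D' x y, 0 < e -> copies G D e U D' ->
  D' x -> D' y -> `|x - y| <= c * e.
Proof.
have [r r0 Dr] := bounded_cball bndD.
have nR : 0 < n%:R :> R by rewrite ltr0n.
exists (n%:R * (2 * r)); first by rewrite !mulr_gt0.
move=> e U D' x y e0 [A [h [GA -> _]]] [x' Dx' <-] [y' Dy' <-].
rewrite /similarity opprD addrACA subrr addr0 -scalerBr -mulmxBr normrZ gtr0_norm//.
rewrite mulrC ler_wpM2r ?(ltW e0)// (le_trans (mulmx_norm_le _ _))//.
rewrite -mulrA ler_wpM2l//.
have A1 : `|A| <= 1 by apply: SO_norm_le1; case: subG => GS _ _ _; exact: GS.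
apply: (le_trans (ler_pM _ _ A1 (ler_normB _ _))) => //.
have := Dr _ Dx'; have := Dr _ Dy'; rewrite /cball /=; lra.
Qed.

(** Used to find one scale below which almost optimal packings exist in all of the finitely many
    cells of a grid. *)
Lemma seq_lower_bound (I : eqType) (K : seq I) (P : I -> R -> Prop) :
  (forall k, exists2 e : R, 0 < e & P k e) -> exists2 f : I -> R,
  (forall k, P k (f k)) & exists2 e0 : R, 0 < e0 & forall k, k \in K -> e0 <= f k.
Proof.
move=> H; pose f k := s2val (cid2 (H k)).
have f0 k : 0 < f k by rewrite /f; case: cid2.
exists f; first by move=> k; rewrite /f; case: cid2.
elim: K => [|k K [e e0 IH]]; first by exists 1.
exists (Num.min (f k) e); first by rewrite lt_min f0.
move=> j; rewrite inE => /predU1P[->|/IH jK]; first by rewrite ge_min lexx.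
by rewrite ge_min jK orbT.
Qed.

Lemma dist_bounds (a b c : R) : `|a - b| < c -> b - c <= a /\ a <= b + c.
Proof. by rewrite ltr_norml => /andP[? ?]; split; lra. Qed.

(* On a cell where the gradient of v oscillates little, v may be replaced by a
   linear map, at a cost controlled by the size of the cell. *)
Lemma cell_compare S tau : 0 <= S -> 0 < tau -> exists2 b : R, 0 < b &
  forall v A t c e s, C1v v -> 0 < t -> 0 < e ->
  packs e (similarity t 1%:M c @` cube) s ->
  leb n (similarity t 1%:M c @` cube) = (t ^+ n)%:E ->
  measurable (similarity t 1%:M c @` cube) ->
  (forall x, (similarity t 1%:M c @` cube) x -> `|grad v x - A| <= b) ->
  (psi A <= S -> psum e v s <= t ^+ n * (psi A + tau)) /\
  (psum e v s <= t ^+ n * S -> psum e (lin A) s <= psum e v s + t ^+ n * tau).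
Proof.
move=> S0 t0; have [C C0 HC] := psum_energy n_gt0 p1 subG openD bndD alpha_core.
(* This is applied to sums divided by [t^n], so [b] depends neither on the cell nor on the scale. *)
have [l [b [l01 b0 H]]] := cvx_perturbation p1 (ltW C0) S0 t0.
exists b => // v A t c e s Cv tt0 e0 ps lU mU vA.
have tn : 0 < t ^+ n by rewrite exprn_gt0.
have [CA gA] := C1v_linear A.
have LA := C1v_Lploc p1 CA; have Lv := C1v_Lploc p1 Cv.
have [Cw gw] := C1v_lincomb 1 (- 1) Cv CA.
have [Cw' gw'] := C1v_lincomb 1 (- 1) CA Cv.
have W (w : 'cV[R]_n -> 'cV[R]_m) : C1v w ->
    (forall x, (similarity t 1%:M c @` cube) x -> `|grad w x| <= b) ->
    psum e w s / t ^+ n <= C * b `^ p.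
  move=> C1 wb; rewrite ler_pdivrMr//.
  have := HC _ _ _ _ b C1 e0 mU _ ps (ltW b0) wb.
  by rewrite lU ltry; apply.
have key u w : Lploc p u -> Lploc p w -> psum e w s / t ^+ n <= C * b `^ p ->
    psum e (fun x => u x + w x) s / t ^+ n <=
    cvx_weight p (1 - l) * (psum e u s / t ^+ n) + cvx_weight p l * (C * b `^ p).
  move=> Lu Lw wb.
  apply: (@le_trans _ _ (cvx_weight p (1 - l) * (psum e u s / t ^+ n) + cvx_weight p l * (psum e w s / t ^+ n))).
    rewrite ler_pdivrMr// mulrDl -[X in _ <= X + _]mulrA -[X in _ <= _ + X]mulrA !divfK ?gt_eqF//.
    exact: (psum_split p1 alpha_core e0 Lu Lw ps l01).
  by rewrite lerD2l ler_wpM2l// cvx_weight_ge0//; case/andP: l01 => /ltW.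
have bb : 0 <= b <= b by rewrite lexx ltW.
split=> [AS|vS].
  rewrite -ler_pdivrMl// mulrC; apply: (H _ _ b) bb _; first by rewrite AS andbT; exact: psi_ge0.
  have := key _ _ LA (C1v_Lploc p1 Cw) (W _ Cw _).
  rewrite [X in psum e X s / _](_ : _ = v); last first.
    by apply/funext => x; rewrite scale1r scaleN1r addrC subrK.
  move=> K; apply: (le_trans (K _)).
    by move=> x xU; rewrite gw gA scale1r scaleN1r vA.
  rewrite lerD2r ler_wpM2l ?cvx_weight_ge0//; first by case/andP: l01 => _ /ltW; rewrite subr_ge0.
  rewrite ler_pdivrMr// mulrC.
  exact: (psum_lin_cell A tt0 e0 ps).
suff : psum e (lin A) s / t ^+ n <= psum e v s / t ^+ n + tau.
  by rewrite ler_pdivrMr// mulrDl divfK ?gt_eqF// [tau * _]mulrC.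
apply: (H _ _ b) bb _.
  rewrite ler_pdivrMr// [S * _]mulrC vS andbT divr_ge0 ?(ltW tn)//.
  exact: (psum_ge0 alpha_core e0 Lv ps).
have := key _ _ Lv (C1v_Lploc p1 Cw') (W _ Cw' _).
rewrite [X in psum e X s / _](_ : _ = lin A); last first.
  by apply/funext => x; rewrite scale1r scaleN1r addrC subrK.
apply => x xU; by rewrite gw' gA scale1r scaleN1r distrC vA.
Qed.

(** The grid is fixed first, according to [tau]; only then does [e] become small. Packings chosen
    cell by cell give the lower bound. For the upper bound a packing of [V] is divided into the
    copies inside cells and the rest. Each error is a few eighths of [tau]. *)
Lemma C1_bmo_limit v V : C1v v -> open V -> bounded_set V ->
  bmo_eps p G D alpha e v V @[e --> 0^'+] -->
    (\int[leb n]_(x in V) psi (grad v x))%:E.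
Proof.
move=> Cv oV bV; have Lv := C1v_Lploc p1 Cv.
have mV := open_measurable_mx oV; have Vfin := bounded_leb_lty mV bV.
have [r r0 Vr] := bounded_cball bV.
(* [L > r] places [V] in the half-open box that the grid fills. *)
pose L := r + 1; have rL : r < L by rewrite ltrDl.
have L0 : 0 < L by lra.
have [C C0 HC] := psum_energy n_gt0 p1 subG openD bndD alpha_core.
have [C' C'0 HC'] := psi_growth n_gt0 p1 subG openD bndD alpha_core.
have cg := C1v_grad_continuous Cv.
have cPsi : continuous (fun x => psi (grad v x)).
  move=> x; apply: (@continuous_comp _ _ _ (grad v) psi); first exact: cg.
  exact: (psi_continuous n_gt0 p1 subG openD bndD alpha_core).
have cn : continuous (fun x => `|grad v x|).
  by move=> x; apply: continuous_comp; [exact: cg|exact: norm_continuous].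
have [M0 M00 gM] := continuous_bounded_cball L cn.
have {}gM x : `|x| <= L -> `|grad v x| <= M0 by move=> /gM; rewrite normr_id.
have p_ge0 : 0 <= p by rewrite (le_trans _ p1).
(* A common bound for [psi (grad v x)] and, per unit volume, for the packing sums of [v]. *)
pose S := C' * M0 `^ p + C * M0 `^ p.
have S1 : 0 <= C' * M0 `^ p by rewrite mulr_ge0 ?powR_ge0// ltW.
have S2 : 0 <= C * M0 `^ p by rewrite mulr_ge0 ?powR_ge0// ltW.
have S0 : 0 <= S by rewrite addr_ge0.
have psiS x : `|x| <= L -> psi (grad v x) <= S.
  move=> /gM xM; rewrite (le_trans (HC' _))// (le_trans _ (_ : C' * M0 `^ p <= S))//.
    by rewrite ler_wpM2l ?(ltW C'0)// (ler_powR_nneg p1).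
  by rewrite lerDl.
have VL x : V x -> `|x| <= L by move=> /Vr xr; rewrite (le_trans xr)// ltW.
have Psi0 x : 0 <= psi (grad v x) by apply: (psi_ge0 n_gt0 p1 subG openD bndD alpha_core).
have intPsi (E : set 'cV[R]_n) : measurable E -> E `<=` cball L ->
    (leb n).-integrable E (EFin \o (fun x => psi (grad v x))).
  move=> mE EL; have I := @integrable_cball _ _ (fun x => psi (grad v x)) L S (continuous_measurable_mx cPsi) _.
  apply: (integrableS (measurable_cball L) mE EL); apply: I => x /psiS.
  by rewrite ger0_norm.
apply: ereal_cvg_right0 => tau t0.
set I := \int[leb n]_(x in V) psi (grad v x).
set Lam := fine (leb n V).
have Lam0 : 0 <= Lam by rewrite fine_ge0.
have LamE : leb n V = Lam%:E by rewrite /Lam fineK// ge0_fin_numE.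
(* [tau1] is an error per unit volume, [eta] a measure that may be neglected; the added 1 covers the
   cases where [Lam] or [S] is zero. *)
pose tau1 := tau / (8 * (Lam + 1)); pose eta := tau / (8 * (S + 1)).
have Lam1 : 0 < Lam + 1 by rewrite ltr_wpDl.
have Sp1 : 0 < S + 1 by rewrite ltr_wpDl.
have tau10 : 0 < tau1 by rewrite divr_gt0// mulr_gt0.
have eta0 : 0 < eta by rewrite divr_gt0// mulr_gt0.
have tL : tau1 * Lam <= tau / 8.
  rewrite /tau1 invfM mulrA mulrAC -[leRHS]mulr1 -mulrA ler_wpM2l ?divr_ge0 ?(ltW t0)//.
  by rewrite ler_pdivrMr// mul1r lerDl.
have eS : eta * S <= tau / 8.
  rewrite /eta invfM mulrA mulrAC -[leRHS]mulr1 -mulrA ler_wpM2l ?divr_ge0 ?(ltW t0)//.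
  by rewrite ler_pdivrMr// mul1r lerDl.
have [b b0 Hb] := cell_compare S0 tau10.
have [d1 d10 ud1] := unif_continuous_cball (ltW L0) cg b0.
have [d2 d20 ud2] := unif_continuous_cball (ltW L0) cPsi tau10.
have [N0 HN] := cells_exhaust oV r0 rL Vr eta0.
pose d := Num.min d1 d2; have d0 : 0 < d by rewrite lt_min d10.
(* Large enough to exhaust [V] and to make the mesh smaller than [d], which limits the oscillation
   of [grad v] and of [psi (grad v x)] on a cell. *)
pose M := (N0 + Num.truncn (2 * L / d)).+1.
have N0M : (N0 < M)%N by rewrite ltnS leq_addr.
have M00' : 0 < M%:R :> R by rewrite ltr0n.
pose t := 2 * L / M%:R.
have Mt : M%:R * t = 2 * L by rewrite /t mulrCA mulfV ?gt_eqF// mulr1.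
have tt0 : 0 < t by rewrite divr_gt0// mulr_gt0.
have td : t < d.
  rewrite ltr_pdivrMr// [d * _]mulrC -ltr_pdivrMr//.
  have L2d : 0 <= 2 * L / d by rewrite divr_ge0 ?mulr_ge0 ?(ltW d0)// ltW.
  have /andP[_ H] := truncn_itv L2d; rewrite (lt_le_trans H)// ler_nat ltnS.
  exact: leq_addl.
have tn : 0 < t ^+ n by rewrite exprn_gt0.
set K := cells_in L t M V.
have KV k : k \in K -> gcell (- L) t k `<=` V by exact: cells_inP.
have Kexh : Lam - eta <= (size K)%:R * t ^+ n by exact: HN.
pose c k := gcenter (- L) t (k : grid n M).
have cE k : similarity t 1%:M (c k) @` cube = gcell (- L) t k by exact: gcellE.
have lc k := (gcell_measure (- L) (k : grid n M) tt0).1.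
have mc k := (gcell_measure (- L) (k : grid n M) tt0).2.
have ck k : k \in K -> V (c k) by move=> /KV; apply; exact: gcenter_gcell.
have near_g k x : k \in K -> gcell (- L) t k x -> `|grad v x - grad v (c k)| <= b.
  move=> kK xk; rewrite ltW//; apply: ud1; first exact: VL (KV _ kK _ xk).
  have dd1 : d <= d1 by rewrite ge_min lexx.
  by rewrite (lt_trans (gcell_diam tt0 xk (gcenter_gcell _ _ tt0)))// (lt_le_trans td).
have near_P k x : k \in K -> gcell (- L) t k x ->
    `|psi (grad v x) - psi (grad v (c k))| < tau1.
  move=> kK xk; apply: ud2; first exact: VL (KV _ kK _ xk).
  have dd2 : d <= d2 by rewrite ge_min lexx orbT.
  by rewrite (lt_trans (gcell_diam tt0 xk (gcenter_gcell _ _ tt0)))// (lt_le_trans td).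
have cellL k : k \in K -> gcell (- L) t k `<=` cball L by move=> kK x /(KV _ kK)/VL.
have intcst (E : set 'cV[R]_n) z : measurable E -> E `<=` cball L ->
    (leb n).-integrable E (EFin \o (fun=> z)).
  move=> mE EL; apply: (integrableS (measurable_cball L) mE EL).
  by apply: (integrable_cball (M := `|z|)).
have int_cst k z : \int[leb n]_(x in gcell (- L) t (k : grid n M)) z = t ^+ n * z.
  by rewrite Rintegral_cst// mulrC; have /= -> := lc k.
have int_up k : k \in K -> t ^+ n * psi (grad v (c k)) <=
    \int[leb n]_(x in gcell (- L) t k) psi (grad v x) + t ^+ n * tau1.
  move=> kK; rewrite -lerBlDr -mulrBr -(int_cst k); apply: le_Rintegral => //.
  - exact: intcst (cellL _ kK).
  - exact: intPsi (cellL _ kK).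
  by move=> x /(near_P _ _ kK)/dist_bounds[].
have int_lo k : k \in K -> \int[leb n]_(x in gcell (- L) t k) psi (grad v x) <=
    t ^+ n * psi (grad v (c k)) + t ^+ n * tau1.
  move=> kK; rewrite -mulrDr -(int_cst k); apply: le_Rintegral => //.
  - exact: intPsi (cellL _ kK).
  - exact: intcst (cellL _ kK).
  by move=> x /(near_P _ _ kK)/dist_bounds[].
have VcL : V `<=` cball L by move=> x /VL.
have dis k k' : k \in K -> k' \in K -> k != k' ->
    gcell (- L) t k `&` gcell (- L) t k' = set0.
  by move=> _ _; exact: gcell_disjoint.
have IE := sum_Rintegral_disjoint (cells_in_uniq L t M V) mc mV dis KV (intPsi _ mV VcL).
have LE := sum_Rintegral_disjoint (cells_in_uniq L t M V) mc mV dis KV (intcst _ 1 mV VcL).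
rewrite -/I -/K in IE; rewrite -/K in LE.
set W := V `\` _ in IE LE.
have mW : measurable W by apply: measurableD => //; exact: measurable_seq_union.
have WL : W `<=` cball L by move=> x [/VcL].
have W0 : 0 <= fine (leb n W) by rewrite fine_ge0.
rewrite !Rintegral_cst// !mul1r -/Lam in LE.
rewrite (eq_bigr (fun=> t ^+ n)) in LE; last by move=> k _; rewrite int_cst mulr1.
rewrite big_const_seq count_predT iter_addr_0 -mulr_natl in LE.
have Nt : (size K)%:R * t ^+ n <= Lam by rewrite -LE lerDl.
have IW0 : 0 <= \int[leb n]_(x in W) psi (grad v x) by apply: Rintegral_ge0.
have IW : \int[leb n]_(x in W) psi (grad v x) <= S * eta.
  apply: le_trans (_ : \int[leb n]_(x in W) S <= _).
    apply: le_Rintegral => //; [exact: intPsi|exact: intcst|].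
    by move=> x /WL/psiS.
  rewrite Rintegral_cst// ler_wpM2l//.
  by move: LE Kexh; clear; lra.
have sumc z : \sum_(k <- K) t ^+ n * z = (size K)%:R * t ^+ n * z.
  by rewrite big_const_seq count_predT iter_addr_0 -[LHS]mulr_natl mulrA.
have Ntau : (size K)%:R * t ^+ n * tau1 <= tau / 8.
  by rewrite (le_trans _ tL)// mulrC ler_wpM2l// ltW.
(* The shrinking ratio: [1/4] keeps shrunken cells nondegenerate, and the second entry bounds the
   total measure lost by shrinking by [eta]. *)
pose nu := Num.min (4^-1) (eta / (2 * n%:R * (Lam + 1))).
have n0R : 0 < n%:R :> R by rewrite ltr0n.
have nu0 : 0 < nu.
  by rewrite lt_min invr_gt0 ltr0n /= divr_gt0// !mulr_gt0.
have nu4 : nu <= 4^-1 by rewrite ge_min lexx.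
have nuE : 2 * n%:R * nu * (Lam + 1) <= eta.
  have : nu <= eta / (2 * n%:R * (Lam + 1)) by rewrite ge_min lexx orbT.
  by rewrite ler_pdivlMr ?mulr_gt0// => H; apply: le_trans H; rewrite le_eqVlt; apply/orP; left; apply/eqP; ring.
pose h := nu * t.
have h0 : 0 < h by rewrite mulr_gt0.
have th : t - 2 * h = (1 - 2 * nu) * t by rewrite /h; ring.
have th0 : 0 < t - 2 * h by rewrite th mulr_gt0//; move: nu4; clear; lra.
have ls k := (scell_measure (- L) (k : grid n M) th0).1.
have ms k := (scell_measure (- L) (k : grid n M) th0).2.
have sg k := @scell_gcell R n (- L) t h M k h0.
have sdis k k' : k \in K -> k' \in K -> k != k' ->
    scell (- L) t h k `&` scell (- L) t h k' = set0.
  move=> kK k'K kk'; rewrite -subset0 -(dis _ _ kK k'K kk').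
  by move=> x [? ?]; split; exact: sg.
have sV k : k \in K -> scell (- L) t h k `<=` V by move=> kK x /sg/(KV _ kK).
have SE := sum_Rintegral_disjoint (cells_in_uniq L t M V) ms mV sdis sV (intcst _ 1 mV VcL).
set Z := V `\` _ in SE.
have mZ : measurable Z by apply: measurableD => //; exact: measurable_seq_union.
have ZL : Z `<=` cball L by move=> x [/VcL].
have Zfin : (leb n Z < +oo)%E.
  by apply: (le_lt_trans _ Vfin); apply: le_measure; rewrite ?inE//; exact: subDsetl.
rewrite !Rintegral_cst// !mul1r -/Lam in SE.
rewrite (eq_bigr (fun=> (t - 2 * h) ^+ n)) in SE; last first.
  by move=> k _; rewrite Rintegral_cst// mul1r; have /= -> := ls k.
rewrite big_const_seq count_predT iter_addr_0 -[X in X + _ = _]mulr_natl in SE.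
(* One [eta] is due to the part of [V] outside the cells, the other, through Bernoulli's inequality,
   to the shrinking. *)
have Zeta : fine (leb n Z) <= 2 * eta.
  have B : (1 - n%:R * (2 * nu)) * t ^+ n <= (t - 2 * h) ^+ n.
    have -> : (t - 2 * h) ^+ n = (1 - 2 * nu) ^+ n * t ^+ n by rewrite th; exact: exprMn.
    rewrite ler_wpM2r ?(ltW tn)//; apply: bernoulli_le.
    by move: nu0 nu4; clear => *; apply/andP; split; lra.
  have : (size K)%:R * ((1 - n%:R * (2 * nu)) * t ^+ n) <= (size K)%:R * (t - 2 * h) ^+ n.
    by rewrite ler_wpM2l.
  have : (size K)%:R * t ^+ n * (2 * n%:R * nu) <= (Lam + 1) * (2 * n%:R * nu).
    by rewrite ler_wpM2r ?mulr_ge0 ?(ltW nu0)//; move: Nt; clear; lra.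
  move: nuE SE Kexh; move: ((size K)%:R) (t ^+ n) (fine (leb n Z)) ((t - 2 * h) ^+ n) => a1 a2 a3 a4.
  by clear; nra.
have [cs cs0 Hcs] := copies_small.
have [f fP [e1 e10 e1f]] := seq_lower_bound K (fun k => lin_cell_lower (grad v (c k)) tau10).
(* The first entry admits almost optimal packings in every cell, the second makes the copies smaller
   than the margin [h]. *)
exists (Num.min (t * e1) (h / cs)); first by rewrite lt_min mulr_gt0//= divr_gt0.
move=> e /andP[e0]; rewrite lt_min => /andP[ete eh].
have eS' k s : k \in K -> packs e (gcell (- L) t k) s -> psum e v s <= t ^+ n * S.
  move=> kK ps; have := HC _ _ _ _ M0 Cv e0 (mc k) _ ps (ltW M00).
  rewrite lc ltry /= => /(_ isT) H; rewrite (le_trans (H _))//.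
    by move=> x xk; apply: gM; exact: cellL xk.
  by rewrite mulrC ler_wpM2l ?(ltW tn)// /S lerDr.
have cmp k s : k \in K -> packs e (gcell (- L) t k) s ->
    (psi (grad v (c k)) <= S -> psum e v s <= t ^+ n * (psi (grad v (c k)) + tau1)) /\
    (psum e v s <= t ^+ n * S -> psum e (lin (grad v (c k))) s <= psum e v s + t ^+ n * tau1).
  move=> kK ps; apply: (Hb v _ t (c k) e s Cv tt0 e0); rewrite cE//.
  by move=> x; exact: near_g.
apply/andP; split.
  have low k : k \in K -> exists s, packs e (gcell (- L) t k) s /\
      t ^+ n * (psi (grad v (c k)) - tau1 - tau1) <= psum e v s.
    move=> kK; have [|s ps Hs] := fP k t (c k) e tt0.
      by rewrite e0 (lt_le_trans ete)// ler_wpM2l ?(ltW tt0)// e1f.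
    exists s; rewrite cE in ps; split=> //.
    have [_ /(_ (eS' _ _ kK ps))] := cmp k s kK ps; move: Hs; rewrite !mulrBr; clear; lra.
  have [sk skP] : exists sk, forall k, k \in K -> packs e (gcell (- L) t k) (sk k) /\
      t ^+ n * (psi (grad v (c k)) - tau1 - tau1) <= psum e v (sk k).
    have Hc k : exists s, k \in K -> packs e (gcell (- L) t k) s /\
      t ^+ n * (psi (grad v (c k)) - tau1 - tau1) <= psum e v s.
      have [kK|kK] := boolP (k \in K); last by exists [::].
      by have [s H] := low k kK; exists s.
    exists (fun k => sval (cid (Hc k))) => k kK; by case: cid => s /= /(_ kK).
  have pall : packs e V (flatten [seq sk k | k <- K]).
    apply: (@packs_flatten _ _ _ _ _ _ (fun k => gcell (- L) t k)) => //.
    - exact: cells_in_uniq.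
    - by move=> k /skP[].
  apply: le_trans (psum_le_bmo_eps alpha_core e0 Lv pall); rewrite lee_fin psum_flatten.
  (* [tau1] is lost three times: in the choice of the packing, in passing from the linear map to
     [v], and in passing from the value at the centre to the integral. *)
  apply: le_trans (_ : \sum_(k <- K) (\int[leb n]_(x in gcell (- L) t k) psi (grad v x) - t ^+ n * (3 * tau1)) <= _).
    rewrite sumrB sumc -IE.
    have : (size K)%:R * t ^+ n * (3 * tau1) <= 3 * (tau / 8).
      by rewrite mulrCA ler_wpM2l.
    by move: IW eS t0; clear; lra.
  rewrite big_seq [leRHS]big_seq; apply: ler_sum => k kK.
  have [_ H] := skP k kK; apply: le_trans H; have := int_lo k kK; rewrite !mulrBr; clear; lra.
apply: (bmo_eps_le alpha_core e0 Lv) => s ps; rewrite lee_fin.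
apply: (le_trans (psum_cover K (fun k => gcell (- L) t k) e0 Lv ps)).
(* A copy contained in no cell of [K] meets no shrunken cell, its diameter being below [h]; so it
   lies in [Z], where the energy bound gives at most [S] times [2 eta]. *)
have rest : psum e v [seq D' <- s | ~~ has (fun k => `[< D' `<=` gcell (- L) t k >]) K] <= 2 * (tau / 8).
  have psZ : packs e Z [seq D' <- s | ~~ has (fun k => `[< D' `<=` gcell (- L) t k >]) K].
    apply: (packs_filter _ ps) => D' D's nhas x D'x.
    have [cD' _] := ps.1 _ D's.
    split; first by case: cD' D'x => A [h' [_ -> ]]; apply.
    move=> [k kK xk]; move/negP: nhas; apply; apply/hasP; exists k => //.
    apply/asboolP => y D'y; apply: (scell_near h0 xk).
    rewrite (le_lt_trans (Hcs _ _ _ _ _ e0 cD' D'x D'y))//.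
    by move: eh; rewrite ltr_pdivlMr// mulrC.
  have := HC _ _ _ _ M0 Cv e0 mZ Zfin psZ (ltW M00).
  move=> /(_ (fun x xZ => gM x (ZL x xZ))) H; apply: (le_trans H).
  apply: le_trans (_ : S * (2 * eta) <= _); last by rewrite mulrCA ler_wpM2l// mulrC.
  by rewrite ler_pM// ?fine_ge0// /S lerDr.
have cellsum : \sum_(k <- K) psum e v [seq D' <- s | `[< D' `<=` gcell (- L) t k >]] <=
   \sum_(k <- K) (\int[leb n]_(x in gcell (- L) t k) psi (grad v x) + t ^+ n * (2 * tau1)).
  rewrite big_seq [leRHS]big_seq; apply: ler_sum => k kK.
  have psk : packs e (gcell (- L) t k) [seq D' <- s | `[< D' `<=` gcell (- L) t k >]].
    by apply: (packs_filter _ ps) => D' _ /asboolP.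
  have [/(_ (psiS _ (VL _ (ck _ kK)))) H _] := cmp k _ kK psk; rewrite (le_trans H)//.
  by have := int_up k kK; clear; lra.
apply: (le_trans (lerD cellsum rest)).
rewrite big_split /= sumc.
have : (size K)%:R * t ^+ n * (2 * tau1) <= 2 * (tau / 8).
  by rewrite mulrCA ler_wpM2l.
by move: IE IW0 t0; clear; lra.
Qed.

End C1_limit.

(** * Mollifications as averages of translates *)

Section lebesgue_scaling.
Context {R : realType} (t : R) (t0 : 0 < t).

Lemma lebesgue_measure_scale (A : set R) : measurable A ->
  (t%:E * lebesgue_measure [set x | A (t * x)%R])%E = lebesgue_measure A.
Proof.
move=> mA.
have mf : measurable_fun setT (fun x : R => t * x : measurableTypeR R) by exact: measurable_funM.
pose mu := measure_function_pushforward__canonical__measure_function_Measure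
  (@lebesgue_measure R) mf.
rewrite (@lebesgue_measure_unique _ (mscale (NngNum (ltW t0)) mu) _ A mA)//.
move=> X [[a b] /= _ <-].
rewrite /mscale /mu /= /pushforward.
rewrite (_ : _ @^-1` _ = `]t^-1 * a, t^-1 * b]%classic); last first.
  by apply/seteqP; split => x /=;
    rewrite !in_itv /= ltr_pdivrMl// ler_pdivlMl.
rewrite !lebesgue_measure_itv/= !lte_fin ltr_pM2l ?invr_gt0//.
case: ifP => _; last by rewrite mule0.
by rewrite -!EFinD -EFinM -mulrBr mulrA divff ?gt_eqF// mul1r.
Qed.

Lemma ge0_integral_lebesgue_scale (f : R -> \bar R) :
  measurable_fun [set: R] f -> (forall x, 0 <= f x)%E ->
  (t%:E * \int[lebesgue_measure]_x f (t * x)%R = \int[lebesgue_measure]_x f x)%E.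
Proof.
move=> mf f0.
have ma : measurable_fun setT (fun x : R => t * x : measurableTypeR R) by exact: measurable_funM.
pose mu := measure_function_pushforward__canonical__measure_function_Measure
  (@lebesgue_measure R) ma.
transitivity (\int[mscale (NngNum (ltW t0)) mu]_x f x)%E.
  by rewrite ge0_integral_mscale//= ge0_integral_pushforward//.
by apply: eq_measure_integral => A mA _; exact: lebesgue_measure_scale.
Qed.

Lemma measurable_scale_mx n k : measurable_fun setT (fun x : 'M[R]_(n, k) => t *: x).
Proof.
apply: measurable_mxP => i j; under eq_fun do rewrite mxE.
by apply: measurable_funM => //; exact: measurable_entry.
Qed.

Lemma leb_scale n (A : set 'cV[R]_n) : measurable A ->
  ((t ^+ n)%:E * leb n [set x | A (t *: x)])%E = leb n A.
Proof.
elim: n A => [|n IH] A mA.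
  rewrite expr0 mul1e; congr (leb 0 _); apply/seteqP; split => x /=; rewrite (_ : t *: x = x)//;
  by apply/colP => -[].
rewrite /= /leb_cons /pushforward /= /product_measure1 /=.
set B := @cv_cons R n @^-1` A.
have mB : measurable B.
  by rewrite -[X in measurable X]setTI; exact: measurable_cv_cons.
rewrite -(@ge0_integral_lebesgue_scale (fun x => leb n (xsection B x)))//; last first.
  exact: measurable_fun_xsection.
rewrite exprS EFinM -muleA; congr (_ * _)%E.
set C := @cv_cons R n @^-1` [set x | A (t *: x)].
have mC : measurable C.
  rewrite -[X in measurable X]setTI; apply: measurable_cv_cons => //.
  rewrite -[X in measurable X]setTI; exact: measurable_scale_mx.
rewrite -ge0_integralZl//; last 2 first.
- exact: measurable_fun_xsection.
- by rewrite lee_fin exprn_ge0// ltW.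
apply: eq_integral => x _ /=.
rewrite -[RHS]IH; last by apply: measurable_xsection.
congr (_ * leb n _)%E; apply/seteqP; split => y /=; rewrite /xsection /= !inE /B /C /=;
  rewrite (_ : t *: cv_cons (x, y) = cv_cons (t * x, t *: y))//;
  apply/colP => i; rewrite !mxE; case: unliftP => [j _|_]; by rewrite ?mxE.
Qed.

Lemma ge0_integral_scale n (f : 'cV[R]_n -> \bar R) :
  measurable_fun [set: 'cV[R]_n] f -> (forall x, 0 <= f x)%E ->
  ((t ^+ n)%:E * \int[leb n]_x f (t *: x)%R = \int[leb n]_x f x)%E.
Proof.
move=> mf f0; have tn0 : 0 <= t ^+ n by rewrite exprn_ge0// ltW.
pose mu := measure_function_pushforward__canonical__measure_function_Measure
  (leb n) (@measurable_scale_mx n 1).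
transitivity (\int[mscale (NngNum tn0) mu]_x f x)%E.
  rewrite ge0_integral_mscale//= ge0_integral_pushforward//.
  exact: measurable_scale_mx.
by apply: eq_measure_integral => A mA _; exact: leb_scale.
Qed.

End lebesgue_scaling.

Section mollifier_mass.
Context {R : realType} (n : nat) (rho : 'cV[R]_n -> R) (s : R).
Context (krho : standard_kernel rho) (s0 : 0 < s).

Lemma mollifier_ge0 x : 0 <= mollifier rho s x.
Proof. by case: krho => _ _ r0 _; rewrite mulr_ge0// invr_ge0 exprn_ge0// ltW. Qed.

Lemma mollifierN x : mollifier rho s (- x) = mollifier rho s x.
Proof.
case: krho => _ rad _ _; congr (_ * _); apply: rad.
by rewrite scalerN -scaleN1r enormZ normrN1 mul1r.
Qed.

Lemma mollifier_supp x : mollifier rho s x != 0 -> enorm x < s.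
Proof.
case: krho => -[_ _ rho1] _ _ _; rewrite /mollifier mulf_eq0 negb_or => /andP[_ rx].
have /rho1 /= : tsupport rho (s^-1 *: x) by exact: subset_closure.
by rewrite enormZ gtr0_norm ?invr_gt0// mulrC ltr_pdivrMr// mul1r.
Qed.

Lemma mollifier_mass : (\int[leb n]_x (mollifier rho s x)%:E = 1)%E.
Proof.
have [_ _ _ <-] := krho; case: krho => -[srho _ _] _ r0 _.
have mr : measurable_fun setT rho by apply: continuous_measurable_mx; exact: (srho 0).
have i0 : 0 < s^-1 by rewrite invr_gt0.
rewrite -(@ge0_integral_scale _ _ i0 _ (fun x => (rho x)%:E))//; last first.
  exact/measurable_EFinP.
rewrite -ge0_integralZl//; first by apply: eq_integral => x _; rewrite -EFinM exprVn.
- apply/measurable_EFinP; apply: measurableT_comp => //; exact: measurable_scale_mx.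
- by move=> x _; rewrite lee_fin.
- by rewrite lee_fin exprn_ge0// ltW.
Qed.

End mollifier_mass.

Section bounded_measurable.
Context d (T : measurableType d) (R : realType).
Implicit Types f g : T -> R.

(** Stable under sums, products and measurable substitutions, and integrable on sets of finite
    measure, so integrability in the sampling argument costs little. *)
Definition bmeas f := measurable_fun setT f /\ exists M : R, forall x, `|f x| <= M.

Lemma bmeas_cst c : bmeas (fun=> c).
Proof. by split => //; exists `|c|. Qed.

Lemma bmeasD f g : bmeas f -> bmeas g -> bmeas (fun x => f x + g x).
Proof.
move=> [mf [M fM]] [mg [N gN]]; split; first exact: measurable_funD.
by exists (M + N) => x; rewrite (le_trans (ler_normD _ _))// lerD.
Qed.

Lemma bmeasM f g : bmeas f -> bmeas g -> bmeas (fun x => f x * g x).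
Proof.
move=> [mf [M fM]] [mg [N gN]]; split; first exact: measurable_funM.
by exists (M * N) => x; rewrite normrM ler_pM.
Qed.

Lemma bmeasB f g : bmeas f -> bmeas g -> bmeas (fun x => f x - g x).
Proof.
move=> bf bg; rewrite (_ : (fun x => _) = (fun x => f x + (-1) * g x)).
  by apply: bmeasD => //; apply: bmeasM => //; exact: bmeas_cst.
by apply/funext => x; rewrite mulN1r.
Qed.

Lemma bmeas_sum (I : Type) (s : seq I) (P : pred I) (f : I -> T -> R) :
  (forall i, bmeas (f i)) -> bmeas (fun x => \sum_(i <- s | P i) f i x).
Proof.
move=> bf; elim: s => [|i s IH].
  by under eq_fun do rewrite big_nil; exact: bmeas_cst.
under eq_fun do rewrite big_cons.
by case: (P i) => //; apply: bmeasD.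
Qed.

Lemma bmeas_indic (A : set T) : measurable A -> bmeas (\1_A : T -> R).
Proof.
move=> mA; split; first exact: measurable_indic.
by exists 1 => x; rewrite indicE; case: (_ \in _); rewrite ?normr1 ?normr0.
Qed.

Lemma bmeas_integrable (mu : {measure set T -> \bar R}) (A : set T) f : measurable A ->
  (mu A < +oo)%E -> bmeas f -> mu.-integrable A (EFin \o f).
Proof.
move=> mA Afin [mf [M fM]]; apply: measurable_bounded_integrable => //.
  exact: measurable_funTS.
by exists M; split; [exact: num_real|move=> M' MM' x _ /=; rewrite (le_trans (fM x))// ltW].
Qed.

End bounded_measurable.

Lemma bmeas_comp d d' (T : measurableType d) (T' : measurableType d') (R : realType)
    (h : T' -> T) (f : T -> R) :
  measurable_fun setT h -> bmeas f -> bmeas (f \o h).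
Proof.
move=> mh [mf [M fM]]; split; first exact: measurableT_comp mf mh.
by exists M => x; exact: fM.
Qed.

Section finite_sums.
Context d (T : measurableType d) (R : realType) (mu : {measure set T -> \bar R}).

Lemma integral_EFin (D : set T) (f : T -> R) : measurable D ->
  mu.-integrable D (EFin \o f) ->
  (\int[mu]_(x in D) (f x)%:E)%E = (\int[mu]_(x in D) f x)%:E.
Proof. by move=> mD If; rewrite /Rintegral fineK//; exact: integrable_fin_num. Qed.

Lemma integrable_sumf (D : set T) (I : Type) (s : seq I) (f : I -> T -> R) :
  measurable D -> (forall i, mu.-integrable D (EFin \o f i)) ->
  mu.-integrable D (EFin \o (fun x => \sum_(i <- s) f i x)).
Proof.
move=> mD If; elim: s => [|i s IH].
  by under eq_fun do rewrite big_nil; exact: integrable0.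
by under eq_fun do rewrite big_cons; exact: integrable_addf.
Qed.

Lemma Rintegral_sum (D : set T) (I : Type) (s : seq I) (f : I -> T -> R) :
  measurable D -> (forall i, mu.-integrable D (EFin \o f i)) ->
  \int[mu]_(x in D) (\sum_(i <- s) f i x) = \sum_(i <- s) \int[mu]_(x in D) f i x.
Proof.
move=> mD If; elim: s => [|i s IH].
  by rewrite /Rintegral; under eq_integral do rewrite big_nil; rewrite integral0 big_nil.
under eq_Rintegral do rewrite big_cons.
by rewrite RintegralD// ?IH ?big_cons//; exact: integrable_sumf.
Qed.

End finite_sums.

(** * Choice of the sample points *)

Section greedy_sampling.
Context {R : realType} (n m : nat).
Implicit Types (x z : 'cV[R]_n).
Context (k : 'cV[R]_n -> R) (s r : R) (dev : 'I_m -> 'cV[R]_n * 'cV[R]_n -> R).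
Context (bk : bmeas k) (k0 : forall z, 0 <= k z) (ks : null_outside s k).
Context (k1 : \int[leb n]_z k z = 1).
Context (bdev : forall i, bmeas (dev i)).
Context (dev0 : forall i x, \int[leb n]_z (k z * dev i (z, x)) = 0).

Let C : set 'cV[R]_n := cball r.
Let mC : measurable C := @measurable_cball R n r.

Let iC (f : 'cV[R]_n -> R) : bmeas f -> (leb n).-integrable C (EFin \o f).
Proof. by apply: bmeas_integrable => //; exact: leb_cball_lty. Qed.

Let bsec z i : bmeas (fun x => dev i (z, x)).
Proof. by apply: (@bmeas_comp _ _ _ _ _ (fun x => (z, x))) => //; exact: measurable_pair1. Qed.

Let bsec2 x i : bmeas (fun z => dev i (z, x)).
Proof. by apply: (@bmeas_comp _ _ _ _ _ (fun z => (z, x))) => //; exact: measurable_pair2. Qed.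

(** By Fubini's theorem the integral over [z] may be taken first, and it vanishes for each [x]
    because [dev i (z, x)] has mean zero under [k]. *)
Lemma greedy_mean (g : 'I_m -> 'cV[R]_n -> R) : (forall i, bmeas (g i)) ->
  let H z := \int[leb n]_(x in C) (\sum_i g i x * dev i (z, x)) in
  measurable_fun setT (fun z => k z * H z) /\ (\int[leb n]_z (k z * H z)%:E = 0)%E.
Proof.
move=> bg H.
pose F (q : 'cV[R]_n * 'cV[R]_n) := k q.1 * (\1_C q.2 * \sum_i g i q.2 * dev i q).
have bF : bmeas F.
  apply: bmeasM; first by apply: (bmeas_comp _ bk); exact: measurable_fst.
  apply: bmeasM; first by apply: (bmeas_comp _ (bmeas_indic _ mC)); exact: measurable_snd.
  apply: bmeas_sum => i; apply: bmeasM => //.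
  by apply: (bmeas_comp _ (bg i)); exact: measurable_snd.
(* [F] lives on a product of two cubes, of finite measure, where a bounded measurable function is
   integrable. *)
have iF : (leb n \x leb n)%E.-integrable setT (EFin \o F).
  have mB : measurable (cball s `*` C : set ('cV[R]_n * 'cV[R]_n)).
    by apply: measurableX => //; exact: measurable_cball.
  rewrite (_ : F = F \_ (cball s `*` C)); last first.
    apply/funext => -[z x]; rewrite patchE; case: ifPn => // /negP zx.
    rewrite /F /=; have [zs|zs] := leP `|z| s; last by rewrite ks// mul0r.
    rewrite indicE; have [xC|_] := boolP (x \in C); last by rewrite mul0r mulr0.
    by exfalso; apply: zx; rewrite inE; split => //; exact: set_mem xC.
  rewrite -restrict_EFin; apply/(integrable_mkcond _ mB).
  apply: bmeas_integrable => //.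
  have /= -> := product_measure1E (leb n) (leb n) (measurable_cball s) mC.
  by rewrite lte_mul_pinfty ?leb_cball_lty// ge0_fin_numE// leb_cball_lty.
have ik (f : 'cV[R]_n -> R) : bmeas f -> (leb n).-integrable setT (EFin \o (fun z => k z * f z)).
  move=> bf; apply: (integrable_null_outside (r := s)).
    by move=> z zs; rewrite ks// mul0r.
  apply: bmeas_integrable; [exact: measurable_cball|exact: leb_cball_lty|exact: bmeasM].
have bS z : bmeas (fun x => \sum_i g i x * dev i (z, x)).
  by apply: bmeas_sum => i; apply: bmeasM.
have FH z : fubini_F (leb n) (EFin \o F) z = (k z * H z)%:E.
  rewrite /fubini_F /F /= /H -RintegralZl//; last exact: iC.
  rewrite -integral_EFin//; last by apply: integrable_scalef => //; exact: iC.
  rewrite [RHS]integral_mkcond; apply: eq_integral => x _.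
  rewrite patchE indicE; have [xC|xC] := boolP (x \in C); first by rewrite mul1r.
  by rewrite mul0r mulr0.
have GH x : fubini_G (leb n) (EFin \o F) x = 0%E.
  rewrite /fubini_G /F /=.
  under eq_integral do rewrite mulrCA.
  rewrite integral_EFin//; last first.
    apply: integrable_scalef => //; apply: ik; apply: bmeas_sum => i; apply: bmeasM => //.
    exact: bmeas_cst.
  congr EFin; rewrite RintegralZl//; last first.
    apply: ik; apply: bmeas_sum => i; apply: bmeasM => //; exact: bmeas_cst.
  rewrite (_ : \int[_]_z _ = 0) ?mulr0//.
  under eq_Rintegral do rewrite mulr_sumr.
  rewrite Rintegral_sum//; last first.
    by move=> i; apply: ik; apply: bmeasM => //; exact: bmeas_cst.
  apply: big1 => i _; under eq_Rintegral do rewrite mulrCA.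
  by rewrite RintegralZl//; [rewrite dev0 mulr0|exact: ik].
have FE : fubini_F (leb n) (EFin \o F) = EFin \o (fun z => k z * H z) by apply/funext.
split; first by apply/measurable_EFinP; rewrite -FE; exact: (measurable_fubini_F iF).
have := integral12_prod_meas1 iF; rewrite -integral21_prod_meas1//.
rewrite FE (_ : fubini_G _ _ = cst 0%E) ?integral0; last by apply/funext.
by [].
Qed.

(* Otherwise the integrand of the vanishing mean would be positive wherever k is. *)
Lemma greedy_step (g : 'I_m -> 'cV[R]_n -> R) : (forall i, bmeas (g i)) ->
  exists2 z, 0 < k z & \int[leb n]_(x in C) (\sum_i g i x * dev i (z, x)) <= 0.
Proof.
move=> bg; apply: contrapT => noz.
pose H z := \int[leb n]_(x in C) (\sum_i g i x * dev i (z, x)).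
have [mkH ikH] : measurable_fun setT (fun z => k z * H z) /\
  (\int[leb n]_z (k z * H z)%:E = 0)%E := greedy_mean bg.
have Hpos z : 0 < k z -> 0 < H z.
  by move=> kz; rewrite ltNge; apply/negP => Hz; apply: noz; exists z.
have kH0 z : 0 <= k z * H z.
  have := k0 z; rewrite le_eqVlt => /predU1P[<-|kz]; first by rewrite mul0r.
  by rewrite mulr_ge0// ltW// Hpos.
have ae0 : ae_eq (leb n) setT (EFin \o (fun z => k z * H z)) (cst 0%E).
  apply/ae_eq_integral_abs => //; first exact/measurable_EFinP.
  by rewrite -ikH; apply: eq_integral => z _ /=; rewrite ger0_norm.
have : (\int[leb n]_z (k z)%:E = \int[leb n]_z (cst 0 z))%E.
  apply: ae_eq_integral => //; first by apply/measurable_EFinP; case: bk.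
  apply: filterS ae0 => z /= /(_ Logic.I)[/eqP]; rewrite mulf_eq0 => /orP[/eqP->//|/eqP Hz _].
  have := k0 z; rewrite le_eqVlt => /predU1P[<-//|/Hpos].
  by rewrite Hz ltxx.
rewrite integral0 => k0'; have := k1; rewrite /Rintegral k0' /= => /eqP.
by rewrite eq_sym oner_eq0.
Qed.

(* The points are chosen one after the other so that each cross term of the
   expanded square is nonpositive; only the diagonal terms add up. *)
Lemma greedy_sampling : exists2 B : R, 0 <= B & forall N, exists zs : seq 'cV[R]_n,
  [/\ size zs = N, forall z, z \in zs -> 0 < k z &
    \int[leb n]_(x in C) (\sum_i (\sum_(z <- zs) dev i (z, x)) ^+ 2) <= N%:R * B].
Proof.
have [M M0 devM] : exists2 M : R, 0 <= M & forall i q, `|dev i q| <= M.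
  have /choice[M MP] : forall i, exists M : R, forall q, `|dev i q| <= M.
    by move=> i; case: (bdev i).
  exists (\sum_i `|M i|); first exact: sumr_ge0.
  move=> i q; rewrite (le_trans (MP i q))// (le_trans (ler_norm _))//.
  by rewrite (bigD1 i)//= lerDl sumr_ge0.
have bsq z : bmeas (fun x => \sum_i dev i (z, x) ^+ 2).
  by apply: bmeas_sum => i; apply: bmeasM.
have bnd z : \int[leb n]_(x in C) (\sum_i dev i (z, x) ^+ 2) <=
    \int[leb n]_(x in C) (m%:R * M ^+ 2).
  apply: le_Rintegral => //; [exact: iC|by apply: iC; exact: bmeas_cst|].
  move=> x _; apply: le_trans (_ : \sum_(i < m) M ^+ 2 <= _).
    by apply: ler_sum => i _; rewrite -real_normK ?num_real// lerXn2r ?nnegrE.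
  by rewrite sumr_const card_ord mulr_natl.
exists (\int[leb n]_(x in C) (m%:R * M ^+ 2)).
  by apply: Rintegral_ge0 => x _; rewrite mulr_ge0// exprn_ge0.
elim=> [|N [zs [zN zk IH]]].
  exists [::]; split => //; rewrite mul0r /Rintegral.
  under eq_integral do under eq_bigr do rewrite big_nil expr0n /=.
  under eq_integral do rewrite sumr_const mul0rn.
  by rewrite integral0.
pose f i x := \sum_(z <- zs) dev i (z, x).
have bf i : bmeas (f i) by apply: bmeas_sum => z.
have [z kz Hz] := greedy_step bf.
exists (z :: zs); split; first by rewrite /= zN.
  by move=> y; rewrite inE => /predU1P[->//|/zk].
rewrite (_ : \int[_]_(x in C) _ = \int[leb n]_(x in C) ((\sum_i f i x ^+ 2) +
    (2 * (\sum_i f i x * dev i (z, x)) + \sum_i dev i (z, x) ^+ 2))); last first.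
  apply: eq_Rintegral => x _; rewrite mulr_sumr -!big_split; apply: eq_bigr => i _ /=.
  by rewrite big_cons -/(f i x); ring.
have i1 : (leb n).-integrable C (EFin \o (fun x => \sum_i f i x ^+ 2)).
  by apply: iC; apply: bmeas_sum => i; apply: bmeasM.
have i2 : (leb n).-integrable C (EFin \o (fun x => \sum_i f i x * dev i (z, x))).
  by apply: iC; apply: bmeas_sum => i; apply: bmeasM.
have i3 := iC (bsq z).
rewrite RintegralD//; last by apply: integrable_addf => //; exact: integrable_scalef.
rewrite RintegralD//; last exact: integrable_scalef.
have E (c : R) : N.+1%:R * c = N%:R * c + c by rewrite -natr1 mulrDl mul1r.
rewrite RintegralZl// E; apply: lerD; first exact: IH.
by rewrite -[leRHS]add0r lerD// pmulr_rle0.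
Qed.

End greedy_sampling.

Section convex_mean.
Context {R : realType}.

(** Finite Jensen inequality with equal weights. The domain [Q] lets it serve both for [alpha] on
    [Lploc] functions and for a power on the half-line. *)
Lemma convex_mean (V : lmodType R) (Q : V -> Prop) (Phi : V -> R) :
  (forall x y t, Q x -> Q y -> 0 <= t <= 1 -> Q (t *: x + (1 - t) *: y) /\
    Phi (t *: x + (1 - t) *: y) <= t * Phi x + (1 - t) * Phi y) ->
  forall (I : eqType) (s : seq I) (f : I -> V), (0 < size s)%N ->
  (forall i, i \in s -> Q (f i)) ->
  Q ((size s)%:R^-1 *: \sum_(i <- s) f i) /\
  Phi ((size s)%:R^-1 *: \sum_(i <- s) f i) <= (size s)%:R^-1 * \sum_(i <- s) Phi (f i).
Proof.
move=> cvx I; elim=> [//|i [_ f _ Qf|j s IH f _ Qf]].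
  by rewrite !big_seq1 /= invr1 scale1r mul1r; split => //; apply: Qf; rewrite mem_head.
have {}IH := IH f isT (fun k sk => Qf k (@mem_behead _ [:: i, j & s] k sk)).
have {IH} [QM PM] := IH.
set S := j :: s in QM PM *; set N := (size S)%:R : R.
have N0 : 0 < N by rewrite ltr0n.
have N1 : (size (i :: S))%:R = N + 1 by rewrite -natr1.
have Nn : N != 0 by rewrite gt_eqF.
have N1n : N + 1 != 0 by rewrite gt_eqF// addr_gt0.
(* The new point gets weight [1/(N+1)]; the remaining weight, shared by [N] old points, is again
   [1/(N+1)] for each. *)
pose t := (N + 1)^-1.
have t01 : 0 <= t <= 1.
  have N1p : 0 < N + 1 by rewrite addr_gt0.
  by rewrite /t invr_ge0 (ltW N1p) invf_le1// lerDr ltW.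
have tN : (1 - t) * N^-1 = t by rewrite /t; field; rewrite Nn N1n.
rewrite N1 -/t.
have -> : t *: (\sum_(k <- i :: S) f k) = t *: f i + (1 - t) *: (N^-1 *: \sum_(k <- S) f k).
  by rewrite big_cons scalerDr scalerA tN.
have [Qc Pc] := cvx _ _ t (Qf i (mem_head _ _)) QM t01.
split => //; rewrite (le_trans Pc)// [X in _ <= t * X]big_cons mulrDr lerD2l.
by rewrite -[X in _ <= X * _]tN -mulrA ler_wpM2l// subr_ge0; case/andP: t01.
Qed.

Lemma powR_mean (p : R) (I : eqType) (s : seq I) (a : I -> R) : 1 <= p ->
  (0 < size s)%N -> (forall i, 0 <= a i) ->
  ((size s)%:R^-1 * \sum_(i <- s) a i) `^ p <= (size s)%:R^-1 * \sum_(i <- s) a i `^ p.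
Proof.
move=> p1 s0 a0.
suff cvx : forall x y t : R^o, 0 <= x -> 0 <= y -> 0 <= t <= 1 ->
    0 <= t *: x + (1 - t) *: y /\
    (t *: x + (1 - t) *: y) `^ p <= t * x `^ p + (1 - t) * y `^ p.
  by have [] := @convex_mean R^o (fun x => 0 <= x) (fun x => x `^ p) cvx I s a s0 (fun i _ => a0 i).
move=> x y t x0 y0 /andP[t0 t1]; split.
  by rewrite addr_ge0// mulr_ge0// subr_ge0.
have := convex_powR p1 (Itv01 t0 t1) (x := x) (y := y).
rewrite !inE /= !in_itv /= !andbT => /(_ x0 y0).
by rewrite !convRE.
Qed.

Lemma mean_le (I : eqType) (s : seq I) (a : I -> R) (c : R) : (0 < size s)%N ->
  (forall i, i \in s -> a i <= c) -> (size s)%:R^-1 * \sum_(i <- s) a i <= c.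
Proof.
move=> s0 ac; rewrite ler_pdivrMl ?ltr0n//.
apply: le_trans (_ : \sum_(i <- s) c <= _).
  by rewrite big_seq [leRHS]big_seq; exact: ler_sum.
by rewrite big_const_seq count_predT iter_addr_0 [leRHS]mulr_natl.
Qed.

End convex_mean.

Section sampling_mollifier.
Context {R : realType} (m n : nat) (p : R) (p1 : 1 <= p).
Context (rho : 'cV[R]_n -> R) (krho : standard_kernel rho) (s : R) (s0 : 0 < s).
Implicit Types (u v w : 'cV[R]_n -> 'cV[R]_m) (x z : 'cV[R]_n).

Let k := mollifier rho s.

Let Ck1 : Ck 1 k. Proof. by have [] := mollifier_C1 krho s0. Qed.
Let ck : continuous k := Ck1.1.
Let ks : null_outside s k. Proof. by have [] := mollifier_C1 krho s0. Qed.
Let k0 : forall z, 0 <= k z. Proof. exact: mollifier_ge0. Qed.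

Lemma mollifier_bmeas : bmeas k.
Proof.
split; first exact: continuous_measurable_mx.
have [M M0 kM] := continuous_bounded_cball s ck.
exists M => x; have [xs|xs] := leP `|x| s; first exact: kM.
by rewrite ks// normr0 ltW.
Qed.

Lemma Rintegral_mollifier : \int[leb n]_z k z = 1.
Proof. by rewrite /Rintegral (mollifier_mass krho s0). Qed.

(** Substitution [y = x + z], together with evenness of the mollifier, displays the convolution as a
    weighted mean of translates, ready to be sampled. *)
Lemma convolution_translates u x i : Lploc p u ->
  convolution k u x i 0 = \int[leb n]_z (k z * u (x + z) i 0).
Proof.
move=> Lu; rewrite mxE.
have mu : measurable_fun setT (fun y : 'cV[R]_n => k (x - y) * u y i 0).
  apply: measurable_funM; last exact: (measurableT_comp (measurable_entry i 0) Lu.1).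
  by apply: continuous_measurable_mx; exact: continuous_reflect.
rewrite -(Rintegral_shift x mu); apply: eq_Rintegral => z _.
by rewrite opprD addrCA subrr addr0 /k (mollifierN s krho) addrC.
Qed.

Lemma translates_integrable u x i : Lploc p u ->
  (leb n).-integrable setT (EFin \o (fun z => k z * u (x + z) i 0)).
Proof.
move=> Lu; apply: (@kernel_integrable _ _ k (fun z => u (x + z) i 0) s) => //.
have := Lploc_entry i p1 (Lploc_shift x Lu).
by under eq_fun do rewrite addrC.
Qed.

Definition mean_translates u (zs : seq 'cV[R]_n) x : 'cV[R]_m :=
  (size zs)%:R^-1 *: \sum_(z <- zs) u (x + z).

Lemma Lploc_mean_translates u zs : Lploc p u -> Lploc p (mean_translates u zs).
Proof.
move=> Lu; have L0 : Lploc p (fun _ : 'cV[R]_n => 0 : 'cV[R]_m).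
  by apply: Lploc_continuous => // x; exact: cst_continuous.
have Ls : Lploc p (fun x => \sum_(z <- zs) u (x + z)).
  elim: zs => [|z zs IH]; first by under eq_fun do rewrite big_nil.
  under eq_fun do rewrite big_cons -[u _]scale1r -[X in _ + X]scale1r.
  exact: (@Lploc_lincomb _ _ _ _ p1 (fun x => u (x + z)) _ 1 1 (Lploc_shift z Lu) IH).
have := Lploc_lincomb p1 (size zs)%:R^-1 0 Ls L0.
by under eq_fun do rewrite scaler0 addr0.
Qed.

Lemma Lploc_convolution u : Lploc p u -> Lploc p (convolution k u).
Proof. by move=> Lu; apply: C1v_Lploc => // i; exact: (convolution_C1 i p1 krho s0 Lu). Qed.

Lemma enorm_powR_integrable u v r : Lploc p u -> Lploc p v ->
  (leb n).-integrable (cball r) (EFin \o (fun x => enorm (u x - v x) `^ p)).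
Proof.
move=> Lu Lv; have [r0|r0] := leP 0 r; last first.
  by rewrite cball_lt0//; exact: integrable_set0.
have E : (fun x => 1 *: u x + (-1) *: v x) = (fun x => u x - v x).
  by apply/funext => x; rewrite scale1r scaleN1r.
by have := Lploc_lincomb p1 1 (-1) Lu Lv; rewrite E => /LplocP[_ /(_ r r0)].
Qed.

(** Greedy sampling gives an L^2 bound. Where the error exceeds [eta], its p-th power is at most
    [B'^p], hence at most [B'^p / eta^2] times its square; elsewhere it is at most [eta^p].
    Boundedness of [w] thus turns L^2 into L^p for every [p >= 1]. *)
Lemma sampling_bounded w (M r e : R) : Lploc p w -> (forall x, enorm (w x) <= M) ->
  0 < e -> exists zs : seq 'cV[R]_n, [/\ (0 < size zs)%N,
    forall z, z \in zs -> 0 < k z &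
    \int[leb n]_(x in cball r) (enorm (convolution k w x - mean_translates w zs x) `^ p) <= e].
Proof.
move=> Lw wM e0.
have M0 : 0 <= M by rewrite (le_trans _ (wM 0))// enorm_ge0.
have wiM i x : `|w x i 0| <= M by rewrite (le_trans (ler_entry_enorm _ _)).
pose b := convolution k w.
have bM i x : `|b x i 0| <= M.
  rewrite /b convolution_translates//.
  rewrite (le_trans (le_normr_Rintegral _ (translates_integrable x i Lw)))//.
  have ik : (leb n).-integrable setT (EFin \o k) := continuous_integrable ck ks.
  rewrite -[leRHS]mulr1 -Rintegral_mollifier -RintegralZl//.
  apply: le_Rintegral => //.
  - exact: (integrable_norm (translates_integrable x i Lw)).
  - exact: integrable_scalef.
  by move=> z _; rewrite normrM ger0_norm// mulrC ler_wpM2r.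
have cb i : continuous (fun x => b x i 0).
  by have [] := convolution_C1 i p1 krho s0 Lw.
have mwi i : measurable_fun setT (fun x => w x i 0).
  exact: (measurableT_comp (measurable_entry i 0) Lw.1).
pose dev i (q : 'cV[R]_n * 'cV[R]_n) := w (q.2 + q.1) i 0 - b q.2 i 0.
have madd : measurable_fun setT (fun q : 'cV[R]_n * 'cV[R]_n => q.2 + q.1).
  apply: measurable_mxP => i j; under eq_fun do rewrite mxE.
  apply: measurable_funD.
    exact: (measurableT_comp (measurable_entry i j) measurable_snd).
  exact: (measurableT_comp (measurable_entry i j) measurable_fst).
have bdev i : bmeas (dev i).
  apply: bmeasB.
    by apply: (bmeas_comp madd (f := fun x => w x i 0)); split => //; exists M.
  apply: (bmeas_comp measurable_snd (f := fun x => b x i 0)); split; last by exists M.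
  exact: continuous_measurable_mx.
have dev0 i x : \int[leb n]_z (k z * dev i (z, x)) = 0.
  rewrite /dev /=; under eq_Rintegral do rewrite mulrBr.
  rewrite RintegralB//; last 2 first.
  - exact: translates_integrable.
  - under eq_fun do rewrite mulrC.
    by apply: integrable_scalef => //; exact: continuous_integrable ck ks.
  rewrite -convolution_translates// -/b.
  under eq_Rintegral do rewrite mulrC.
  rewrite RintegralZl//; last exact: continuous_integrable ck ks.
  by rewrite Rintegral_mollifier mulr1 subrr.
have [B B0 samp] := greedy_sampling r mollifier_bmeas k0 ks Rintegral_mollifier bdev dev0.
pose B' := m%:R * (2 * M).
pose V := fine (leb n (cball r : set 'cV[R]_n)).
have V0 : 0 <= V by rewrite fine_ge0.
(* Chosen so that [eta^p] integrates over the cube to at most [e / 2]. *)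
pose eta := (e / (2 * (V + 1))) `^ p^-1.
have V1 : 0 < V + 1 by rewrite ltr_wpDl.
have q0 : 0 < e / (2 * (V + 1)) by rewrite divr_gt0// mulr_gt0.
have eta0 : 0 < eta by rewrite powR_gt0.
have p0 : 0 < p by rewrite (lt_le_trans ltr01).
have etap : eta `^ p = e / (2 * (V + 1)) by rewrite -powRrM mulVf ?gt_eqF// powRr1// ltW.
pose c := B' `^ p * eta ^- 2.
have c0 : 0 <= c by rewrite mulr_ge0 ?powR_ge0// invr_ge0 exprn_ge0// ltW.
have cB0 : 0 < c * B + 1 by rewrite ltr_wpDl// mulr_ge0.
(* The number of samples is such that [c B / N <= e / 2]. *)
have [N0 _ NP] := near_infty_natSinv_lt (PosNum (divr_gt0 (divr_gt0 e0 (ltr0n R 2)) cB0)).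
have {NP} := NP N0 (leqnn _); rewrite /=; set N := N0.+1 => NP.
have [zs [zN zk S]] := samp N.
exists zs; split => //; first by rewrite zN.
have Nr : 0 < N%:R :> R by rewrite ltr0n.
have entry i x : (b x - mean_translates w zs x) i 0 = - (N%:R^-1 * \sum_(z <- zs) dev i (z, x)).
  have -> (y : 'cV[R]_m) : (y - mean_translates w zs x) i 0 =
      y i 0 - N%:R^-1 * \sum_(z <- zs) w (x + z) i 0 by rewrite !mxE summxE zN.
  rewrite /dev /= sumrB big_const_seq count_predT iter_addr_0 zN -[b x i 0 *+ N]mulr_natl.
  by rewrite mulrBr mulrA mulVf ?gt_eqF// mul1r opprB.
have bnd x : enorm (b x - mean_translates w zs x) <= B'.
  rewrite (le_trans (enorm_le_sum _))//.
  apply: le_trans (_ : \sum_(i < m) 2 * M <= _); last by rewrite sumr_const card_ord /B' [leRHS]mulr_natl.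
  apply: ler_sum => i _; rewrite entry normrN normrM ger0_norm ?invr_ge0 ?ler0n//.
  rewrite ler_pdivrMl//.
  apply: le_trans (ler_norm_sum _ _ _) _.
  apply: le_trans (_ : \sum_(z <- zs) 2 * M <= _).
    apply: ler_sum => z _; rewrite (le_trans (ler_normB _ _))// mulr2n mulrDl mul1r lerD//.
  by rewrite big_const_seq count_predT iter_addr_0 zN [leRHS]mulr_natl.
have ptw x : enorm (b x - mean_translates w zs x) `^ p <=
    eta `^ p + c * N%:R ^- 2 * \sum_i (\sum_(z <- zs) dev i (z, x)) ^+ 2.
  have en2 : enorm (b x - mean_translates w zs x) ^+ 2 =
      N%:R ^- 2 * \sum_i (\sum_(z <- zs) dev i (z, x)) ^+ 2.
    rewrite /enorm sqr_sqrtr ?sumr_ge0// => [|i _]; last exact: sqr_ge0.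
    by rewrite mulr_sumr; apply: eq_bigr => i _; rewrite entry sqrrN exprMn exprVn.
  rewrite -mulrA -en2.
  set E := enorm _; have E0 : 0 <= E by exact: enorm_ge0.
  have [Ee|Ee] := leP E eta.
    by rewrite (le_trans (ler_powR_nneg p1 E0 Ee))// lerDl mulr_ge0// exprn_ge0.
  apply: le_trans (_ : B' `^ p <= _).
    by apply: ler_powR_nneg => //; exact: bnd.
  rewrite /c -mulrA mulrC; rewrite ler_wpDl ?powR_ge0// ler_peMl ?powR_ge0//.
  by rewrite mulrC ler_pdivlMr ?exprn_gt0// mul1r lerXn2r ?nnegrE// ltW.
have bs : bmeas (fun x => \sum_i (\sum_(z <- zs) dev i (z, x)) ^+ 2).
  apply: bmeas_sum => i; apply: bmeasM; apply: bmeas_sum => z;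
  by apply: (@bmeas_comp _ _ _ _ _ (fun x => (z, x))) => //; exact: measurable_pair1.
have mC := @measurable_cball R n r.
have iC (f : 'cV[R]_n -> R) : bmeas f -> (leb n).-integrable (cball r) (EFin \o f).
  by apply: bmeas_integrable => //; exact: leb_cball_lty.
apply: (@le_trans _ _ (\int[leb n]_(x in cball r)
   (eta `^ p + c * N%:R ^- 2 * \sum_i (\sum_(z <- zs) dev i (z, x)) ^+ 2))).
  apply: le_Rintegral => //.
  - by apply: enorm_powR_integrable; [exact: Lploc_convolution|exact: Lploc_mean_translates].
  - apply: iC; apply: bmeasD; first exact: bmeas_cst.
    by apply: bmeasM => //; exact: bmeas_cst.
rewrite RintegralD//; last 2 first.
- by apply: iC; exact: bmeas_cst.
- by apply: iC; apply: bmeasM => //; exact: bmeas_cst.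
rewrite RintegralZl//; last exact: iC.
rewrite Rintegral_cst// -/V etap.
have H1 : e / (2 * (V + 1)) * V <= e / 2.
  rewrite invfM mulrA -mulrA ler_piMr ?divr_ge0 ?ltW//.
  by rewrite mulrC ltr_pdivrMr// mul1r ltrDl.
have H2 : c * N%:R ^- 2 * (\int[leb n]_(x in cball r) \sum_i (\sum_(z <- zs) dev i (z, x)) ^+ 2) <= e / 2.
  apply: le_trans (_ : c * N%:R ^- 2 * (N%:R * B) <= _).
    by rewrite ler_wpM2l// mulr_ge0// invr_ge0 exprn_ge0.
  rewrite (_ : _ * _ = N%:R^-1 * (c * B)); last by field; rewrite gt_eqF.
  move: NP; rewrite ltr_pdivlMr//; move: (c * B) => cB.
  rewrite mulrDr mulr1 => /ltW; apply: le_trans; by rewrite lerDl invr_ge0.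
lra.
Qed.

Definition truncate u (M : R) x : 'cV[R]_m := if enorm (u x) <= M then u x else 0.

Definition tail u (M : R) x : 'cV[R]_m := if enorm (u x) <= M then 0 else u x.

Lemma truncateD u M x : u x = truncate u M x + tail u M x.
Proof. by rewrite /truncate /tail; case: ifP; rewrite ?addr0 ?add0r. Qed.

Lemma measurable_if_cV (a : 'cV[R]_n -> bool) u v : measurable_fun setT a ->
  measurable_fun setT u -> measurable_fun setT v ->
  measurable_fun setT (fun x => if a x then u x else v x).
Proof.
move=> ma mu mv; apply: measurable_mxP => i j.
rewrite (_ : (fun x => _) = (fun x => if a x then u x i j else v x i j)); last first.
  by apply/funext => x; case: (a x).
apply: measurable_fun_ifT => //.
  exact: (measurableT_comp (measurable_entry i j) mu).
exact: (measurableT_comp (measurable_entry i j) mv).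
Qed.

Lemma measurable_tail u M : measurable_fun setT u -> measurable_fun setT (tail u M).
Proof.
move=> mu; apply: measurable_if_cV => //; apply: measurable_fun_ler => //.
exact: measurable_enorm.
Qed.

Lemma measurable_truncate u M : measurable_fun setT u -> measurable_fun setT (truncate u M).
Proof.
move=> mu; apply: measurable_if_cV => //; apply: measurable_fun_ler => //.
exact: measurable_enorm.
Qed.

Lemma enorm0 : enorm (0 : 'cV[R]_m) = 0.
Proof. by rewrite /enorm big1 ?sqrtr0// => i _; rewrite mxE expr0n. Qed.

Lemma enorm_tail u M x : enorm (tail u M x) <= enorm (u x).
Proof. by rewrite /tail; case: ifP; rewrite // enorm0 enorm_ge0. Qed.

Lemma enorm_truncate u M x : enorm (truncate u M x) <= enorm (u x).
Proof. by rewrite /truncate; case: ifP; rewrite // enorm0 enorm_ge0. Qed.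

Lemma Lploc_dominated u v : Lploc p u -> measurable_fun setT v ->
  (forall x, enorm (v x) <= enorm (u x)) -> Lploc p v.
Proof.
move=> /LplocP[mu Iu] mv vu; apply/LplocP; split => // r r0.
apply: (@le_integrable _ _ _ _ _ (@measurable_cball R n r) _ (EFin \o (fun x => enorm (u x) `^ p))).
- by apply/measurable_EFinP/measurable_funTS; exact: measurable_enorm_powR.
- move=> x _ /=; rewrite lee_fin !ger0_norm ?powR_ge0//.
  by apply: ler_powR_nneg => //; exact: enorm_ge0.
exact: Iu.
Qed.

(** Dominated convergence along integer levels: at each point the tail vanishes eventually. [M >= 1]
    will make the tail at most its own p-th power in norm. *)
Lemma tail_small u r e : 0 <= r -> Lploc p u -> 0 < e ->
  exists2 M, 1 <= M & \int[leb n]_(x in cball r) (enorm (tail u M x) `^ p) <= e.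
Proof.
move=> r0 Lu e0; have [mu /(_ r r0) Iu] := (LplocP p u).1 Lu.
have mC := @measurable_cball R n r.
pose f_ j x := (enorm (tail u j.+1%:R x) `^ p)%:E.
have mf j : measurable_fun (cball r) (f_ j).
  apply/measurable_EFinP/measurable_funTS; apply: measurable_enorm_powR; exact: measurable_tail.
have p0 : p != 0 by rewrite gt_eqF// (lt_le_trans ltr01).
have f0 : {ae leb n, forall x, cball r x -> f_ ^~ x @ \oo --> (cst 0%E x : \bar R)}.
  apply: aeW => x _; apply: cvg_near_cst.
  have [N xN] : exists N : nat, enorm (u x) <= N%:R.
    exists (Num.truncn (enorm (u x))).+1; have /andP[_ /ltW//] := truncn_itv (enorm_ge0 (u x)).
  exists N => // j /= Nj; rewrite /f_ /tail ifT ?enorm0 ?powR0//.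
  by rewrite (le_trans xN)// ler_nat (leq_trans Nj).
have fu : {ae leb n, forall x j, cball r x -> (`|f_ j x| <= (EFin \o (fun x => (enorm (u x) `^ p)%R)) x)%E}.
  apply: aeW => x j _; rewrite /f_ /= lee_fin ger0_norm ?powR_ge0//.
  by apply: ler_powR_nneg => //; [exact: enorm_ge0|exact: enorm_tail].
have [_ _] := dominated_convergence mC mf (measurable_cst _) f0 Iu fu.
have -> : (\int[leb n]_(x in cball r) cst 0 x = 0)%E by rewrite integral0.
move=> /fine_cvgP[_ /cvgrPdist_lt/(_ e e0)[N _ /(_ N (leqnn N))]].
rewrite /= sub0r normrN => /ltW NE; exists N.+1%:R; first by rewrite ler1n.
by rewrite (le_trans _ NE)// ler_norm.
Qed.

Lemma Rintegral_cball_shift_le (g : 'cV[R]_n -> R) r t z : `|z| <= t ->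
  (forall x, 0 <= g x) -> measurable_fun setT g ->
  (leb n).-integrable (cball r) (EFin \o (fun x => g (x + z))) ->
  (leb n).-integrable (cball (r + t)) (EFin \o g) ->
  \int[leb n]_(x in cball r) g (x + z) <= \int[leb n]_(x in cball (r + t)) g x.
Proof.
move=> zt g0 mg I1 I2; rewrite -lee_fin -!integral_EFin//; [|exact: measurable_cball..].
exact: integral_cball_shift_le.
Qed.

(** The truncated part is sampled. The tail enters through its convolution and through its mean over
    the sample points; both are bounded by the integral [I] of its p-th power over a larger cube,
    for any sample points in the support of the kernel. So the level [M] can be chosen before the
    points. *)
Lemma sampling u r e : 0 <= r -> Lploc p u -> 0 < e ->
  exists zs : seq 'cV[R]_n, [/\ (0 < size zs)%N,
    forall z, z \in zs -> enorm z < s &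
    \int[leb n]_(x in cball r) (enorm (convolution k u x - mean_translates u zs x) `^ p) <= e].
Proof.
move=> r0 Lu e0.
have [S S0 kS] : exists2 S, 0 < S & forall x, `|k x| <= S.
  have [M M0 kM] := continuous_bounded_cball s ck.
  exists M => // x; have [xs|xs] := leP `|x| s; first exact: kM.
  by rewrite ks// normr0 ltW.
pose V := fine (leb n (cball r : set 'cV[R]_n)).
have V0 : 0 <= V by rewrite fine_ge0.
pose K := m%:R `^ p * 2 `^ p.
have K0 : 0 <= K by rewrite mulr_ge0// powR_ge0.
pose cY := (m%:R * S) `^ p.
have cY0 : 0 <= cY by rewrite powR_ge0.
pose cZ := m%:R `^ p.
have cZ0 : 0 <= cZ by rewrite powR_ge0.
have K1 : 0 < K + 1 by rewrite ltr_wpDl.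
pose Q := K * K * (cY * V + cZ).
have Q0 : 0 <= Q by rewrite !(mulr_ge0, addr_ge0).
have Q1 : 0 < Q + 1 by rewrite ltr_wpDl.
(* The entry 1 gives [I^p <= I]; the other absorbs the constants of the two tail terms. *)
pose d := Num.min 1 (e / 2 / (Q + 1)).
have d0 : 0 < d by rewrite lt_min ltr01 !divr_gt0.
have rs0 : 0 <= r + s by rewrite addr_ge0// ltW.
have [M M1 dM] := tail_small rs0 Lu d0.
set I := \int[leb n]_(x in cball (r + s)) _ in dM.
have I0 : 0 <= I by apply: Rintegral_ge0 => x _; exact: powR_ge0.
have Lt : Lploc p (tail u M).
  by apply: (Lploc_dominated Lu); [apply: measurable_tail; case: Lu|exact: enorm_tail].
have Lw : Lploc p (truncate u M).
  by apply: (Lploc_dominated Lu); [apply: measurable_truncate; case: Lu|exact: enorm_truncate].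
have wM x : enorm (truncate u M x) <= M.
  by rewrite /truncate; case: ifP => //; rewrite enorm0 (le_trans ler01).
have eK : 0 < e / 2 / (K + 1) by rewrite !divr_gt0.
have [zs [zs0 zk zI]] := sampling_bounded r Lw wM eK.
exists zs; split => // [z /zk kz|].
  by apply: (mollifier_supp (rho := rho)) => //; rewrite gt_eqF.
pose X x := convolution k (truncate u M) x - mean_translates (truncate u M) zs x.
have {zI}zI : \int[leb n]_(x in cball r) (enorm (X x) `^ p) <= e / 2 / (K + 1) := zI.
pose Y x := convolution k (tail u M) x.
pose Z x := - mean_translates (tail u M) zs x.
have XYZ x : convolution k u x - mean_translates u zs x = X x + (Y x + Z x).
  have cE : convolution k u x = convolution k (truncate u M) x + Y x.
    apply/colP => i; rewrite [RHS]mxE !(convolution_translates x i)//.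
    rewrite -RintegralD//; [|exact: translates_integrable..].
    by apply: eq_Rintegral => z _; rewrite -mulrDr [in LHS](truncateD u M) mxE.
  have mE : mean_translates u zs x = mean_translates (truncate u M) zs x - Z x.
    rewrite /Z opprK /mean_translates -scalerDr -big_split/=; congr (_ *: _).
    by apply: eq_bigr => z _; exact: truncateD.
  by rewrite cE mE /X opprB [Z x - _]addrC addrACA.
have split2 (a b : 'cV[R]_m) : enorm (a + b) `^ p <= K * (enorm a `^ p + enorm b `^ p).
  apply: (le_trans (ler_powR_nneg p1 (enorm_ge0 _) (enormD_le a b))).
  rewrite powRM ?addr_ge0 ?enorm_ge0// /K -mulrA ler_wpM2l ?powR_ge0//.
  by apply: powR_add_le => //; exact: enorm_ge0.
(* Where it does not vanish, the tail has norm above [M >= 1]; so its L^1 norm is controlled by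
   [I]. *)
have tailp x : enorm (tail u M x) <= enorm (tail u M x) `^ p.
  rewrite /tail; case: ifP => [_|/negbT]; first by rewrite enorm0 powR_ge0.
  rewrite -ltNge => uM.
  by rewrite -[leLHS]powRr1 ?enorm_ge0// ler_powR// (le_trans M1)// ltW.
have tailE i : \int[leb n]_(y in cball (r + s)) `|tail u M y i 0| <= I.
  apply: le_Rintegral.
  - exact: measurable_cball.
  - by apply: integrable_norm; exact: (Lploc_entry i p1 Lt).2.
  - by have /LplocP[_] := Lt; apply.
  - by move=> x _; rewrite (le_trans (ler_entry_enorm _ _)).
have Yb x : cball r x -> enorm (Y x) `^ p <= cY * I.
  move=> xr; have Ye : enorm (Y x) <= m%:R * S * I.
    rewrite (le_trans (enorm_le_sum _))//.
    apply: le_trans (_ : \sum_(i < m) S * I <= _); last first.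
      by rewrite sumr_const card_ord -mulrA [leRHS]mulr_natl.
    apply: ler_sum => i _; rewrite /Y mxE.
    apply: (@le_trans _ _ (S * \int[leb n]_(y in cball (r + s)) `|tail u M y i 0|)).
      apply: (@kernel_le _ _ (fun y => k (x - y))) => //.
      - exact: continuous_reflect.
      - by apply: (null_outside_reflect ks); rewrite lerD2r.
      - exact: Lploc_entry Lt.
    by rewrite ler_wpM2l// ltW.
  apply: (le_trans (ler_powR_nneg p1 (enorm_ge0 _) Ye)).
  rewrite powRM ?mulr_ge0 ?(ltW S0)// ler_wpM2l//.
  by apply: powR_le_id => //; rewrite I0 (le_trans dM)// ge_min lexx.
pose W x := (size zs)%:R^-1 * \sum_(z <- zs) enorm (tail u M (x + z)) `^ p.
have Zb x : enorm (Z x) `^ p <= cZ * W x.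
  have Ze : enorm (Z x) <= m%:R * ((size zs)%:R^-1 * \sum_(z <- zs) enorm (tail u M (x + z))).
    rewrite (le_trans (enorm_le_sum _))//.
    apply: le_trans (_ : \sum_(i < m) ((size zs)%:R^-1 * \sum_(z <- zs) enorm (tail u M (x + z))) <= _); last first.
      by rewrite sumr_const card_ord [leRHS]mulr_natl.
    apply: ler_sum => i _.
    have -> : Z x i 0 = - ((size zs)%:R^-1 * \sum_(z <- zs) tail u M (x + z) i 0).
      by rewrite /Z /mean_translates !mxE summxE.
    rewrite normrN normrM ger0_norm ?invr_ge0// ler_wpM2l ?invr_ge0//.
    rewrite (le_trans (ler_norm_sum _ _ _))//; apply: ler_sum => z _; exact: ler_entry_enorm.
  apply: (le_trans (ler_powR_nneg p1 (enorm_ge0 _) Ze)).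
  have S1 : 0 <= \sum_(z <- zs) enorm (tail u M (x + z)) by apply: sumr_ge0 => z _; exact: enorm_ge0.
  rewrite powRM ?mulr_ge0 ?invr_ge0// ler_wpM2l//.
  by apply: powR_mean => // z; exact: enorm_ge0.
have mC := @measurable_cball R n r.
have iT z : (leb n).-integrable (cball r) (EFin \o (fun x => enorm (tail u M (x + z)) `^ p)).
  by have /LplocP[_] := Lploc_shift z Lt; apply.
have iX : (leb n).-integrable (cball r) (EFin \o (fun x => enorm (X x) `^ p)).
  by apply: enorm_powR_integrable; [exact: Lploc_convolution|exact: Lploc_mean_translates].
have iS : (leb n).-integrable (cball r) (EFin \o (fun x => \sum_(z <- zs) enorm (tail u M (x + z)) `^ p)).
  exact: integrable_sumf.
have ic c : (leb n).-integrable (cball r) (EFin \o (fun=> c)).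
  by apply: bmeas_integrable => //; [exact: leb_cball_lty|exact: bmeas_cst].
have iW : (leb n).-integrable (cball r) (EFin \o W) by exact: integrable_scalef.
have i1 : (leb n).-integrable (cball r) (EFin \o (fun x => cZ * W x)).
  exact: integrable_scalef.
have i2 : (leb n).-integrable (cball r) (EFin \o (fun x => cY * I + cZ * W x)).
  exact: integrable_addf.
have i3 : (leb n).-integrable (cball r) (EFin \o (fun x => K * K * (cY * I + cZ * W x))).
  exact: integrable_scalef.
have i4 : (leb n).-integrable (cball r) (EFin \o (fun x => K * enorm (X x) `^ p)).
  exact: integrable_scalef.
apply: (@le_trans _ _ (\int[leb n]_(x in cball r) (K * enorm (X x) `^ p +
    K * K * (cY * I + cZ * W x)))).
  apply: le_Rintegral; first exact: mC.
  - by apply: enorm_powR_integrable; [exact: Lploc_convolution|exact: Lploc_mean_translates].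
  - exact: (integrable_addf mC i4 i3).
  move=> x xr; rewrite XYZ (le_trans (split2 _ _))// mulrDr lerD2l -mulrA ler_wpM2l//.
  by rewrite (le_trans (split2 _ _))// ler_wpM2l// lerD ?Yb.
rewrite RintegralD// RintegralZl// [X in _ + X]RintegralZl// RintegralD// Rintegral_cst// -/V.
rewrite [X in _ + K * K * (_ + X)]RintegralZl// [X in _ + K * K * (_ + _ * X)]RintegralZl//.
rewrite Rintegral_sum//.
have SI : (size zs)%:R^-1 * \sum_(z <- zs) \int[leb n]_(x in cball r) (enorm (tail u M (x + z)) `^ p) <= I.
  apply: (mean_le zs0) => z zz.
  have kz := zk z zz.
  apply: (@Rintegral_cball_shift_le (fun x => enorm (tail u M x) `^ p)).
  - rewrite leNgt; apply/negP => zs'; move: kz; rewrite ks ?ltxx//.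
  - by move=> x; exact: powR_ge0.
  - by apply: measurable_enorm_powR; case: Lt.
  - exact: iT.
  - by have /LplocP[_] := Lt; apply.
have KX : K * \int[leb n]_(x in cball r) (enorm (X x) `^ p) <= e / 2.
  apply: (le_trans (ler_wpM2l K0 zI)).
  rewrite mulrC mulrAC ler_pdivrMr// ler_pM2l ?divr_gt0// lerDl//.
have QI : Q * I <= e / 2.
  apply: le_trans (_ : Q * (e / 2 / (Q + 1)) <= _).
    by rewrite ler_wpM2l// (le_trans dM)// ge_min lexx orbT.
  rewrite mulrC mulrAC ler_pdivrMr// ler_pM2l ?divr_gt0// lerDl//.
apply: (@le_trans _ _ (e / 2 + Q * I)); last by rewrite [leRHS]splitr lerD2l.
apply: lerD; first exact: KX.
rewrite /Q -[K * K * _ * I]mulrA; apply: ler_wpM2l; first exact: mulr_ge0.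
rewrite mulrDl [cY * V * I]mulrAC lerD2l; apply: ler_wpM2l; first exact: cZ0.
exact: SI.
Qed.

End sampling_mollifier.

(** * The mollification inequality *)

Section cutoff.
Context {R : realType} (m n : nat) (p : R) (p1 : 1 <= p).
Implicit Types (u v : 'cV[R]_n -> 'cV[R]_m) (r : R).

Let p0 : 0 < p. Proof. exact: lt_le_trans p1. Qed.

(** Lower semicontinuity is assumed on L^p, while mollifications are only locally in L^p. By
    locality [alpha] does not see the cutoff on copies inside the cube. *)
Definition cutoff r v x : 'cV[R]_m := if `|x| <= r then v x else 0.

Lemma measurable_cutoff r v : measurable_fun setT v -> measurable_fun setT (cutoff r v).
Proof.
move=> mv; apply: measurable_if_cV => //.
apply: measurable_fun_ler => //; apply: continuous_measurable_mx => x.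
exact: norm_continuous.
Qed.

Lemma Lploc_cutoff r v : Lploc p v -> Lploc p (cutoff r v).
Proof.
move=> Lv; apply: (Lploc_dominated p1 Lv); first by apply: measurable_cutoff; case: Lv.
by move=> x; rewrite /cutoff; case: ifP; rewrite // enorm0 enorm_ge0.
Qed.

Lemma cutoff_integral r u v : Lploc p u -> Lploc p v ->
  (\int[leb n]_x (enorm (cutoff r u x - cutoff r v x) `^ p)%:E =
   (\int[leb n]_(x in cball r) (enorm (u x - v x) `^ p))%:E)%E.
Proof.
move=> Lu Lv; rewrite -integral_EFin; [|exact: measurable_cball|exact: enorm_powR_integrable].
rewrite [RHS]integral_mkcond; apply: eq_integral => x _.
rewrite patchE /cutoff; case: ifPn => [xr|/negP xr].
  by rewrite mem_set.
rewrite memNset//.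
by rewrite subrr enorm0 powR0// gt_eqF.
Qed.

Lemma Lp_cutoff r v : Lploc p v -> Lp p (cutoff r v).
Proof.
move=> Lv; split; first by apply: measurable_cutoff; case: Lv.
have L0 : Lploc p (fun _ : 'cV[R]_n => 0 : 'cV[R]_m).
  by apply: Lploc_continuous => // x; exact: cst_continuous.
have := cutoff_integral r Lv L0; under eq_integral do rewrite [cutoff r _ _ in X in _ - X]/cutoff if_same subr0.
by move=> ->; exact: ltry.
Qed.

Lemma Lp_dist_cutoff r u v (e : R) : 0 <= e -> Lploc p u -> Lploc p v ->
  \int[leb n]_(x in cball r) (enorm (u x - v x) `^ p) <= e `^ p ->
  (Lp_dist p (cutoff r u) (cutoff r v) <= e%:E)%E.
Proof.
move=> e0 Lu Lv H; rewrite /Lp_dist unlock.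
under eq_integral do rewrite gee0_abs ?lee_fin ?enorm_ge0// poweR_EFin.
rewrite cutoff_integral// poweR_EFin lee_fin.
rewrite -[leRHS](powRr1 e0) -(mulfV (lt0r_neq0 p0)) powRrM.
apply: ge0_ler_powR => //; rewrite ?invr_ge0 ?(ltW p0)// nnegrE.
- by apply: Rintegral_ge0 => x _; exact: powR_ge0.
- exact: powR_ge0.
Qed.

End cutoff.

Section segment_in_open.
Context {R : realType} (n : nat).

(** The parameters at which the segment from [x] to [x + z] lies in [U] form a nonempty subset of
    [[0, 1]], open, and closed because the segment is too short to reach the boundary; connectedness
    makes it all of [[0, 1]]. *)
Lemma translate_inside (U V : set 'cV[R]_n) (s : R) x z : open U -> V `<=` U ->
  (s%:E < euclid_dist V (boundary U))%E -> V x -> enorm z < s -> U (x + z).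
Proof.
move=> oU VU sd Vx zs.
pose f (t : R) := x + t *: z.
have cf : continuous f.
  move=> t; apply: continuous_mx_entries => i j.
  rewrite (_ : (fun t => _) = (fun t => x i j + t * z i j)); last by apply/funext => t'; rewrite !mxE.
  have ci : continuous (fun t : R => t) by move=> t'; exact: cvg_id.
  have cc : continuous (fun t : R => x i j + t * z i j).
    apply: continuous_addf; first exact: continuous_cstf.
    by apply: continuous_mulf => //; exact: continuous_cstf.
  exact: cc.
have nob t : 0 <= t <= 1 -> closure U (f t) -> U (f t).
  move=> /andP[t0 t1] clU; apply: contrapT => nU.
  have : (euclid_dist V (boundary U) <= (enorm (x - f t))%:E)%E.
    apply: ereal_inf_lbound; exists x => //; exists (f t) => //.
    by split => // /interior_subset.
  rewrite leNgt => /negP; apply; apply: lt_trans sd; rewrite lte_fin.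
  rewrite /f opprD addrA subrr sub0r -scaleN1r !enormZ normrN1 mul1r ger0_norm//.
  by rewrite (le_lt_trans _ zs)// ler_piMl// enorm_ge0.
have E : `[0, 1]%classic `&` f @^-1` U = `[0, 1]%classic.
  apply: (@segment_connected R 0 1).
  - exists 0; split; first by rewrite /= in_itv/= lexx ler01.
    by rewrite /= /f scale0r addr0; exact: VU.
  - exists (f @^-1` U) => //; apply: open_comp => // t _; exact: cf.
  - exists (f @^-1` (closure U)); first by apply: closed_comp; [move=> t _; exact: cf|exact: closed_closure].
    apply/seteqP; split => t [/=]; rewrite in_itv /= => t01 Ut; split => //.
      exact: subset_closure.
    exact: nob.
have : `[0, 1]%classic (1 : R) by rewrite /= in_itv /= lexx ler01.
by rewrite -E => -[_]; rewrite /= /f scale1r.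
Qed.

End segment_in_open.

Section mollification.
Context {R : realType} (m n : nat) (p : R) (p1 : 1 <= p).
Context (G : set 'M[R]_n) (subG : SO_subgroup G).
Context (D : set 'cV[R]_n).
Context (alpha : ('cV[R]_n -> 'cV[R]_m) -> set 'cV[R]_n -> R).
Context (alpha_core : p_core_functional p G D alpha).
Context (alpha_lsc : forall D', all_copies G D setT D' -> lsc_Lp p (fun u => alpha u D')).
Implicit Types (u v : 'cV[R]_n -> 'cV[R]_m).

Lemma alpha_cutoff r v D' : Lploc p v -> all_copies G D setT D' -> D' `<=` cball r ->
  alpha (cutoff r v) D' = alpha v D'.
Proof.
move=> Lv aD sub; apply: (core_local alpha_core); [exact: Lploc_cutoff|exact: Lv|exact: aD|].
by apply: aeW => x /sub xr; rewrite /cutoff ifT.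
Qed.

Lemma alpha_lsc_local r v D' tau : Lploc p v -> all_copies G D setT D' ->
  D' `<=` cball r -> 0 < tau -> exists2 e : R, 0 < e & forall w, Lploc p w ->
    \int[leb n]_(x in cball r) (enorm (v x - w x) `^ p) <= e ->
    alpha v D' <= alpha w D' + tau.
Proof.
move=> Lv aD sub t0.
have [|e e0 H] := alpha_lsc aD (Lp_cutoff p1 r Lv) (a := alpha v D' - tau).
  by rewrite alpha_cutoff// ltrBlDr ltrDl.
have e2 : 0 < e / 2 by rewrite divr_gt0.
(* Half of [e] turns the non-strict bound on the integral into a strict one for [Lp_dist]. *)
exists ((e / 2) `^ p); first exact: powR_gt0.
move=> w Lw vw; rewrite -lerBlDr ltW// -(alpha_cutoff Lw aD sub).
apply: H; first exact: Lp_cutoff.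
apply: le_lt_trans (Lp_dist_cutoff p1 (ltW e2) Lv Lw vw) _.
by rewrite lte_fin ltr_pdivrMr// ltr_pMr// ltr1n.
Qed.

Lemma alpha_lsc_seq r v (s : seq (set 'cV[R]_n)) tau : Lploc p v ->
  (forall D', D' \in s -> all_copies G D setT D' /\ D' `<=` cball r) -> 0 < tau ->
  exists2 e : R, 0 < e & forall w, Lploc p w ->
    \int[leb n]_(x in cball r) (enorm (v x - w x) `^ p) <= e ->
    forall D', D' \in s -> alpha v D' <= alpha w D' + tau.
Proof.
move=> Lv + t0; elim: s => [_|D1 s IH sP]; first by exists 1.
have [e1 e10 H1] := IH (fun D' sD => sP D' (mem_behead (s := D1 :: s) sD)).
have [aD sub] := sP D1 (mem_head _ _).
have [e2 e20 H2] := alpha_lsc_local Lv aD sub t0.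
exists (Num.min e1 e2); first by rewrite lt_min e10.
move=> w Lw; rewrite le_min => /andP[w1 w2] D'; rewrite inE => /predU1P[->|sD].
  exact: H2.
exact: H1 sD.
Qed.

Lemma alpha_mean_translates u (zs : seq 'cV[R]_n) D' : Lploc p u ->
  all_copies G D setT D' -> (0 < size zs)%N ->
  alpha (mean_translates u zs) D' <=
    (size zs)%:R^-1 * \sum_(z <- zs) alpha u (similarity 1 1%:M z @` D').
Proof.
move=> Lu aD zs0.
have cvx (v w : 'cV[R]_n -> 'cV[R]_m) (t : R) : Lploc p v -> Lploc p w -> 0 <= t <= 1 ->
    Lploc p (t *: v + (1 - t) *: w) /\
    alpha (t *: v + (1 - t) *: w) D' <= t * alpha v D' + (1 - t) * alpha w D'.
  move=> Lv Lw t01; split; first exact: Lploc_lincomb.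
  exact: (core_convex alpha_core).
have [_] := convex_mean (Phi := fun v => alpha v D') cvx zs0
   (f := fun z x => u (x + z)) (fun z _ => Lploc_shift z Lu).
rewrite (_ : _ *: _ = mean_translates u zs); last first.
  by apply/funext => x; rewrite /mean_translates /= fct_sumE.
move=> /le_trans; apply; rewrite ler_wpM2l ?invr_ge0//; apply: ler_sum => z _.
rewrite (alpha_homothety subG alpha_core)//.
rewrite (_ : _ \o _ = (fun x => u (x + z)))//.
by apply/funext => x /=; rewrite similarity1E scale1r.
Qed.

(** The inequality holds at each fixed scale, since translation preserves the size of copies. The
    order of choices matters: the packing, then the tolerance from semicontinuity, then the sample
    points. *)
Lemma bmo_eps_mollify (rho : 'cV[R]_n -> R) u (s e : R) (U V : set 'cV[R]_n) :
  standard_kernel rho -> 0 < s -> Lploc p u -> open U -> V `<=` U -> bounded_set V ->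
  (s%:E < euclid_dist V (boundary U))%E -> 0 < e ->
  (bmo_eps p G D alpha e (convolution (mollifier rho s) u) V <=
   bmo_eps p G D alpha e u U)%E.
Proof.
move=> krho s0 Lu oU VU bV sd e0.
set us := convolution _ _.
have Lus : Lploc p us by exact: Lploc_convolution.
apply: (bmo_eps_le alpha_core) => // l pl; have [cl _] := pl.
have [r r0 Vr] := bounded_cball bV.
have lP D' : D' \in l -> all_copies G D setT D' /\ D' `<=` cball r.
  move=> /cl[c _]; split; first exact: copies_all c.
  by case: c => A [h [_ -> sV]]; exact: subset_trans Vr.
have b0 : (0 <= bmo_eps p G D alpha e u U)%E.
  have pn : packs G D e U [::] by split.
  have := psum_le_bmo_eps alpha_core e0 Lu pn.
  by rewrite /psum big_nil mulr0.
(* The value [+oo] is trivial, and the empty packing has excluded [-oo]. *)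
move: b0; case bE : (bmo_eps p G D alpha e u U) => [b| |] //; last by move=> _; rewrite leey.
move=> _; rewrite lee_fin; set c := e `^ (n%:R - p).
have c0 : 0 < c by rewrite powR_gt0.
apply: (@le_eps _ _ _ (c * (size l)%:R)); first by rewrite mulr_ge0// ltW.
move=> tau t0.
have [d d0 H] := alpha_lsc_seq Lus lP t0.
have [zs [zs0 zss zsI]] := sampling p1 krho s0 (ltW r0) Lu d0.
have {}H := H _ (Lploc_mean_translates p1 zs Lu) zsI.
have shift z : z \in zs -> psum p alpha e u [seq similarity 1 1%:M z @` D' | D' <- l] <= b.
  move=> zz; rewrite -lee_fin -bE; apply: (psum_le_bmo_eps alpha_core) => //.
  have := packs_homothety z ltr01 pl; rewrite mul1r; apply: packs_subset.
  move=> _ [x Vx <-]; rewrite similarity1E scale1r; exact: translate_inside sd Vx (zss z zz).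
apply: le_trans (_ : c * \sum_(D' <- l) (tau +
    (size zs)%:R^-1 * \sum_(z <- zs) alpha u (similarity 1 1%:M z @` D')) <= _).
  rewrite /psum -/c ler_wpM2l ?(ltW c0)// big_seq [leRHS]big_seq; apply: ler_sum => D' lD.
  rewrite (le_trans (H D' lD))// addrC lerD2l; apply: alpha_mean_translates => //.
  by case: (lP D' lD).
rewrite big_split /= mulrDr big_const_seq count_predT iter_addr_0 addrC; apply: lerD; last first.
  by rewrite -[tau *+ _]mulr_natr [leLHS]mulrCA.
(* After the exchange, each inner sum belongs to the packing translated by [z] and is at most [b];
   so is their mean. *)
rewrite -mulr_sumr exchange_big /= mulrCA mulr_sumr.
apply: mean_le => // z zz; have := shift z zz.
by rewrite /psum big_map.
Qed.

End mollification.

(** * Coercivity of psi and conclusion *)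

Section coercivity.
Context {R : realType} (m n : nat) (n_gt0 : (0 < n)%N) (p : R) (p1 : 1 <= p).
Context (G : set 'M[R]_n) (subG : SO_subgroup G).
Context (D : set 'cV[R]_n) (openD : open D) (bndD : bounded_set D).
Context (alpha : ('cV[R]_n -> 'cV[R]_m) -> set 'cV[R]_n -> R).
Context (alpha_core : p_core_functional p G D alpha).
Implicit Types A B : 'M[R]_(m, n).

Notation psi := (psi p G D alpha).

Let ge0 A : 0 <= psi A. Proof. exact: psi_ge0. Qed.

Lemma psi_eq0P A : core_null p G D alpha A <-> psi A = 0.
Proof.
rewrite /core_null /= (core_psiE n_gt0 p1 subG openD bndD alpha_core).
by split => [[]|->].
Qed.

(** In [psi_split] the weight of [psi (- B)] may explode as [l] tends to 0, but it multiplies zero,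
    while the weight of [psi A] tends to 1. *)
Lemma psi_subr_null A B : psi B = 0 -> psi (A - B) <= psi A.
Proof.
move=> B0; have NB0 : psi (- B) = 0.
  apply/eqP; rewrite eq_le ge0 andbT -B0.
  have := psi_scale n_gt0 p1 subG openD bndD alpha_core (- B) (t := -1).
  by rewrite oppr_eq0 oner_eq0 normrN1 powR1 mul1r scaleN1r opprK; apply.
apply/ler_addgt0Pl => tau t0.
have [l l01 lt] := cvx_weight_near1 p1 (ge0 A) t0.
apply: (le_trans (psi_split n_gt0 p1 subG openD bndD alpha_core A (- B) l01)).
by rewrite NB0 mulr0 addr0 [leRHS]addrC.
Qed.

(** A basis of [P] gives coordinates in which the unit sphere is compact; the minimum of [psi] there
    is positive by hypothesis. Homogeneity extends the bound to [P], and [K] compares the operator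
    norm with the coordinate norm. *)
Lemma psi_coercive (P : {vspace 'M[R]_(m, n)}) : (forall A, A \in P -> psi A = 0 -> A = 0) ->
  exists2 C : R, 0 < C & forall A, A \in P -> C * opnorm A `^ p <= psi A.
Proof.
move=> P0; pose d := \dim P; pose b := vbasis P.
have p_gt0 : 0 < p by exact: lt_le_trans p1.
pose L (c : 'cV[R]_d) : 'M[R]_(m, n) := \sum_i c i 0 *: b`_i.
have LP c : L c \in P.
  by apply: rpred_sum => i _; apply: rpredZ; apply: vbasis_mem; rewrite mem_nth// size_tuple.
have Lsurj A : A \in P -> A = L (\col_i coord b i A).
  by move=> AP; rewrite [LHS](coord_vbasis AP); apply: eq_bigr => i _; rewrite mxE.
have Linj c : L c = 0 -> c = 0.
  move=> Lc; apply/colP => i; have := coord_sum_free (fun i => c i 0) i (basis_free (vbasisP P)).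
  by rewrite -/(L c) Lc linear0 mxE.
have LZ t c : L (t *: c) = t *: L c.
  by rewrite /L scaler_sumr; apply: eq_bigr => i _; rewrite mxE scalerA.
have cL : continuous (psi \o L).
  move=> c; apply: continuous_comp; last exact: (psi_continuous n_gt0 p1 subG openD bndD alpha_core).
  apply: continuous_mx_entries => i j.
  rewrite (_ : (fun y => L y i j) = (fun y => \sum_k y k 0 * (b`_k) i j)); last first.
    by apply/funext => y; rewrite summxE; apply: eq_bigr => k _; rewrite mxE.
  apply: continuous_at_sum => k.
  have cc : continuous (fun y : 'cV[R]_d => y k 0 * (b`_k) i j).
    by apply: continuous_mulf; [exact: coord_continuous|exact: continuous_cstf].
  exact: cc.
pose K := m%:R * n%:R * (\sum_(i < d) `|b`_i|) + 1.
have K0 : 0 < K by rewrite ltr_wpDl// !mulr_ge0// sumr_ge0.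
have LK c : opnorm (L c) <= K * `|c|.
  have [_ H] := opnorm_bounds (L c); apply: (le_trans H).
  apply: (@le_trans _ _ (m%:R * n%:R * ((\sum_(i < d) `|b`_i|) * `|c|))).
    rewrite ler_wpM2l ?mulr_ge0// mulr_suml (le_trans (ler_norm_sum _ _ _))//.
    apply: ler_sum => i _; rewrite normrZ mulrC ler_wpM2l//; exact: ler_mx_norm_entry.
  by rewrite mulrA ler_wpM2r// /K lerDl.
pose S : set 'cV[R]_d := [set c | `|c| = 1].
have normS c : c != 0 -> S (`|c|^-1 *: c).
  by move=> c0; rewrite /S /= normrZ normfV normr_id mulVf// normr_eq0.
(* An empty sphere means that [P] is zero, and then only [A = 0] occurs. *)
have [S0|noS] := pselect (S !=set0); last first.
  exists 1 => // A AP; have -> : A = 0; last by rewrite opnorm0 powR0 ?gt_eqF// mulr0.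
  rewrite (Lsurj A AP); set c := \col_i _.
  have [->|/normS Sc] := eqVneq c 0; last by exfalso; apply: noS; eexists; exact: Sc.
  by rewrite /L big1// => i _; rewrite mxE scale0r.
have cS : compact S.
  apply: (subclosed_compact _ (compact_cball (n := d) ler01)).
    have := @closed_comp _ _ (fun c : 'cV[R]_d => `|c|) [set 1].
    apply; last exact: closed_eq.
    by move=> c _; exact: norm_continuous.
  by move=> c; rewrite /S /cball /= => ->.
have [c0 /set_mem Sc0 min] := compact_EVT_min S0 cS (continuous_subspaceT cL).
have k0 : 0 < psi (L c0).
  rewrite lt_neqAle ge0 andbT eq_sym; apply/eqP => z.
  have /Linj c00 := P0 _ (LP c0) z.
  by move: Sc0; rewrite /S /= c00 normr0 => /eqP; rewrite eq_sym oner_eq0.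
exists (psi (L c0) / K `^ p); first by rewrite divr_gt0 ?powR_gt0.
move=> A AP; rewrite (Lsurj A AP); set c := \col_i _.
have [c_0|cn0] := eqVneq c 0.
  have -> : L c = 0 by rewrite c_0 /L big1// => i _; rewrite mxE scale0r.
  by rewrite opnorm0 powR0 ?gt_eqF// mulr0.
have n0 : 0 < `|c| by rewrite normr_gt0.
apply: (@le_trans _ _ (psi (L c0) / K `^ p * (K * `|c|) `^ p)).
  rewrite ler_wpM2l ?divr_ge0 ?ge0 ?powR_ge0//; apply: ler_powR_nneg => //.
  by have [] := opnorm_bounds (L c).
rewrite powRM ?(ltW K0)// mulrA divfK ?gt_eqF ?powR_gt0//.
have := psi_scale n_gt0 p1 subG openD bndD alpha_core (L (`|c|^-1 *: c)) (t := `|c|).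
rewrite gt_eqF// => /(_ isT); rewrite normr_id LZ scalerA divff ?gt_eqF// scale1r.
apply: le_trans; rewrite mulrC ler_wpM2l ?powR_ge0// -LZ; apply: min.
exact: mem_set (normS _ cn0).
Qed.

End coercivity.

Section limit_inferior.
Context {R : realType}.

(** Near 0 on the right [f], and hence [g], exceeds [l - tau]; this neighbourhood competes in the
    supremum of infima that defines the lower limit. *)
Lemma cvg_le_limf_einf (f g : R -> \bar R) (l : R) :
  f e @[e --> 0^'+] --> l%:E -> (forall e, 0 < e -> (f e <= g e)%E) ->
  (l%:E <= limf_einf g 0^'+)%E.
Proof.
move=> fl fg; apply/lee_addgt0Pr => tau t0; rewrite -leeBlDr//.
rewrite limf_einfE.
pose N := [set e | 0 < e /\ (l%:E - tau%:E < f e)%E].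
apply: (@le_trans _ _ (ereal_inf (g @` N))).
  apply: le_ereal_inf_tmp => _ [e [e0 /ltW fe] <-].
  by rewrite (le_trans fe)// fg.
apply: ereal_sup_ubound; exists N => //.
apply: filterI; first exact: nbhs_right_gt.
have lt : (l%:E - tau%:E < l%:E)%E by rewrite -EFinB lte_fin ltrBlDr ltrDl.
exact: (fl _ (open_ereal_gt' lt)).
Qed.

End limit_inferior.

Theorem corollary4p1 (R : realType) (n m : nat) (n_gt0 : (0 < n)%N)
  (m_gt0 : (0 < m)%N) (p : R) (p_ge1 : 1 <= p)
  (G : set 'M[R]_n) (subG : SO_subgroup G)
  (D : set 'cV[R]_n) (openD : open D) (bndD : bounded_set D)
  (alpha : ('cV[R]_n -> 'cV[R]_m) -> set 'cV[R]_n -> R)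
  (alpha_core : p_core_functional p G D alpha)
  (alpha_lsc : forall D', all_copies G D setT D' ->
     lsc_Lp p (fun u => alpha u D'))
  (P : {vspace 'M[R]_(m, n)})
  (P_null : direct_sum_decomposition P (core_null p G D alpha))
  (piP : 'M[R]_(m, n) -> 'M[R]_(m, n))
  (piP_proj : projection_along P (core_null p G D alpha) piP) :
  exists2 C : R, 0 < C &
    forall (Omega Omega' : set 'cV[R]_n) (rho : 'cV[R]_n -> R)
      (u : 'cV[R]_n -> 'cV[R]_m) (sigma : R),
    open Omega -> open Omega' -> compactly_contained Omega' Omega ->
    standard_kernel rho -> Lploc p u ->
    0 < sigma -> (sigma%:E < euclid_dist Omega' (boundary Omega))%E ->
    let us := convolution (mollifier rho sigma) u in
    let psi := core_psi p G D alpha in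
    [/\ (C%:E * \int[leb n]_(x in Omega') ((opnorm (piP (grad us x))) `^ p)%:E
           <= \int[leb n]_(x in Omega') psi (grad us x))%E,
        has_bmo p G D alpha us Omega',
        (\int[leb n]_(x in Omega') psi (grad us x))%E
           = bmo p G D alpha us Omega' &
        (bmo p G D alpha us Omega' <= bmo_inf p G D alpha u Omega)%E].
Proof.
have psiE := core_psiE n_gt0 p_ge1 subG openD bndD alpha_core.
have null0 := psi_eq0P n_gt0 p_ge1 subG openD bndD alpha_core.
(* [C] is obtained before the sets, the kernel and [u] are introduced, hence independent of them. *)
have [C C0 HC] : exists2 C : R, 0 < C & forall A, A \in P ->
    C * opnorm A `^ p <= psi p G D alpha A.
  apply: psi_coercive => // A AP A0.
  have : ([set` P] `&` core_null p G D alpha) A by split => //; exact/null0.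
  by rewrite P_null.2.
exists C => // Omega Omega' rho u s oO oO' [cO' sO'] krho Lu s0 sd us psi0.
have subO : Omega' `<=` Omega by exact: subset_trans (@subset_closure _ _) sO'.
have bO' : bounded_set Omega'.
  have [M [Mr HM]] := compact_bounded cO'.
  by exists M; split => // N MN x /subset_closure Ox; exact: HM Ox.
have mO' := open_measurable_mx oO'.
have Cus : C1v us by move=> i; exact: (convolution_C1 i p_ge1 krho s0 Lu).
have cpsi : continuous (fun x => psi p G D alpha (grad us x)).
  move=> x; apply: continuous_comp; first exact: C1v_grad_continuous.
  exact: (psi_continuous n_gt0 p_ge1 subG openD bndD alpha_core).
have mpsi : measurable_fun Omega' (fun x => (psi p G D alpha (grad us x))%:E).
  by apply/measurable_EFinP/measurable_funTS; exact: continuous_measurable_mx.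
have ipsi : (leb n).-integrable Omega' (EFin \o (fun x => psi p G D alpha (grad us x))).
  have [r r0 Or] := bounded_cball bO'.
  have [M M0 HM] := continuous_bounded_cball r cpsi.
  apply: (integrableS (measurable_cball r) mO' Or).
  by apply: (integrable_cball (M := M)) => //; exact: continuous_measurable_mx.
have intE : (\int[leb n]_(x in Omega') psi0 (grad us x) =
    (\int[leb n]_(x in Omega') psi p G D alpha (grad us x))%:E)%E.
  by rewrite -integral_EFin//; apply: eq_integral => x _; rewrite /psi0 psiE.
have lim := C1_bmo_limit n_gt0 p_ge1 subG openD bndD alpha_core Cus oO' bO'.
have bmoE : bmo p G D alpha us Omega' = (\int[leb n]_(x in Omega') psi p G D alpha (grad us x))%:E.
  exact/cvg_lim.
split.
- rewrite intE -integral_EFin//; apply: ge0_integral_le_scale => //.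
  + by move=> x _; rewrite lee_fin powR_ge0.
  (* [piP] changes the gradient by a null matrix, whose subtraction does not increase [psi];
     coercivity applies to the part in [P]. *)
  move=> x _; have [PA NA] := piP_proj (grad us x).
  rewrite -EFinM lee_fin (le_trans (HC _ PA))//.
  have := psi_subr_null n_gt0 p_ge1 subG openD bndD alpha_core (grad us x) ((null0 _).1 NA).
  by rewrite opprB addrC subrK.
- by apply/cvg_ex; eexists; exact: lim.
- by rewrite intE bmoE.
- rewrite bmoE; apply: cvg_le_limf_einf lim _ => e e0.
  exact: (bmo_eps_mollify p_ge1 subG alpha_core alpha_lsc krho s0 Lu oO subO bO' sd e0).
Qed.
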